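(* Let $\widehat{G}$ be a signed bigraph. Then $\widehat{G}$ is chordal if and only if it is $\mathcal{F}$-free, i.e. it contains no signed graph in $\mathcal F=F_1\cup\cdots\cup F_6\cup\mathcal C\cup D\cup\mathcal S\cup\mathcal J$ as an induced subgraph.
   Context: A signed graph is a finite simple graph each of whose edges is assigned a sign, positive or negative. A signed bigraph is a signed graph whose underlying graph is bipartite. An induced subgraph is obtained by deleting vertices only; containing $H$ as an induced subgraph means some induced subgraph is isomorphic to $H$ via a sign-preserving isomorphism. A signed graph is positive if all its edges are positive. In a bigraph with bipartition $(X,Y)$, a subgraph $H$ is a biclique if every vertex of $V(H)\cap X$ is adjacent to every vertex of $V(H)\cap Y$. For an edge $uv$, $N(uv)=(N(u)\cup N(v))\setminus\{u,v\}$; $uv$ is signed simplicial if $N(uv)$ induces a positive biclique. A signed bigraph $\widehat G$ is chordal if its edges can be ordered $e_1,\dots,e_m$ so that each $e_i$ is signed simplicial in $\widehat G-\{e_1,\dots,e_{i-1}\}$ (edges deleted, vertices kept). A family specified by a graph with edges declared negative, positive or free is the set of all signed graphs obtained by giving free edges arbitrary signs. Tadpoles: for $k\ge1$, a tadpole of type 1 has distinct vertices $w,y,z,x_1,\dots,x_k$ and edges exactly $x_ky,x_kz$ (negative), $wy,wz$ (free) and $x_ix_{i+1}$, $1\le i<k$ (free). For $k\ge2$, a tadpole of type 2 is the same with the additional negative edge $wx_{k-1}$. The end is $x_1$; the heads are $w,y,z$. Sum of tadpoles $T,T'$ (disjoint, ends $x,x'$): identify $x$ with $x'$. Join of $T,T'$: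 fix a bipartition of the disjoint union $T\cup T'$ (either relative orientation of the two tadpoles), then add a positive edge from $x$ to every vertex of $T'$ in the part opposite to $x$ and a positive edge from $x'$ to every vertex of $T$ in the part opposite to $x'$; exception: if $x,x'$ are in opposite parts (so $xx'$ is added, positively) and $T$ is a type-1 tadpole with $k=1$, the added edge between $x'$ and the head $w$ of $T$ may have either sign, and symmetrically if $T'$ is a type-1 tadpole with $k=1$, the added edge between $x$ and the head $w'$ of $T'$ may have either sign. $\mathcal S$ ($\mathcal J$) is the set of all sums (joins) of pairs of tadpoles (of any types and lengths). $\mathcal C$ is the set of signed cycles of length $2k$, $k\ge3$ (any signs); $D$: parts $\{a_1,a_2,a_3\},\{b_1,b_2,b_3\}$, edges exactly $a_1b_1,a_1b_2,a_2b_1,a_2b_2,a_2b_3,a_3b_2,a_3b_3$, $a_2b_2$ negative, others free; $F_1$: $K_{2,2}$ all edges negative; $F_2$: $K_{2,3}$ with parts $\{a_1,a_2\},\{b_1,b_2,b_3\}$, $a_1b_1,a_1b_2,a_2b_2,a_2b_3$ negative, $a_1b_3,a_2b_1$ free; $F_3$: $K_{2,4}$ with parts $\{a_1,a_2\},\{b_1,\dots,b_4\}$, $a_1b_1,a_1b_2,a_2b_3,a_2b_4$ negative, rest free; $F_4$: $K_{3,3}$ with parts $\{a_1,a_2,a_3\},\{b_1,b_2,b_3\}$, $a_ib_i$ negative, rest free; $F_5$: parts $\{a_1,a_2,a_3\},\{b_1,b_2,b_3\}$, all nine edges except $a_1b_3$, $a_2b_1,a_3b_2$ negative, rest free; $F_6$: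 parts $\{a_1,\dots,a_4\},\{b_1,\dots,b_4\}$, $a_1,a_2$ adjacent exactly to $b_1,b_2$, $a_3,a_4$ adjacent to all $b_j$, $a_1b_1,a_2b_1,a_3b_2,a_4b_3,a_4b_4$ negative, rest free. *)

(* Defs.v *)
From mathcomp Require Import all_boot.
Set Implicit Arguments. Unset Strict Implicit. Unset Printing Implicit Defensive.

(* A signed graph on a finite vertex type T: adjacency [sadj] and the set of
   negative edges [sneg] (an edge x y is positive iff ~~ sneg x y). *)
Record sgraph (T : finType) := SGraph { sadj : rel T; sneg : rel T }.

Definition signed_graph (T : finType) (G : sgraph T) : Prop :=
  [/\ symmetric (sadj G), irreflexive (sadj G), symmetric (sneg G)
    & forall x y, sneg G x y -> sadj G x y].

Definition is_bipartition (T : finType) (G : sgraph T) (part : T -> bool) : Prop :=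
  forall x y, sadj G x y -> part x != part y.

Definition del_edges (T : finType) (G : sgraph T) (E : seq (T * T)) : sgraph T :=
  SGraph [rel x y | sadj G x y && ~~ (((x, y) \in E) || ((y, x) \in E))]
         [rel x y | sneg G x y && ~~ (((x, y) \in E) || ((y, x) \in E))].

Definition edge_nbh (T : finType) (G : sgraph T) (u v : T) : {set T} :=
  ([set w | sadj G u w] :|: [set w | sadj G v w]) :\: [set u; v].

Definition positive_biclique (T : finType) (G : sgraph T) (part : T -> bool)
    (S : {set T}) : Prop :=
  (forall a b, a \in S -> b \in S -> sadj G a b -> ~~ sneg G a b) /\
  (forall a b, a \in S -> b \in S -> part a -> ~~ part b -> sadj G a b).

Definition signed_simplicial (T : finType) (G : sgraph T) (part : T -> bool)
    (e : T * T) : Prop :=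
  positive_biclique G part (edge_nbh G e.1 e.2).

Definition edge_ordering (T : finType) (G : sgraph T) (s : seq (T * T)) : Prop :=
  (forall p, p \in s -> sadj G p.1 p.2) /\
  (forall x y, sadj G x y ->
     count (fun p => (p == (x, y)) || (p == (y, x))) s = 1).

Definition chordal (T : finType) (G : sgraph T) (part : T -> bool) : Prop :=
  exists s : seq (T * T), edge_ordering G s /\
    forall s1 e s2, s = s1 ++ e :: s2 ->
      signed_simplicial (del_edges G s1) part e.

Inductive lbl := Neg | Pos | Free.
Definition pedge := (nat * nat * lbl)%type.

Definition pmatch (i j : nat) (e : pedge) : bool :=
  ((e.1.1 == i) && (e.1.2 == j)) || ((e.1.1 == j) && (e.1.2 == i)).

Definition in_family (n : nat) (es : seq pedge) (H : sgraph 'I_n) : Prop :=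
  [/\ signed_graph H,
      forall i j : 'I_n, sadj H i j = has (pmatch i j) es
    & forall i j : 'I_n, all (fun e => pmatch i j e ==>
          match e.2 with Neg => sneg H i j | Pos => ~~ sneg H i j | Free => true end) es].

Definition induced_in (U T : finType) (H : sgraph U) (G : sgraph T) : Prop :=
  exists f : U -> T, injective f /\
    forall x y, sadj G (f x) (f y) = sadj H x y /\
                (sadj H x y -> sneg G (f x) (f y) = sneg H x y).

Definition contains_fam (T : finType) (G : sgraph T) (n : nat) (es : seq pedge) : Prop :=
  exists H : sgraph 'I_n, in_family es H /\ induced_in H G.

(* convention: a_1..a_p are vertices 0..p-1, b_1..b_q are p..p+q-1 *)
Definition F1 : seq pedge :=
  [:: (0,2,Neg); (0,3,Neg); (1,2,Neg); (1,3,Neg)].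
Definition F2 : seq pedge :=
  [:: (0,2,Neg); (0,3,Neg); (1,3,Neg); (1,4,Neg); (0,4,Free); (1,2,Free)].
Definition F3 : seq pedge :=
  [:: (0,2,Neg); (0,3,Neg); (1,4,Neg); (1,5,Neg);
      (0,4,Free); (0,5,Free); (1,2,Free); (1,3,Free)].
Definition F4 : seq pedge :=
  [:: (0,3,Neg); (1,4,Neg); (2,5,Neg);
      (0,4,Free); (0,5,Free); (1,3,Free); (1,5,Free); (2,3,Free); (2,4,Free)].
(* K_{3,3} minus a1b3; a2b1, a3b2 negative *)
Definition F5 : seq pedge :=
  [:: (1,3,Neg); (2,4,Neg);
      (0,3,Free); (0,4,Free); (1,4,Free); (1,5,Free); (2,3,Free); (2,5,Free)].
Definition F6 : seq pedge :=
  [:: (0,4,Neg); (1,4,Neg); (2,5,Neg); (3,6,Neg); (3,7,Neg);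
      (0,5,Free); (1,5,Free);
      (2,4,Free); (2,6,Free); (2,7,Free); (3,4,Free); (3,5,Free)].
Definition Dpat : seq pedge :=
  [:: (1,4,Neg); (0,3,Free); (0,4,Free); (1,3,Free); (1,5,Free); (2,4,Free); (2,5,Free)].

Definition cycle_pat (n : nat) : seq pedge :=
  [seq (i, i.+1 %% n, Free) | i <- iota 0 n].

(* Tadpoles.  two = false: type 1; two = true: type 2.
   Vertices: x_1..x_k = 0..k-1, w = k, y = k+1, z = k+2; the end x_1 is 0. *)
Definition tadpole (two : bool) (k : nat) : seq pedge :=
  [:: (k.-1, k.+1, Neg); (k.-1, k.+2, Neg); (k, k.+1, Free); (k, k.+2, Free)]
  ++ [seq (i, i.+1, Free) | i <- iota 0 k.-1]
  ++ (if two then [:: (k.-2, k, Neg)] else [::]).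

Definition tad_size (k : nat) : nat := k + 3.
Definition valid_tad (two : bool) (k : nat) : bool := if two then 2 <= k else 1 <= k.

Definition tad_side (k v : nat) : bool :=
  if v < k then odd v else if v == k then odd k.-1 else odd k.

Definition relabel (f : nat -> nat) (e : pedge) : pedge := (f e.1.1, f e.1.2, e.2).

(* sum: T on 0..n1-1, T' with its end identified with 0, other vertices shifted *)
Definition sum_pat (t1 : bool) (k1 : nat) (t2 : bool) (k2 : nat) : seq pedge :=
  tadpole t1 k1 ++
  map (relabel (fun v => if v == 0 then 0 else v + (tad_size k1).-1)) (tadpole t2 k2).
Definition sum_size (k1 k2 : nat) : nat := tad_size k1 + tad_size k2 - 1.

(* join: T on 0..n1-1, T' on n1..n1+n2-1 (end x' = n1);
   o chooses the relative orientation of the two bipartitions *)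
Definition join_pat (t1 : bool) (k1 : nat) (t2 : bool) (k2 : nat) (o : bool)
    : seq pedge :=
  let n1 := tad_size k1 in
  let n2 := tad_size k2 in
  let side v := if v < n1 then tad_side k1 v else o (+) tad_side k2 (v - n1) in
  let opp := side 0 != side n1 in
  tadpole t1 k1 ++
  map (relabel (fun v => v + n1)) (tadpole t2 k2) ++
  [seq (0, v, if [&& opp, ~~ t2, k2 == 1 & v == n1 + k2] then Free else Pos)
     | v <- iota n1 n2 & side v != side 0] ++
  [seq (n1, v, if [&& opp, ~~ t1, k1 == 1 & v == k1] then Free else Pos)
     | v <- iota 0 n1 & side v != side n1].
Definition join_size (k1 k2 : nat) : nat := tad_size k1 + tad_size k2.

Definition contains_F (T : finType) (G : sgraph T) : Prop :=
  contains_fam G 4 F1 \/ contains_fam G 5 F2 \/ contains_fam G 6 F3 \/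
  contains_fam G 6 F4 \/ contains_fam G 6 F5 \/ contains_fam G 8 F6 \/
  (exists k, 3 <= k /\ contains_fam G (2 * k) (cycle_pat (2 * k))) \/
  contains_fam G 6 Dpat \/
  (exists t1 k1 t2 k2, [/\ valid_tad t1 k1, valid_tad t2 k2 &
      contains_fam G (sum_size k1 k2) (sum_pat t1 k1 t2 k2)]) \/
  (exists t1 k1 t2 k2 o, [/\ valid_tad t1 k1, valid_tad t2 k2 &
      contains_fam G (join_size k1 k2) (join_pat t1 k1 t2 k2 o)]).

Definition F_free (T : finType) (G : sgraph T) : Prop := ~ contains_F G.

(* Main.v *)
Require Import Defs.
From mathcomp Require Import all_boot zify.
Set Implicit Arguments. Unset Strict Implicit. Unset Printing Implicit Defensive.

(* An edge [uv] is signed simplicial iff it is not obstructed, i.e. there are no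
   neighbours [p <> v] of [u] and [q <> u] of [v] such that [pq] is not a positive edge.
   In each pattern of the family all pairs of vertices on opposite sides are obstructed.
   Hence the first edge of a pattern to be removed is not simplicial, and no pattern can
   appear when a simplicial edge is removed. It remains to find a simplicial edge in an
   [F]-free graph with at least one edge.

   Suppose that all edges are obstructed. If some two edges form an induced 2K_2, then
   there are two components [K] and [B] of the complement of a vertex set, both with
   an edge and both with this set as neighbourhood. If [K] is minimal, then it contains no
   induced 2K_2 and is completely joined to its neighbourhood [S]. The neighbourhoods in [K]
   thus form a chain, which ranks the vertices so that adjacency is a comparison of ranks.
   At each rank the negative edges which cross it are covered by two vertices, because of
   [F1], ..., [F4]. As all edges are obstructed, this yields, by comparing consecutive ranks
   and by [F5] and [F6], a tadpole in [K] with its end in [S]. Without an induced 2K_2 the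
   same argument applies with [S] empty, which is absurd.
   Minimality on the other side gives a second tadpole in [B] with its end in [S]. Two such
   tadpoles with a common end form a sum. Otherwise a shortest path through [B] from the end
   of the first one to the heads of the second one extends the former, and as there are no
   long induced cycles and no [D], the extended tadpole and the second one form a join. *)

(** Obstruction is considered for all pairs on opposite sides, not only for edges: if a pattern
    appears when [uv] is deleted, it contains [u] and [v] as a non-adjacent pair, and this pair has
    to be obstructed too. Inside a tadpole every such pair is obstructed except the edges at its
    end, for which a further neighbour of the end is missing. Sums and joins are two ways in which
    another tadpole provides it. The obstacle in the converse is that only one of the two components
    can be chosen minimal, and completeness to the common neighbourhood is known on that side alone.
    In the other component the tadpole comes from a minimal full pair inside it, and its end is
    carried back to the common neighbourhood along an induced path. If there is no such path, a
    strictly smaller component appears, and induction applies to it. The free sign in a join with a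
    type 1 tadpole with [k = 1] belongs to the one case in which a negative edge to [w] is neither
    excluded nor part of a new tadpole of type 2. *)

Definition lbl_ok (l : lbl) (b : bool) : bool :=
  match l with Neg => b | Pos => ~~ b | Free => true end.

Definition embeds (T : finType) (G : sgraph T) (N : nat) (es : seq pedge)
    (t : nat -> T) : Prop :=
  [/\ forall i j, i < N -> j < N -> t i = t j -> i = j,
      forall i j, i < N -> j < N -> sadj G (t i) (t j) = has (pmatch i j) es
    & forall i j, i < N -> j < N ->
        all (fun x => pmatch i j x ==> lbl_ok x.2 (sneg G (t i) (t j))) es].

(** Maps on [nat] replace graphs on ['I_N], so that index formulas of the parametrised patterns
    carry no bounds. The graph [H] is recovered as the pullback of [G]. *)
Lemma contains_famP (T : finType) (G : sgraph T) N es :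
  signed_graph G -> 0 < N ->
  contains_fam G N es <-> exists t, embeds G N es t.
Proof.
case=> symG irrG symnG nG N0; split.
- case=> H [[sH adH lbH] [f [injf fH]]].
  exists (fun i => f (insubd (Ordinal N0) i)).
  have vE i : i < N -> val (insubd (Ordinal N0) i) = i.
    by move=> iN; rewrite val_insubd iN.
  split=> [i j iN jN /injf/(congr1 val)|i j iN jN|i j iN jN].
  + by rewrite !vE.
  + by rewrite (fH _ _).1 adH !vE.
  + have := lbH (insubd (Ordinal N0) i) (insubd (Ordinal N0) j).
    rewrite !vE //; case hH: (sadj H (insubd (Ordinal N0) i) (insubd (Ordinal N0) j)).
      by rewrite (fH _ _).2.
    move: hH; rewrite adH !vE // => /negbT; rewrite -all_predC => /sub_all h _.
    by apply: h => x /= /negbTE->.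
- case=> t [injt adt lbt].
  exists (SGraph [rel i j : 'I_N | sadj G (t i) (t j)]
                 [rel i j : 'I_N | sneg G (t i) (t j)]); split.
  + split=> [|i j|i j].
    * split=> [i j|i|i j|i j] /=; [exact: symG|exact: irrG|exact: symnG|exact: nG].
    * by rewrite /= adt.
    * exact: lbt.
  + exists (fun i : 'I_N => t i); split=> // i j /injt h.
    by apply/val_inj/h.
Qed.

Inductive forbidden : nat -> seq pedge -> Prop :=
| forb_F1 : forbidden 4 F1
| forb_F2 : forbidden 5 F2
| forb_F3 : forbidden 6 F3
| forb_F4 : forbidden 6 F4
| forb_F5 : forbidden 6 F5
| forb_F6 : forbidden 8 F6
| forb_cycle k : 3 <= k -> forbidden (2 * k) (cycle_pat (2 * k))
| forb_D : forbidden 6 Dpat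
| forb_sum t1 k1 t2 k2 : valid_tad t1 k1 -> valid_tad t2 k2 ->
    forbidden (sum_size k1 k2) (sum_pat t1 k1 t2 k2)
| forb_join t1 k1 t2 k2 o : valid_tad t1 k1 -> valid_tad t2 k2 ->
    forbidden (join_size k1 k2) (join_pat t1 k1 t2 k2 o).

Lemma contains_FP (T : finType) (G : sgraph T) :
  contains_F G <-> exists N es, forbidden N es /\ contains_fam G N es.
Proof.
split.
- case=> [h|[h|[h|[h|[h|[h|[[k [k3 h]]|[h|[|]]]]]]]]].
  + by exists 4, F1; split=> //; constructor.
  + by exists 5, F2; split=> //; constructor.
  + by exists 6, F3; split=> //; constructor.
  + by exists 6, F4; split=> //; constructor.
  + by exists 6, F5; split=> //; constructor.
  + by exists 8, F6; split=> //; constructor.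
  + by exists (2 * k), (cycle_pat (2 * k)); split=> //; constructor.
  + by exists 6, Dpat; split=> //; constructor.
  + case=> t1 [k1 [t2 [k2 [v1 v2 h]]]].
    by exists (sum_size k1 k2), (sum_pat t1 k1 t2 k2); split=> //; constructor.
  + case=> t1 [k1 [t2 [k2 [o [v1 v2 h]]]]].
    by exists (join_size k1 k2), (join_pat t1 k1 t2 k2 o); split=> //; constructor.
- case=> N [es [fN h]]; rewrite /contains_F; case: fN h; try by intuition.
  + by move=> k k3 h; do 6!right; left; exists k.
  + by move=> t1 k1 t2 k2 v1 v2 h; do 8!right; left; exists t1, k1, t2, k2.
  + by move=> t1 k1 t2 k2 o v1 v2 h; do 9!right; exists t1, k1, t2, k2, o.
Qed.

Lemma forbidden_gt0 N es : forbidden N es -> 0 < N.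
Proof. by case=> //; rewrite /sum_size /join_size /tad_size => *; lia. Qed.

(** * Tadpoles *)

Definition tarc (two : bool) (k i j : nat) : bool :=
  [|| (j == i.+1) && (j < k), (i.+1 == k) && ((j == k.+1) || (j == k.+2)),
      (i == k) && ((j == k.+1) || (j == k.+2)) | [&& two, i.+2 == k & j == k]].

Definition tadj two k i j : bool := tarc two k i j || tarc two k j i.

Definition tnegarc (two : bool) (k i j : nat) : bool :=
  ((i.+1 == k) && ((j == k.+1) || (j == k.+2))) || [&& two, i.+2 == k & j == k].

Definition tneg two k i j : bool := tnegarc two k i j || tnegarc two k j i.

Ltac bhyps :=
  repeat match goal with
  | H : is_true (_ || _) |- _ => case/orP: H => H
  | H : is_true (_ && _) |- _ => let H' := fresh H in case/andP: H => H H'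
  end.

Ltac bgoal :=
  lazymatch goal with
  | |- is_true (_ && _) => apply/andP; split; bgoal
  | |- is_true (_ || _) => first [apply/orP; left; bgoal | apply/orP; right; bgoal | lia]
  | |- is_true (~~ (_ || _)) => rewrite negb_or; bgoal
  | |- is_true (~~ (_ && _)) => rewrite negb_and; first [apply/orP; left; bgoal | apply/orP; right; bgoal | lia]
  | |- _ => lia
  end.

Lemma pmatchE i j a b l :
  pmatch i j (a, b, l) = ((a == i) && (b == j)) || ((a == j) && (b == i)).
Proof. by []. Qed.

Lemma has_path i j k :
  has (pmatch i j) [seq (l, l.+1, Free) | l <- iota 0 k.-1] =
  ((j == i.+1) && (j < k)) || ((i == j.+1) && (i < k)).
Proof.
rewrite has_map; apply/hasP/idP => [[l]|].
  by rewrite mem_iota /= pmatchE; lia.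
case/orP=> /andP[/eqP-> h].
  by exists i; rewrite /= ?mem_iota ?pmatchE; lia.
by exists j; rewrite /= ?mem_iota ?pmatchE; lia.
Qed.

Lemma has_tadpole two k i j : valid_tad two k ->
  has (pmatch i j) (tadpole two k) = tadj two k i j.
Proof.
move=> v; rewrite /tadpole !has_cat has_path /= !pmatchE /tadj /tarc.
by case: two v => /= v; rewrite ?pmatchE ?orbF; apply/idP/idP=> h; bhyps; bgoal.
Qed.

Lemma all_tadpole two k i j b : valid_tad two k ->
  all (fun x => pmatch i j x ==> lbl_ok x.2 b) (tadpole two k) =
  (tneg two k i j ==> b).
Proof.
move=> v; rewrite /tadpole !all_cat /= !pmatchE /= !implybT.
have -> : all (fun x => pmatch i j x ==> lbl_ok x.2 b)
    [seq (l, l.+1, Free) | l <- iota 0 k.-1].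
  by rewrite all_map; apply/allP=> l _; rewrite /= implybT.
case: b; case: two v => /= v; rewrite ?pmatchE ?implybT ?implybF ?andbT ?andTb //.
  by rewrite /tneg /tnegarc /= -!negb_or; congr (~~ _); apply/idP/idP=> h; bhyps; bgoal.
by rewrite /tneg /tnegarc /= -!negb_or; congr (~~ _); apply/idP/idP=> h; bhyps; bgoal.
Qed.

Lemma tad_gt0 two k : valid_tad two k -> 0 < k.
Proof. by case: two => //= /ltnW. Qed.

Definition tad (T : finType) (G : sgraph T) (two : bool) (k : nat) (t : nat -> T) :=
  [/\ valid_tad two k,
      forall i j, i < k + 3 -> j < k + 3 -> t i = t j -> i = j,
      forall i j, i < k + 3 -> j < k + 3 -> sadj G (t i) (t j) = tadj two k i j
    & forall i j, i < k + 3 -> j < k + 3 -> tneg two k i j -> sneg G (t i) (t j)].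

Lemma tadj_side two k i j : valid_tad two k -> tadj two k i j ->
  tad_side k i != tad_side k j.
Proof.
by rewrite /tadj /tarc /tad_side; case: two => /= v h; bhyps; do !case: ifP; lia.
Qed.

Lemma tadj_gt0 two k i : valid_tad two k -> i < k + 3 ->
  exists2 p, 0 < p < k + 3 & tadj two k i p.
Proof.
move=> v ik.
exists (if i < k then if i.+1 < k then i.+1 else k.+1 else if i == k then k.+1 else k);
  move: v; rewrite /tadj /tarc; case: two => /= v; do !case: ifP=> *; bgoal.
Qed.

(** On the path the outer neighbours, or the successors, are not adjacent; near the heads the
    negative edges do the work. An edge at the end has no second neighbour on the side of the end,
    hence the exception. *)
Lemma tadj_obstructed two k i j : valid_tad two k -> i < j -> j < k + 3 ->
  tad_side k i != tad_side k j ->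
  (exists p q, [/\ (p < k + 3) && (q < k + 3), tadj two k i p && tadj two k j q,
     p != j, q != i & ~~ tadj two k p q || tneg two k p q])
  \/ i = 0 /\ tadj two k i j.
Proof.
move=> v ij jk sd.
have [jk'|jk'] := ltnP j k.
  case: (eqVneq j i.+1) => [ji|ji].
    case: (posnP i) => [i0|i0].
      by right; split=> //; rewrite /tadj /tarc; bgoal.
    left; exists i.-1, (if j.+1 < k then j.+1 else k.+1).
    by move: v sd; rewrite /tadj /tarc /tad_side /tneg /tnegarc; case: two => /= v;
      do !case: ifP; split; bgoal.
  left; exists i.+1, (if j.+1 < k then j.+1 else k.+1).
  by move: v sd; rewrite /tadj /tarc /tad_side /tneg /tnegarc; case: two => /= v;
    do !case: ifP; split; bgoal.
have [ik|ik] := ltnP i k; last first.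
  (* For the edge from [w] to one of [y], [z], the other one is joined to [x_k] by a negative
     edge. *)
  left; exists (if j == k.+1 then k.+2 else k.+1), k.-1.
  by move: v sd; rewrite /tadj /tarc /tad_side /tneg /tnegarc; case: two => /= v;
    do !case: ifP; split; bgoal.
case: (eqVneq j k) => [ejk|njk].
  left; exists i.+1, k.+1.
  by move: v sd; rewrite /tadj /tarc /tad_side /tneg /tnegarc; case: two => /= v;
    do !case: ifP; split; bgoal.
case: (eqVneq i.+1 k) => [eik|nik].
  case: (posnP i) => [i0|i0].
    by right; split=> //; rewrite /tadj /tarc; bgoal.
  (* The pair [x_{k-1}], [w] is not adjacent in type 1 and a negative edge in type 2: either way it
     obstructs. *)
  left; exists i.-1, k.
  by move: v sd; rewrite /tadj /tarc /tad_side /tneg /tnegarc; case: two => /= v;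
    do !case: ifP; split; bgoal.
left; exists i.+1, k.
by move: v sd; rewrite /tadj /tarc /tad_side /tneg /tnegarc; case: two => /= v;
  do !case: ifP; split; bgoal.
Qed.

Lemma pmatchC i j x : pmatch i j x = pmatch j i x.
Proof. by rewrite /pmatch orbC. Qed.

Lemma embeds_le (T : finType) (G : sgraph T) N es t : signed_graph G ->
  (forall i j, i < N -> j < N -> i <= j ->
     [/\ t i = t j -> i = j, sadj G (t i) (t j) = has (pmatch i j) es
       & all (fun x => pmatch i j x ==> lbl_ok x.2 (sneg G (t i) (t j))) es]) ->
  embeds G N es t.
Proof.
case=> symG irrG symnG nG H; split=> i j ik jk; have [ij|/ltnW ij] := leqP i j.
- by case: (H i j).
- by case: (H j i) => // h _ _ /esym/h.
- by case: (H i j).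
- by rewrite symG (eq_has (pmatchC _ _)); case: (H j i).
- by case: (H i j).
- rewrite symnG (eq_all (a2 := fun x => pmatch j i x ==> lbl_ok x.2 (sneg G (t j) (t i)))).
    by case: (H j i).
  by move=> x; rewrite pmatchC.
Qed.

Lemma tadjC two k i j : tadj two k i j = tadj two k j i.
Proof. exact: orbC. Qed.

Lemma tnegC two k i j : tneg two k i j = tneg two k j i.
Proof. exact: orbC. Qed.

Lemma tadj_lt two k i j : valid_tad two k -> tadj two k i j ->
  [/\ i < k + 3, j < k + 3 & i != j].
Proof.
by rewrite /tadj /tarc; case: two => /= v h; bhyps; split; lia.
Qed.

Lemma tneg_adj two k i j : tneg two k i j -> tadj two k i j.
Proof.
rewrite /tneg /tnegarc /tadj /tarc; case: two => /= h; bhyps; bgoal.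
Qed.

Lemma has_relabel f i j es : injective f ->
  has (pmatch (f i) (f j)) (map (relabel f) es) = has (pmatch i j) es.
Proof.
by move=> inj; rewrite has_map; apply: eq_has => x; rewrite /pmatch /= !inj_eq.
Qed.

Lemma all_relabel f i j es b : injective f ->
  all (fun x => pmatch (f i) (f j) x ==> lbl_ok x.2 b) (map (relabel f) es) =
  all (fun x => pmatch i j x ==> lbl_ok x.2 b) es.
Proof.
by move=> inj; rewrite all_map; apply: eq_all => x; rewrite /pmatch /= !inj_eq.
Qed.

Lemma pmatch_relabelF f i j x : (forall v, f v != i) ->
  pmatch i j (relabel f x) = false.
Proof. by move=> h; rewrite /pmatch /= !(negbTE (h _)) andbF. Qed.

Lemma has_relabelF f i j es : (forall v, f v != i) ->
  has (pmatch i j) (map (relabel f) es) = false.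
Proof.
move=> h; rewrite has_map (eq_has (a2 := pred0)) ?has_pred0 // => x /=.
exact: pmatch_relabelF.
Qed.

Lemma all_relabelF f i j es b : (forall v, f v != i) ->
  all (fun x => pmatch i j x ==> lbl_ok x.2 b) (map (relabel f) es).
Proof.
move=> h; rewrite all_map (eq_all (a2 := predT)) ?all_predT // => x /=.
by rewrite pmatch_relabelF.
Qed.

(** * Sums and joins *)

(** The predecessor accounts for the shared end: index 1 lands right after the first tadpole. *)
Definition sum_shift k v := if v == 0 then 0 else v + (tad_size k).-1.

Lemma sum_shiftS k v : 0 < v -> sum_shift k v = v + (k + 2).
Proof. by case: v => // v _; rewrite /sum_shift /tad_size /=; lia. Qed.

Lemma sum_shift_inj k : injective (sum_shift k).
Proof.
by case=> [|u] [|v] //; rewrite ?(@sum_shiftS k _.+1) // /sum_shift /=; lia.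
Qed.

Lemma sum_shiftF k i v : 0 < i < k + 3 -> sum_shift k v != i.
Proof. by case: v => [|v]; rewrite ?(@sum_shiftS k _.+1) // /sum_shift /=; lia. Qed.

Section Sum.
Variables (T : finType) (G : sgraph T).
Variables (t1 : bool) (k1 : nat) (t2 : bool) (k2 : nat).
Hypotheses (v1 : valid_tad t1 k1) (v2 : valid_tad t2 k2).

Lemma has_sum_pat i j :
  has (pmatch i j) (sum_pat t1 k1 t2 k2) = tadj t1 k1 i j ||
  has (pmatch i j) (map (relabel (sum_shift k1)) (tadpole t2 k2)).
Proof. by rewrite /sum_pat has_cat has_tadpole. Qed.

Lemma all_sum_pat i j b :
  all (fun x => pmatch i j x ==> lbl_ok x.2 b) (sum_pat t1 k1 t2 k2) =
  (tneg t1 k1 i j ==> b) &&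
  all (fun x => pmatch i j x ==> lbl_ok x.2 b)
    (map (relabel (sum_shift k1)) (tadpole t2 k2)).
Proof. by rewrite /sum_pat all_cat all_tadpole. Qed.

Lemma sum_embeds_tads t : embeds G (sum_size k1 k2) (sum_pat t1 k1 t2 k2) t ->
  [/\ tad G t1 k1 t, tad G t2 k2 (t \o sum_shift k1)
    & forall i j, 0 < i < k1 + 3 -> 0 < j < k2 + 3 ->
        t i <> t (sum_shift k1 j) /\ ~~ sadj G (t i) (t (sum_shift k1 j))].
Proof.
rewrite /sum_size /tad_size => -[inj ad lb].
have sh j : j < k2 + 3 -> sum_shift k1 j < k1 + 3 + (k2 + 3) - 1.
  by case: j => [|j] jk; rewrite ?(@sum_shiftS k1 _.+1) // /sum_shift /=; lia.
have no2 i j : i < k1 + 3 -> j < k1 + 3 ->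
    has (pmatch i j) (map (relabel (sum_shift k1)) (tadpole t2 k2)) = false.
  move=> ik jk; case: (posnP i) => [->|i0]; last first.
    by apply: has_relabelF => v; apply: sum_shiftF; lia.
  case: (posnP j) => [->|j0]; last first.
    rewrite (eq_has (pmatchC _ _)).
    by apply: has_relabelF => v; apply: sum_shiftF; lia.
  rewrite -[X in pmatch X](_ : sum_shift k1 0 = 0) //.
  rewrite -[X in pmatch _ X](_ : sum_shift k1 0 = 0) //.
  rewrite has_relabel ?has_tadpole //; last exact: sum_shift_inj.
  by apply/negP => /tadj_lt[].
have no1 (i j : nat) : tadj t1 k1 (sum_shift k1 i) (sum_shift k1 j) = false.
  apply/negP => /tadj_lt-/(_ v1)[].
  case: i j => [|i] [|j]; rewrite ?(@sum_shiftS k1 _.+1) // /sum_shift /=; lia.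
split.
- split=> // [i j ik jk|i j ik jk|i j ik jk ng].
  + by apply: inj; lia.
  + by rewrite ad ?has_sum_pat ?no2 ?orbF //; lia.
  + by have := lb i j; rewrite all_sum_pat ng => -/(_ _ _)/andP[]//; lia.
- split=> // [i j ik jk /=|i j ik jk /=|i j ik jk ng /=].
  + by move/inj=> h; apply: (@sum_shift_inj k1); apply: h; exact: sh.
  + rewrite ad ?has_sum_pat ?no1 ?sh // has_relabel ?has_tadpole //.
    exact: sum_shift_inj.
  + have := lb _ _ (sh _ ik) (sh _ jk); rewrite all_sum_pat => /andP[_].
    by rewrite all_relabel ?all_tadpole ?ng //; exact: sum_shift_inj.
- move=> i j ik jk; have jk' := sh j (proj2 (andP jk)).
  have ne : i != sum_shift k1 j by rewrite eq_sym sum_shiftF.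
  split; first by move/inj=> h; move/eqP: ne; apply; apply: h; lia.
  rewrite ad ?has_sum_pat //; last by lia.
  rewrite negb_or.
  rewrite has_relabelF ?andbT; last by move=> v; apply: sum_shiftF.
  apply/negP=> /(tadj_lt v1)[_]; rewrite sum_shiftS; lia.
Qed.

Lemma sum_of_tads t t' : signed_graph G ->
  tad G t1 k1 t -> tad G t2 k2 t' -> t 0 = t' 0 ->
  (forall i j, 0 < i < k1 + 3 -> 0 < j < k2 + 3 ->
     t i <> t' j /\ ~~ sadj G (t i) (t' j)) ->
  exists s, embeds G (sum_size k1 k2) (sum_pat t1 k1 t2 k2) s.
Proof.
move=> sG [_ inj1 ad1 ng1] [_ inj2 ad2 ng2] t00 cross.
pose s v := if v < k1 + 3 then t v else t' (v - (k1 + 2)).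
have s2 v : k1 + 3 <= v -> exists2 w, 0 < w & v = sum_shift k1 w.
  move=> h; exists (v - (k1 + 2)); first lia.
  by rewrite sum_shiftS; lia.
have sE w : s (sum_shift k1 w) = t' w.
  rewrite /s; case: (posnP w) => [->|w0]; first by rewrite ifT //; rewrite /sum_shift /=; lia.
  by rewrite sum_shiftS // ifF; [congr t'|]; lia.
have shlt w : 0 < w -> sum_shift k1 w < sum_size k1 k2 -> w < k2 + 3.
  by move=> w0; rewrite sum_shiftS // /sum_size /tad_size; lia.
have tad1 w : k1 + 3 <= w -> forall u, tadj t1 k1 u w = false.
  by move=> h u; apply/negP=> /(tadj_lt v1)[]; lia.
have sh3 w : 0 < w -> k1 + 3 <= sum_shift k1 w.
  by move=> w0; rewrite sum_shiftS //; lia.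
have s1 v : v < k1 + 3 -> s v = t v by rewrite /s => ->.
have si := @sum_shift_inj k1.
exists s; apply: embeds_le => // i j ik jk ij; rewrite has_sum_pat all_sum_pat.
case: (ltnP j (k1 + 3)) => [j1|/s2[w w0 jE]].
  have i1 : i < k1 + 3 by lia.
  rewrite !s1 //.
  have h2 : has (pmatch i j) (map (relabel (sum_shift k1)) (tadpole t2 k2)) = false.
    case: (posnP j) => j0.
      have -> : i = sum_shift k1 0 by rewrite /sum_shift /=; lia.
      rewrite j0 -[X in pmatch _ X](_ : sum_shift k1 0 = 0) //.
      by rewrite has_relabel ?has_tadpole //; apply/negP=> /tadj_lt[].
    rewrite (eq_has (pmatchC _ _)).
    by apply: has_relabelF => v; apply: sum_shiftF; lia.
  split; first exact: inj1.
    by rewrite h2 orbF ad1.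
  rewrite implybE; apply/andP; split.
    by rewrite -implybE; apply/implyP; exact: ng1.
  move/negbT: h2; rewrite -all_predC; apply: sub_all => x /= /negbTE->//.
have wk : w < k2 + 3 by apply: shlt => //; rewrite -jE.
rewrite jE sE tad1 ?sh3 // orFb.
have -> : tneg t1 k1 i (sum_shift k1 w) = false.
  by apply/negP=> /tneg_adj; rewrite tad1 ?sh3.
rewrite implyFb andTb.
case: (posnP i) => [->|i0].
  rewrite -[X in pmatch X](_ : sum_shift k1 0 = 0) //.
  rewrite -[X in s X](_ : sum_shift k1 0 = 0) // sE.
  rewrite has_relabel // all_relabel // has_tadpole // all_tadpole //.
  split; [| by apply: ad2; lia | by apply/implyP; apply: ng2; lia].
  by move/inj2=> h; rewrite -h //; lia.
case: (ltnP i (k1 + 3)) => [i1|/s2[u u0 iE]].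
  rewrite s1 //; have [ne nad] : t i <> t' w /\ ~~ sadj G (t i) (t' w) by apply: cross; lia.
  rewrite (negbTE nad) has_relabelF ?all_relabelF //; move=> v; apply: sum_shiftF; lia.
have uk : u < k2 + 3 by apply: shlt => //; rewrite -iE.
rewrite iE sE has_relabel // all_relabel // has_tadpole // all_tadpole //.
split; [| exact: ad2 | by apply/implyP; exact: ng2].
by move/inj2=> h; rewrite h.
Qed.

End Sum.

Lemma has_star (a m n : nat) (P : pred nat) (c : nat -> lbl) i j :
  has (pmatch i j) [seq (a, v, c v) | v <- iota m n & P v] =
  [&& i == a, m <= j < m + n & P j] || [&& j == a, m <= i < m + n & P i].
Proof.
rewrite has_map; apply/hasP/idP => [[v] /=|].
  rewrite mem_filter mem_iota pmatchE => /andP[Pv vm].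
  case/orP=> /andP[/eqP<- /eqP<-]; rewrite eqxx vm Pv //; exact: orbT.
case/orP=> /and3P[/eqP-> vm Pv].
  by exists j; rewrite /= ?mem_filter ?mem_iota ?Pv // pmatchE !eqxx.
by exists i; rewrite /= ?mem_filter ?mem_iota ?Pv // pmatchE !eqxx orbT.
Qed.

Lemma all_star (a m n : nat) (P : pred nat) (c : nat -> lbl) i j b :
  all (fun x => pmatch i j x ==> lbl_ok x.2 b)
    [seq (a, v, c v) | v <- iota m n & P v] =
  ([&& i == a, m <= j < m + n & P j] ==> lbl_ok (c j) b) &&
  ([&& j == a, m <= i < m + n & P i] ==> lbl_ok (c i) b).
Proof.
rewrite all_map; apply/allP/andP => [h|[h1 h2] v /=].
  split; apply/implyP=> /and3P[/eqP ia vm Pv].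
    have := h j; rewrite /= mem_filter mem_iota Pv vm => /(_ isT).
    by rewrite pmatchE ia !eqxx.
  have := h i; rewrite /= mem_filter mem_iota Pv vm => /(_ isT).
  by rewrite pmatchE ia !eqxx orbT.
rewrite mem_filter mem_iota pmatchE => /andP[Pv vm].
apply/implyP; case/orP=> /andP[/eqP ia /eqP vj].
  by move: h1; rewrite -ia -vj eqxx vm Pv.
by move: h2; rewrite -ia -vj eqxx vm Pv.
Qed.

Lemma has_cat4 (A : Type) (p : pred A) s1 s2 s3 s4 :
  has p (s1 ++ (s2 ++ (s3 ++ s4))) = [|| has p s1, has p s2, has p s3 | has p s4].
Proof. by rewrite !has_cat. Qed.

Lemma all_cat4 (A : Type) (p : pred A) s1 s2 s3 s4 :
  all p (s1 ++ (s2 ++ (s3 ++ s4))) = [&& all p s1, all p s2, all p s3 & all p s4].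
Proof. by rewrite !all_cat. Qed.

Section Join.
Variables (T : finType) (G : sgraph T).
Variables (t1 : bool) (k1 : nat) (t2 : bool) (k2 : nat) (o : bool).
Hypotheses (v1 : valid_tad t1 k1) (v2 : valid_tad t2 k2).

Let n1 := k1 + 3.
Let n2 := k2 + 3.
Let sh v := v + n1.

Let k1_gt0 := tad_gt0 v1.
Let k2_gt0 := tad_gt0 v2.

Let shI : injective sh. Proof. exact: addIn. Qed.

(** In the common bipartition the end of the first tadpole has side [false] and that of the second
    has side [o]. Each disjunct thus says that one vertex is an end and the other lies opposite to
    it. *)
Definition join_cross i j : bool :=
  ((i == 0) && (o (+) tad_side k2 j)) || ((j == 0) && (tad_side k1 i (+) o)).

Let side v := if v < n1 then tad_side k1 v else o (+) tad_side k2 (v - n1).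

Lemma side0 : side 0 = false.
Proof. by rewrite /side /n1 addn3 /= /tad_side k1_gt0. Qed.

Lemma siden1 : side n1 = o.
Proof. by rewrite /side ltnn subnn /tad_side k2_gt0 addbF. Qed.

Lemma sideD j : side (sh j) = o (+) tad_side k2 j.
Proof. by rewrite /side /sh ifF ?addnK //; lia. Qed.

Lemma join_patE : join_pat t1 k1 t2 k2 o = tadpole t1 k1 ++
  (map (relabel sh) (tadpole t2 k2) ++
  ([seq (0, v, if [&& o, ~~ t2, k2 == 1 & v == n1 + k2] then Free else Pos)
     | v <- iota n1 n2 & side v != false] ++
  [seq (n1, v, if [&& o, ~~ t1, k1 == 1 & v == k1] then Free else Pos)
     | v <- iota 0 n1 & side v != o])).
Proof.
transitivity (tadpole t1 k1 ++
  (map (relabel sh) (tadpole t2 k2) ++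
  ([seq (0, v, if [&& side 0 != side n1, ~~ t2, k2 == 1 & v == n1 + k2] then Free else Pos)
     | v <- iota n1 n2 & side v != side 0] ++
  [seq (n1, v, if [&& side 0 != side n1, ~~ t1, k1 == 1 & v == k1] then Free else Pos)
     | v <- iota 0 n1 & side v != side n1]))); first by [].
by rewrite siden1 side0; case: (o).
Qed.

Let h2F i j : i < n1 -> has (pmatch i j) (map (relabel sh) (tadpole t2 k2)) = false.
Proof. by move=> ik; apply: has_relabelF => v; rewrite /sh; lia. Qed.

Let l2T i j b : i < n1 ->
  all (fun x => pmatch i j x ==> lbl_ok x.2 b) (map (relabel sh) (tadpole t2 k2)).
Proof. by move=> ik; apply: all_relabelF => v; rewrite /sh; lia. Qed.

Let tF i j : tadj t1 k1 i (sh j) = false.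
Proof. by apply/negP=> /(tadj_lt v1)[_]; rewrite /sh /n1; lia. Qed.

Let nF i j : tneg t1 k1 i (sh j) = false.
Proof. by apply/negP=> /tneg_adj; rewrite tF. Qed.

Lemma has_join11 i j : i < n1 -> j < n1 ->
  has (pmatch i j) (join_pat t1 k1 t2 k2 o) = tadj t1 k1 i j.
Proof.
move=> ik jk; rewrite join_patE has_cat4 !has_star has_tadpole // h2F //.
by case: (tadj _ _ _ _) => //=; apply/negP => h; bhyps; lia.
Qed.

Lemma all_join11 i j b : i < n1 -> j < n1 ->
  all (fun x => pmatch i j x ==> lbl_ok x.2 b) (join_pat t1 k1 t2 k2 o) =
  (tneg t1 k1 i j ==> b).
Proof.
move=> ik jk; rewrite join_patE all_cat4 !all_star all_tadpole // l2T //.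
rewrite [X in _ && X](_ : _ = true) ?andbT //.
by do ![apply/andP; split => //]; apply/implyP=> h; bhyps; lia.
Qed.

Lemma has_join12 i j : i < n1 -> j < n2 ->
  has (pmatch i (sh j)) (join_pat t1 k1 t2 k2 o) = join_cross i j.
Proof.
move=> ik jk; rewrite join_patE has_cat4 !has_star has_tadpole // h2F // tF.
rewrite sideD /sh /join_cross.
have -> : side i = tad_side k1 i by rewrite /side ik.
have -> : (j + n1 == n1) = (j == 0) by lia.
have -> : (j + n1 == 0) = false by rewrite /n1; lia.
have -> : (i == n1) = false by lia.
have -> : n1 <= j + n1 < n1 + n2 by lia.
have -> : 0 <= i < 0 + n1 by lia.
by rewrite !orFb !orbF /= -negb_eqb; case: (o); case: (tad_side k1 i); case: (tad_side k2 j); rewrite //= ?andbF ?andbT.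
Qed.

Lemma all_join12 i j b : i < n1 -> j < n2 ->
  all (fun x => pmatch i (sh j) x ==> lbl_ok x.2 b) (join_pat t1 k1 t2 k2 o) =
  ((i == 0) && (o (+) tad_side k2 j) && ~~ [&& o, ~~ t2, k2 == 1 & j == k2] ==> ~~ b)
  && ((j == 0) && (tad_side k1 i (+) o) && ~~ [&& o, ~~ t1, k1 == 1 & i == k1] ==> ~~ b).
Proof.
move=> ik jk; rewrite join_patE all_cat4 !all_star all_tadpole // l2T // nF.
rewrite sideD /sh /join_cross.
have -> : side i = tad_side k1 i by rewrite /side ik.
have -> : (j + n1 == n1) = (j == 0) by lia.
have -> : (j + n1 == 0) = false by rewrite /n1; lia.
have -> : (i == n1) = false by lia.
have -> : n1 <= j + n1 < n1 + n2 by lia.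
have -> : 0 <= i < 0 + n1 by lia.
have -> : (j + n1 == n1 + k2) = (j == k2) by lia.
rewrite !andTb !andbT.
by case: (i == 0); case: (j == 0); case: [&& o, ~~ t2, k2 == 1 & j == k2];
  case: [&& o, ~~ t1, k1 == 1 & i == k1];
  case: (o); case: (tad_side k1 i); case: (tad_side k2 j); case: b.
Qed.

Lemma has_join22 i j : i < n2 -> j < n2 ->
  has (pmatch (sh i) (sh j)) (join_pat t1 k1 t2 k2 o) = tadj t2 k2 i j.
Proof.
move=> ik jk; rewrite join_patE has_cat4 !has_star has_tadpole // tF.
rewrite has_relabel // has_tadpole //.
case: (tadj _ _ _ _) => //=; apply/negP ; rewrite /sh /n1 => h; bhyps; lia.
Qed.

Lemma all_join22 i j b : i < n2 -> j < n2 ->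
  all (fun x => pmatch (sh i) (sh j) x ==> lbl_ok x.2 b) (join_pat t1 k1 t2 k2 o) =
  (tneg t2 k2 i j ==> b).
Proof.
move=> ik jk; rewrite join_patE all_cat4 !all_star all_tadpole // nF.
rewrite all_relabel // all_tadpole //=.
rewrite [X in _ && X](_ : _ = true) ?andbT //.
apply/andP; split; apply/andP; split; apply/implyP; rewrite /sh /n1 => h; bhyps; lia.
Qed.

Lemma join_embeds_tads t : embeds G (join_size k1 k2) (join_pat t1 k1 t2 k2 o) t ->
  [/\ tad G t1 k1 t, tad G t2 k2 (t \o sh)
    & forall i j, i < n1 -> j < n2 ->
        t i <> t (sh j) /\ sadj G (t i) (t (sh j)) = join_cross i j].
Proof.
rewrite /join_size /tad_size => -[inj ad lb].
have shl j : j < n2 -> sh j < k1 + 3 + (k2 + 3) by rewrite /sh /n1; lia.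
split.
- split=> // [i j ik jk|i j ik jk|i j ik jk ng].
  + by apply: inj; lia.
  + by rewrite ad ?has_join11 //; lia.
  + by have := lb i j; rewrite all_join11 // ng => h; apply: h; lia.
- split=> // [i j ik jk|i j ik jk|i j ik jk ng].
  + by move/inj=> h; apply/shI/h; exact: shl.
  + by rewrite ad ?has_join22 ?shl.
  + by have := lb _ _ (shl _ ik) (shl _ jk); rewrite all_join22 // ng.
- move=> i j ik jk; have jk' := shl j jk; split.
    by move/inj=> h; have := h _ jk'; rewrite /sh /n1 in ik *; lia.
  by rewrite ad ?has_join12 //; rewrite /n1 in ik; lia.
Qed.

Lemma join_of_tads t t' : signed_graph G ->
  tad G t1 k1 t -> tad G t2 k2 t' ->
  (forall i j, i < n1 -> j < n2 ->
     t i <> t' j /\ sadj G (t i) (t' j) = join_cross i j) ->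
  (forall j, j < n2 -> o (+) tad_side k2 j -> sneg G (t 0) (t' j) ->
     [&& o, ~~ t2, k2 == 1 & j == k2]) ->
  (forall i, i < n1 -> tad_side k1 i (+) o -> sneg G (t i) (t' 0) ->
     [&& o, ~~ t1, k1 == 1 & i == k1]) ->
  exists s, embeds G (join_size k1 k2) (join_pat t1 k1 t2 k2 o) s.
Proof.
move=> sG [_ inj1 ad1 ng1] [_ inj2 ad2 ng2] cross pos1 pos2.
pose s v := if v < n1 then t v else t' (v - n1).
have sE w : s (sh w) = t' w by rewrite /s /sh ifF ?addnK //; lia.
have s1 v : v < n1 -> s v = t v by rewrite /s => ->.
have s2 v : n1 <= v -> v < join_size k1 k2 -> exists2 w, w < n2 & v = sh w.
  rewrite /join_size /tad_size => h1 h2; exists (v - n1); first by rewrite /n1 /n2 in h1 *; lia.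
  by rewrite /sh; lia.
exists s; apply: embeds_le => // i j ik jk ij; case: (ltnP j n1) => [j1|/s2/(_ jk)[w wn jE]].
  have i1 : i < n1 by lia.
  rewrite !s1 // has_join11 // all_join11 //; split; [exact: inj1|exact: ad1|].
  by apply/implyP; exact: ng1.
case: (ltnP i n1) => [i1|/s2/(_ ik)[u un iE]]; last first.
  rewrite iE jE !sE has_join22 // all_join22 //; split; [|exact: ad2|].
    by move/inj2=> h; rewrite h.
  by apply/implyP; exact: ng2.
have [ne ad] := cross i w i1 wn.
rewrite jE sE s1 // has_join12 // all_join12 //; split=> //.
apply/andP; split; apply/implyP=> /andP[/andP[/eqP e1 h]]; apply: contra; rewrite ?e1.
  exact: pos1.
exact: pos2.
Qed.

End Join.

(** * Obstructed pairs in the forbidden patterns *)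

Definition obstructing (T : finType) (G : sgraph T) (u v p q : T) : bool :=
  [&& sadj G u p, sadj G v q, p != v, q != u & ~~ (sadj G p q && ~~ sneg G p q)].

Definition pneg es i j :=
  has (fun x => pmatch i j x && (if x.2 is Neg then true else false)) es.

Lemma pneg_ok es i j b : all (fun x => pmatch i j x ==> lbl_ok x.2 b) es ->
  pneg es i j -> b.
Proof.
elim: es => //= x es IH /andP[h1 /IH h2] /orP[/andP[m]|//].
by move: h1; rewrite m; case: x.2.
Qed.

Definition obs_pat es i j p q :=
  [&& has (pmatch i p) es, has (pmatch j q) es, p != j, q != i
    & ~~ has (pmatch p q) es || pneg es p q].

(* Pairs with a common neighbour lie on the same side of any bipartition, so only
   the other pairs need an obstruction. *)
Definition obs_check N es :=
  all (fun i => all (fun j =>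
    has (fun r => has (pmatch i r) es && has (pmatch j r) es) (iota 0 N) ||
    has (fun p => has (obs_pat es i j p) (iota 0 N)) (iota 0 N)) (iota 0 N)) (iota 0 N).

Section Obstruct.
Variables (T : finType) (G : sgraph T) (part : T -> bool).
Hypotheses (sG : signed_graph G) (bG : is_bipartition G part).

Let symG : symmetric (sadj G). Proof. by case: sG. Qed.
Let symnG : symmetric (sneg G). Proof. by case: sG. Qed.

Lemma obstructingC u v p q : obstructing G u v p q = obstructing G v u q p.
Proof.
by rewrite /obstructing symG [sneg G p q]symnG; case: (sadj G v q);
  rewrite ?andbF //=; case: (q != u); rewrite ?andbF //= [sadj G p q]symG.
Qed.

(** A tadpole is connected, so its bipartition is unique up to the side of its end. *)
Lemma tad_part two k t i : tad G two k t -> i < k + 3 ->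
  part (t i) = part (t 0) (+) tad_side k i.
Proof.
case=> v _ ad _.
have step a b : a < k + 3 -> b < k + 3 -> tadj two k a b ->
    part (t a) = part (t 0) (+) tad_side k a -> part (t b) = part (t 0) (+) tad_side k b.
  move=> ak bk ab; have := tadj_side v ab; have := ab; rewrite -ad // => /bG.
  by case: (part (t a)) (part (t b)) (part (t 0)) (tad_side k a) (tad_side k b)
    => [] [] [] [] [].
have k0 := tad_gt0 v.
have path j : j < k -> part (t j) = part (t 0) (+) tad_side k j.
  elim: j => [|j IH] jk; first by rewrite /tad_side k0 addbF.
  by apply: (@step j) (IH _); rewrite /tadj /tarc; try bgoal; lia.
have y : part (t k.+1) = part (t 0) (+) tad_side k k.+1.
  by apply: (@step k.-1) (path _ _); rewrite /tadj /tarc; try bgoal; lia.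
have z : part (t k.+2) = part (t 0) (+) tad_side k k.+2.
  by apply: (@step k.-1) (path _ _); rewrite /tadj /tarc; try bgoal; lia.
have w : part (t k) = part (t 0) (+) tad_side k k.
  by apply: (@step k.+1) (y); rewrite /tadj /tarc; try bgoal; lia.
move=> ik; have [ik'|ki] := ltnP i k; first exact: path.
have [->|?] := eqVneq i k; first by [].
have [->|?] := eqVneq i k.+1; first by [].
by have -> : i = k.+2 by lia.
Qed.

Lemma tad_nonadj two k t p q : tad G two k t -> p < k + 3 -> q < k + 3 ->
  ~~ tadj two k p q || tneg two k p q -> ~~ (sadj G (t p) (t q) && ~~ sneg G (t p) (t q)).
Proof.
case=> v _ ad ng pk qk /orP[h|h]; first by rewrite ad // (negbTE h).
by rewrite (ng _ _ pk qk h) andbF.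
Qed.

Lemma tad_neq two k t p q : tad G two k t -> p < k + 3 -> q < k + 3 ->
  p != q -> t p != t q.
Proof. by case=> v inj _ _ pk qk; apply: contra => /eqP/inj->. Qed.

(* [x] plays the role of a neighbour of the end outside of the tadpole. *)
Lemma tad_pair_obstructed two k t x i j : tad G two k t -> sadj G (t 0) x ->
  (forall q, 0 < q < k + 3 -> t q <> x /\ ~~ sadj G (t q) x) ->
  i < k + 3 -> j < k + 3 -> part (t i) != part (t j) ->
  exists p q, [/\ p = x \/ (exists2 a, a < k + 3 & p = t a),
    q = x \/ (exists2 a, a < k + 3 & q = t a) & obstructing G (t i) (t j) p q].
Proof.
move=> tt x0 xM.
wlog ij : i j / i < j => [hw ik jk pij|].
  have [ij|] := ltnP i j; first exact: hw.
  rewrite leq_eqVlt => /orP[/eqP ij|ij]; first by rewrite ij eqxx in pij.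
  have [|p [q [hp hq h]]] := hw j i ij jk ik; first by rewrite eq_sym.
  by exists q, p; split=> //; rewrite obstructingC.
move=> ik jk; have := tt; case=> v inj ad ng.
rewrite (tad_part tt) // [part (t j)](tad_part tt) // => sij.
have {}sij : tad_side k i != tad_side k j.
  by move: sij; case: (part _); case: (tad_side k i); case: (tad_side k j).
have [[p [q [/andP[pk qk] /andP[ip jq] pj qi h]]]|[i0 aij]] :=
    tadj_obstructed v ij jk sij.
  exists (t p), (t q); split; [by right; exists p|by right; exists q|].
  by rewrite /obstructing !ad // ip jq !(tad_neq tt) //=; rewrite -!ad //; apply: (tad_nonadj tt).
have [q /andP[q0 qk] jq] := tadj_gt0 v jk.
have jq' : j <> q by case: (tadj_lt v jq) => _ _ /eqP.
exists x, (t q); split; [by left|by right; exists q|].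
have /xM[_ nq] : 0 < q < k + 3 by rewrite q0.
have /xM[nj _] : 0 < j < k + 3 by lia.
rewrite i0 /obstructing x0 ad // jq /= symG (negbTE nq) /= andbT.
rewrite eq_sym (introF eqP nj) /=; apply: (tad_neq tt) => //; lia.
Qed.

Lemma finite_obstructed N es t i j : obs_check N es -> embeds G N es t ->
  i < N -> j < N -> part (t i) != part (t j) ->
  exists p q, [/\ p < N, q < N & obstructing G (t i) (t j) (t p) (t q)].
Proof.
move=> chk [inj ad lb] iN jN pij.
have inN a : a < N -> a \in iota 0 N by rewrite mem_iota.
have := allP (allP chk i (inN _ iN)) j (inN _ jN); case/orP=> /hasP[r].
  rewrite mem_iota => /= rN; rewrite -!ad // => /andP[/bG ir /bG jr].
  by move: pij ir jr; case: (part _); case: (part _); case: (part _).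
rewrite mem_iota => /= rN /hasP[q]; rewrite mem_iota => /= qN /and5P[ir jq rj qi h].
exists r, q; split=> //; rewrite /obstructing !ad // ir jq /=.
have ne a b : a < N -> b < N -> a != b -> t a != t b.
  by move=> aN bN; apply: contra => /eqP/inj->.
rewrite !ne //=; case/orP: h => [/negbTE->//|h].
by rewrite (pneg_ok (lb _ _ rN qN)) // andbF.
Qed.

Lemma has_cycle n i j : i < n -> j < n ->
  has (pmatch i j) (cycle_pat n) = (i.+1 %% n == j) || (j.+1 %% n == i).
Proof.
move=> ik jn; rewrite has_map; apply/hasP/idP => [[l] _ /=|].
  by rewrite pmatchE => /orP[]/andP[/eqP-> ->]; rewrite ?orbT.
case/orP=> h; first by exists i; rewrite /= ?mem_iota ?pmatchE ?eqxx ?h.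
by exists j; rewrite /= ?mem_iota ?pmatchE ?eqxx ?h ?orbT.
Qed.

(** For an edge of the cycle take the outer neighbours, which are not adjacent because the length is
    at least 6. For a non-adjacent pair take both successors: a rotation preserves non-adjacency. *)
Lemma cycle_obstructed k t i j : 3 <= k -> embeds G (2 * k) (cycle_pat (2 * k)) t ->
  i < 2 * k -> j < 2 * k -> part (t i) != part (t j) ->
  exists p q, [/\ p < 2 * k, q < 2 * k & obstructing G (t i) (t j) (t p) (t q)].
Proof.
move=> k3 [inj ad lb].
have md a : a < 2 * k -> a.+1 %% (2 * k) = if a.+1 == 2 * k then 0 else a.+1.
  by move=> h; case: eqP => [->|?]; [rewrite modnn|rewrite modn_small //; lia].
have pt a : a < 2 * k -> part (t a) = part (t 0) (+) odd a.
  elim: a => [|a IH] aN; first by rewrite addbF.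
  have aN' : a < 2 * k by lia.
  have /bG : sadj G (t a) (t a.+1).
    by rewrite ad // has_cycle // md //; case: (eqVneq a.+1 (2 * k)); rewrite ?eqxx //; lia.
  by rewrite IH //=; case: (part _); case: (part _); case: (odd a).
have ne a b : a < 2 * k -> b < 2 * k -> a != b -> t a != t b.
  by move=> aN bN; apply: contra => /eqP/inj->.
wlog ij : i j / i < j => [hw ik jk pij|ik jk pij].
  have [ij|] := ltnP i j; first exact: hw.
  rewrite leq_eqVlt => /orP[/eqP ij|ij]; first by rewrite ij eqxx in pij.
  have [|p [q [hp hq h]]] := hw j i ij jk ik; first by rewrite eq_sym.
  by exists q, p; split=> //; rewrite obstructingC.
have oij : odd i != odd j.
  by move: pij; rewrite (pt i) // [part (t j)]pt //; case: (part _); case: (odd i); case: (odd j).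
pose suc a := a.+1 %% (2 * k).
have sucP a : a < 2 * k -> a.+1 = 2 * k /\ suc a = 0 \/ a.+1 < 2 * k /\ suc a = a.+1.
  by move=> h; rewrite /suc md //; case: (eqVneq a.+1 (2 * k)); lia.
have fin p q : p < 2 * k -> q < 2 * k -> suc i = p \/ suc p = i ->
    suc j = q \/ suc q = j -> p <> j -> q <> i -> suc p <> q -> suc q <> p ->
    exists p q, [/\ p < 2 * k, q < 2 * k & obstructing G (t i) (t j) (t p) (t q)].
  move=> pN qN ip jq /eqP pj /eqP qi /eqP pq /eqP qp; exists p, q; split=> //.
  rewrite /obstructing !ad // !has_cycle // -!/(suc _) !ne // (negbTE pq) (negbTE qp) /=.
  by rewrite andbT; apply/andP; split; apply/orP; [case: ip|case: jq] => ->; auto.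
have pre a : a < 2 * k -> exists2 p, p < 2 * k & suc p = a.
  move=> aN; exists (if a == 0 then (2 * k).-1 else a.-1).
    by case: (eqVneq a 0) => /= ?; lia.
  case: (eqVneq a 0) => /= ?.
    by case: (sucP (2 * k).-1) => [|[]|[]]; lia.
  by case: (sucP a.-1) => [|[]|[]]; lia.
have [ji|ji] := eqVneq j i.+1.
  have [p pN ip] := pre i ik; have Sp := sucP p pN; have Sj := sucP j jk.
  have qN : suc j < 2 * k by lia.
  have Sq := sucP _ qN.
  by apply: (fin p (suc j)) => //; [right|left| | | |]; lia.
have Sj := sucP j jk; have Si := sucP i ik.
have [ji'|ji'] := boolP ((j.+1 == 2 * k) && (i == 0)).
  have [q qN jq] := pre j jk; have Sq := sucP q qN.
  have pN : suc i < 2 * k by lia.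
  have Sp := sucP _ pN.
  by apply: (fin (suc i) q) => //; [left|right| | | |]; lia.
have pN : suc i < 2 * k by lia.
have qN : suc j < 2 * k by lia.
have Sp := sucP _ pN; have Sq := sucP _ qN.
by apply: (fin (suc i) (suc j)) => //; [left|left| | | |]; lia.
Qed.

End Obstruct.

Section Forbidden.
Variables (T : finType) (G : sgraph T) (part : T -> bool).
Hypotheses (sG : signed_graph G) (bG : is_bipartition G part).

Let symG : symmetric (sadj G). Proof. by case: sG. Qed.

(** Every vertex has a neighbour in its own tadpole other than the end, and vertices other than the
    ends are never adjacent across. *)
Lemma cross_obstructed t1 k1 t t2 k2 t' i j :
  tad G t1 k1 t -> tad G t2 k2 t' ->
  (forall a b, a < k1 + 3 -> b < k2 + 3 -> (0 < a) || (0 < b) -> t a <> t' b) ->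
  (forall a b, 0 < a < k1 + 3 -> 0 < b < k2 + 3 -> ~~ sadj G (t a) (t' b)) ->
  i < k1 + 3 -> j < k2 + 3 ->
  exists p q, [/\ p < k1 + 3, q < k2 + 3 & obstructing G (t i) (t' j) (t p) (t' q)].
Proof.
move=> [v1 inj1 ad1 ng1] [v2 inj2 ad2 ng2] dif nad ik jk.
have [p /andP[p0 pk] ip] := tadj_gt0 v1 ik.
have [q /andP[q0 qk] jq] := tadj_gt0 v2 jk.
exists p, q; split=> //; rewrite /obstructing ad1 // ad2 // ip jq (negbTE (nad _ _ _ _)) ?p0 ?q0 //=.
rewrite andbT; apply/andP; split; apply/eqP; first by apply: dif; rewrite ?p0.
by apply/nesym/dif; rewrite ?q0 ?orbT.
Qed.

Lemma tad_side_ex k c : 0 < k -> exists2 b, 0 < b < k + 3 & c (+) tad_side k b.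
Proof.
move=> k0; exists (if c (+) odd k then k.+1 else k); first by case: ifP; lia.
case: ifP => h; rewrite /tad_side; first by rewrite !ifF //; lia.
rewrite ltnn eqxx; move: h; case: (k) k0 => //= m _.
by case: c; case: (odd m).
Qed.

Lemma forbidden_obstructed N es t i j : forbidden N es -> embeds G N es t ->
  i < N -> j < N -> part (t i) != part (t j) ->
  exists p q, [/\ p < N, q < N & obstructing G (t i) (t j) (t p) (t q)].
Proof.
move=> fb; case: fb i j; try by move=> i j; apply: (finite_obstructed bG); vm_compute.
- by move=> k k3 i j; apply: (cycle_obstructed sG bG).
- move=> t1 k1 t2 k2 v1 v2 i j em iN jN pij.
  have [tt tt' cr] := sum_embeds_tads v1 v2 em.
  have inj : forall i j, i < sum_size k1 k2 -> j < sum_size k1 k2 -> t i = t j -> i = j by case: em.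
  rewrite /sum_size /tad_size in iN jN inj *.
  have k1_gt0 := tad_gt0 v1.
  have k2_gt0 := tad_gt0 v2.
  have shl w : w < k2 + 3 -> sum_shift k1 w < k1 + 3 + (k2 + 3) - 1.
    by case: w => [|w] wk; rewrite ?(@sum_shiftS k1 _.+1) // /sum_shift /=; lia.
  have sh0 : sum_shift k1 0 = 0 by [].
  have dif a b : a < k1 + 3 -> b < k2 + 3 -> (0 < a) || (0 < b) -> t a <> t (sum_shift k1 b).
    move=> ak bk ab /inj h; have {}h : a = sum_shift k1 b by apply: h; [lia|exact: shl].
    case: (posnP a) ab => [a0|a0] /= ab.
      by move: h; rewrite a0 sum_shiftS //; lia.
    by move/eqP: h; rewrite eq_sym; apply/negP; apply: sum_shiftF; rewrite a0.
  have nad a b : 0 < a < k1 + 3 -> 0 < b < k2 + 3 -> ~~ sadj G (t a) (t (sum_shift k1 b)).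
    by move=> ha hb; case: (cr a b ha hb).
  (* Neighbours of the shared end: [x] in the second tadpole serves the edges at the end in the
     first one, and [y] conversely. *)
  have [x xk x0] := tadj_gt0 v2 (ltn_addl k2 (isT : 0 < 3)).
  have [y yk y0] := tadj_gt0 v1 (ltn_addl k1 (isT : 0 < 3)).
  have s2 v : v < k1 + 3 + (k2 + 3) - 1 -> v < k1 + 3 \/
      exists w, [/\ 0 < w, w < k2 + 3 & v = sum_shift k1 w].
    move=> vN; case: (ltnP v (k1 + 3)) => hv; [by left|right].
    by exists (v - (k1 + 2)); split; rewrite ?sum_shiftS; lia.
  have inT1 z a : z = t a \/ (exists2 b, b < k1 + 3 & z = t b) ->
      a < k1 + 3 + (k2 + 3) - 1 -> exists2 p, p < k1 + 3 + (k2 + 3) - 1 & z = t p.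
    by move=> [->|[b bk ->]] aN; [exists a|exists b => //; lia].
  have inT2 z a : z = t a \/ (exists2 b, b < k2 + 3 & z = t (sum_shift k1 b)) ->
      a < k1 + 3 -> exists2 p, p < k1 + 3 + (k2 + 3) - 1 & z = t p.
    move=> [->|[b bk ->]] ak; first by exists a => //; lia.
    by exists (sum_shift k1 b) => //; exact: shl.
  have fin u v p q : (exists2 a, a < k1 + 3 + (k2 + 3) - 1 & p = t a) ->
      (exists2 a, a < k1 + 3 + (k2 + 3) - 1 & q = t a) -> obstructing G u v p q ->
      exists p q, [/\ p < k1 + 3 + (k2 + 3) - 1, q < k1 + 3 + (k2 + 3) - 1
        & obstructing G u v (t p) (t q)].
    by move=> [a aN ->] [b bN ->] h; exists a, b.
  have xk' := proj2 (andP xk); have yk' := proj2 (andP yk).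
  have both1 : i < k1 + 3 -> j < k1 + 3 -> exists p q,
      [/\ p < k1 + 3 + (k2 + 3) - 1, q < k1 + 3 + (k2 + 3) - 1
        & obstructing G (t i) (t j) (t p) (t q)].
    move=> i1 j1; have [|q qk|p [q [hp hq]]] :=
      tad_pair_obstructed (x := t (sum_shift k1 x)) sG bG tt _ _ i1 j1 pij.
    + by case: (tt') => _ _ ad _; have := ad 0 x; rewrite x0 => h; apply: h; lia.
    + by split; [apply: dif; lia|apply: nad].
    + by apply: fin; [exact: inT1 hp (shl _ xk')|exact: inT1 hq (shl _ xk')].
  have both2 a b : a < k2 + 3 -> b < k2 + 3 ->
      part (t (sum_shift k1 a)) != part (t (sum_shift k1 b)) -> exists p q,
      [/\ p < k1 + 3 + (k2 + 3) - 1, q < k1 + 3 + (k2 + 3) - 1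
        & obstructing G (t (sum_shift k1 a)) (t (sum_shift k1 b)) (t p) (t q)].
    move=> ak bk pab; have [|q qk|p [q [hp hq]]] :=
      tad_pair_obstructed (x := t y) sG bG tt' _ _ ak bk pab.
    + by case: (tt) => _ _ ad _; have := ad 0 y; rewrite y0 => h; apply: h; lia.
    + by rewrite /= symG; split; [apply/nesym/dif; lia|apply: nad].
    + by apply: fin; [exact: inT2 hp yk'|exact: inT2 hq yk'].
  have cross a b : a < k1 + 3 -> b < k2 + 3 -> part (t a) != part (t (sum_shift k1 b)) ->
      exists p q, [/\ p < k1 + 3 + (k2 + 3) - 1, q < k1 + 3 + (k2 + 3) - 1
        & obstructing G (t a) (t (sum_shift k1 b)) (t p) (t q)].
    move=> ak bk; have [->|a0] := posnP a; first by rewrite -{1 2}sh0; apply: both2 => //; rewrite addn3.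
    move=> _; have [p [q [pk qk h]]] := cross_obstructed tt tt' dif nad ak bk.
    apply: fin h; first by exists p => //; lia.
    by exists (sum_shift k1 q) => //; exact: shl.
  case: (s2 i iN) (s2 j jN) pij => [i1|[a [a0 ak ->]]] [j1|[b [b0 bk ->]]] pij.
  + exact: both1.
  + exact: cross.
  + have [|p [q [pN qN h]]] := cross j a j1 ak; first by rewrite eq_sym.
    by exists q, p; split=> //; rewrite obstructingC.
  + exact: both2.
- move=> t1 k1 t2 k2 o v1 v2 i j em iN jN pij.
  have [tt tt' cr] := join_embeds_tads v1 v2 em.
  rewrite /join_size /tad_size in iN jN *.
  have k1_gt0 := tad_gt0 v1.
  have k2_gt0 := tad_gt0 v2.
  pose sh v := v + (k1 + 3).
  have dif a b : a < k1 + 3 -> b < k2 + 3 -> (0 < a) || (0 < b) -> t a <> t (sh b).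
    by move=> ak bk _; case: (cr a b ak bk).
  have ad a b : a < k1 + 3 -> b < k2 + 3 -> sadj G (t a) (t (sh b)) = join_cross k1 k2 o a b.
    by move=> ak bk; case: (cr a b ak bk).
  have nad a b : 0 < a < k1 + 3 -> 0 < b < k2 + 3 -> ~~ sadj G (t a) (t (sh b)).
    by move=> ha hb; rewrite ad ?/join_cross; lia.
  (* Both sides occur among the vertices other than the end, so in either orientation each end has
     such a neighbour in the other tadpole. *)
  have [x /andP[x0 xk] xs] := tad_side_ex o k2_gt0.
  have [y /andP[y0 yk] ys] := tad_side_ex o k1_gt0.
  have s2 v : v < k1 + 3 + (k2 + 3) -> v < k1 + 3 \/ exists2 w, w < k2 + 3 & v = sh w.
    move=> vN; case: (ltnP v (k1 + 3)) => hv; [by left|right].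
    by exists (v - (k1 + 3)); rewrite /sh; lia.
  have inT1 z a : z = t (sh a) \/ (exists2 b, b < k1 + 3 & z = t b) ->
      a < k2 + 3 -> exists2 p, p < k1 + 3 + (k2 + 3) & z = t p.
    by move=> [->|[b bk ->]] aN; [exists (sh a)|exists b]; rewrite // /sh; lia.
  have inT2 z a : z = t a \/ (exists2 b, b < k2 + 3 & z = t (sh b)) ->
      a < k1 + 3 -> exists2 p, p < k1 + 3 + (k2 + 3) & z = t p.
    by move=> [->|[b bk ->]] ak; [exists a|exists (sh b)]; rewrite // /sh; lia.
  have fin u v p q : (exists2 a, a < k1 + 3 + (k2 + 3) & p = t a) ->
      (exists2 a, a < k1 + 3 + (k2 + 3) & q = t a) -> obstructing G u v p q ->
      exists p q, [/\ p < k1 + 3 + (k2 + 3), q < k1 + 3 + (k2 + 3)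
        & obstructing G u v (t p) (t q)].
    by move=> [a aN ->] [b bN ->] h; exists a, b.
  case: (s2 i iN) (s2 j jN) => [i1|[a ak ia]] [j1|[b bk jb]].
  + have [|q qk|p [q [hp hq]]] :=
      tad_pair_obstructed (x := t (sh x)) sG bG tt _ _ i1 j1 pij.
    * by rewrite ad ?/join_cross //; [rewrite xs|lia].
    * by split; [apply: dif; lia|apply: nad; lia].
    * by apply: fin; [exact: inT1 hp xk|exact: inT1 hq xk].
  + have [p [q [pk qk h]]] := cross_obstructed tt tt' dif nad i1 bk.
    apply: fin; last by rewrite jb; exact: h.
      by exists p => //; lia.
    by exists (sh q) => //; rewrite /sh; lia.
  + have [p [q [pk qk h]]] := cross_obstructed tt tt' dif nad j1 ak.
    apply: fin; last by rewrite (obstructingC sG) ia; exact: h.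
      by exists (sh q) => //; rewrite /sh; lia.
    by exists p => //; lia.
  + move: pij; rewrite ia jb => pij.
    have [|q qk|p [q [hp hq]]] :=
      tad_pair_obstructed (x := t y) sG bG tt' _ _ ak bk pij.
    * rewrite symG; apply: (etrans (ad y 0 yk _)); first by lia.
      by rewrite /join_cross [tad_side k1 y (+) o]addbC ys orbT.
    * by rewrite /= symG; split; [apply/nesym/dif; lia|apply: nad; lia].
    * by apply: fin; [exact: inT2 hp yk|exact: inT2 hq yk].
Qed.

End Forbidden.

(** * Simplicial edges *)

Section Simplicial.
Variables (T : finType) (G : sgraph T) (part : T -> bool).
Hypotheses (sG : signed_graph G) (bG : is_bipartition G part).

Let symG : symmetric (sadj G). Proof. by case: sG. Qed.

Lemma obstructed_not_simplicial u v p q : part u != part v ->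
  obstructing G u v p q -> ~ signed_simplicial G part (u, v).
Proof.
move=> puv /and5P[up vq pv qu /negP h] [/= pos cpl]; apply: h.
have irr z : sadj G z z = false by case: sG.
have pS : p \in edge_nbh G u v.
  by rewrite !inE negb_or up pv andbT (_ : p != u) //; apply: contraTneq up => ->; rewrite irr.
have qS : q \in edge_nbh G u v.
  by rewrite !inE negb_or vq qu orbT andbT (_ : q != v) //; apply: contraTneq vq => ->; rewrite irr.
have pvq : part p != part q.
  by move: (bG up) (bG vq) puv; do 4 case: (part _).
have apq : sadj G p q.
  case Pp: (part p); first by apply: cpl; rewrite ?Pp //; move: pvq; rewrite Pp; case: (part q).
  by rewrite symG; apply: cpl; rewrite ?Pp //; move: pvq; rewrite Pp; case: (part q).
by rewrite apq pos.
Qed.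

Lemma unobstructed_simplicial u v : part u != part v ->
  (forall p q, ~~ obstructing G u v p q) -> signed_simplicial G part (u, v).
Proof.
move=> puv hp.
have pos a b : a \in edge_nbh G u v -> b \in edge_nbh G u v -> part a != part b ->
    sadj G a b && ~~ sneg G a b.
  wlog pav : a b / part a = part v => [hw aS bS pab|].
    have [pav|pav] := eqVneq (part a) (part v); first exact: hw.
    rewrite symG; have [_ _ -> _] := sG; apply: hw; rewrite // 1?eq_sym //.
    by move: pab pav; do 3 case: (part _).
  have nbh w c : c \in edge_nbh G u v -> w \in [:: u; v] -> part c != part w ->
      [&& sadj G w c, c != u & c != v].
    rewrite !inE negb_or => /andP[/andP[-> ->]] h w2; move: h; rewrite andbT => h.
    have [/eqP-> {w2 w}|/eqP->] := orP w2 => pcw; case/orP: h => h; rewrite ?h //;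
      by have := bG h; move: puv pcw; do 3 case: (part _).
  move=> aS bS pab.
  have pau : part a != part u by rewrite pav eq_sym.
  have pbv : part b != part v by rewrite -pav eq_sym.
  have /and3P[ua au av] := nbh u a aS (mem_head _ _) pau.
  have /and3P[vb bu bv] : [&& sadj G v b, b != u & b != v].
    by apply: nbh; rewrite // !inE eqxx orbT.
  apply/negPn/negP=> hab; case/negP: (hp a b).
  by rewrite /obstructing ua vb av bu.
split=> a b aS bS /= h.
  by case/andP: (pos a b aS bS (bG h)).
move=> hb; have hab : part a != part b by rewrite h (negbTE hb).
by have /andP[] := pos a b aS bS hab.
Qed.

End Simplicial.

Lemma forbidden_edge N es : forbidden N es ->
  exists i j, [/\ i < N, j < N & has (pmatch i j) es].
Proof.
have tadE t k : valid_tad t k -> has (pmatch k k.+1) (tadpole t k).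
  by move=> v; rewrite has_tadpole // /tadj /tarc; bgoal.
case; try by [exists 0, 2|exists 0, 3|exists 1, 3|exists 0, 4|exists 1, 4].
- move=> k k3; exists 0, 1; split; try lia.
  by rewrite has_cycle ?modn_small //; lia.
- move=> t1 k1 t2 k2 v1 v2; exists k1, k1.+1; rewrite /sum_size /tad_size.
  by split; [lia|lia|rewrite has_cat tadE].
- move=> t1 k1 t2 k2 o v1 v2; exists k1, k1.+1; rewrite /join_size /tad_size.
  by split; [lia|lia|rewrite has_cat tadE].
Qed.

Section Edges.
Variables (T : finType) (part : T -> bool).
Implicit Types (G : sgraph T).

Lemma del_signed G E : signed_graph G -> signed_graph (del_edges G E).
Proof.
case=> sy ir sn sub; split=> [x y|x|x y|x y] /=.
- by rewrite sy orbC.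
- by rewrite ir.
- by rewrite sn orbC.
- by case/andP=> /sub-> ->.
Qed.

Lemma del_bip G E : is_bipartition G part -> is_bipartition (del_edges G E) part.
Proof. by move=> b x y /andP[/b]. Qed.

Lemma chordal_F_free G : signed_graph G -> is_bipartition G part ->
  chordal G part -> F_free G.
Proof.
move=> sG bG [s [[sE sC] simp]] /contains_FP[N [es [fb /(contains_famP _ sG (forbidden_gt0 fb))[t em]]]].
have [inj ad lb] := em; have [symG irrG symnG subG] := sG.
have obs i j : i < N -> j < N -> sadj G (t i) (t j) ->
    exists p q, [/\ p < N, q < N & obstructing G (t i) (t j) (t p) (t q)].
  by move=> iN jN /bG; apply: (forbidden_obstructed sG bG fb em).
pose inI x := [exists i : 'I_N, t i == x].
have inIP x : reflect (exists2 i, i < N & t i = x) (inI x).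
  apply: (iffP existsP) => [[i /eqP<-]|[i iN <-]]; first by exists i.
  by exists (Ordinal iN).
pose inE (p : T * T) := inI p.1 && inI p.2.
have hasE : has inE s.
  have [i [j [iN jN ij]]] : exists i j, [/\ i < N, j < N & sadj G (t i) (t j)].
    have [i [j [iN jN ij]]] := forbidden_edge fb.
    by exists i, j; rewrite ad.
  have : has (fun p => (p == (t i, t j)) || (p == (t j, t i))) s.
    by rewrite has_count sC.
  apply: sub_has => p /orP[]/eqP->; rewrite /inE /=; apply/andP; split; apply/inIP;
    by [exists i|exists j].
(* The ordering is cut at its first edge with both ends in the pattern; until then the pattern is
   intact, as [keep] records. *)
move: sE simp; case: (split_find hasE) => -[x y] s1 s2 /andP[/= /inIP[i iN ix] /inIP[j jN jy]] ns1.
move=> /(_ (x, y)); rewrite mem_cat mem_rcons mem_head => /(_ isT) /= xy simp.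
rewrite -{x}ix -{y}jy in xy simp.
have keep a b : a < N -> b < N -> ((t a, t b) \in s1) || ((t b, t a) \in s1) = false.
  move=> aN bN; apply/negbTE; apply: contra ns1 => h; apply/hasP.
  by case/orP: h => h; [exists (t a, t b)|exists (t b, t a)];
    rewrite // /inE /=; apply/andP; split; apply/inIP; [exists a|exists b|exists b|exists a].
have [p [q [pN qN h]]] := obs i j iN jN xy.
apply: (obstructed_not_simplicial (p := t p) (q := t q) (del_signed s1 sG) (@del_bip _ s1 bG) (bG _ _ xy) _ (simp s1 _ s2 _)).
  by move: h; rewrite /obstructing /= !keep // !andbT => h; exact: h.
by rewrite cat_rcons.
Qed.

(** A pattern of the smaller graph that avoids [u] or [v] is already one of [G]. Otherwise the
    pattern obstructs the pair [u], [v], and the obstruction persists in [G] since [p q] is not the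
    deleted edge. *)
Lemma F_free_del G u v : signed_graph G -> is_bipartition G part -> sadj G u v ->
  signed_simplicial G part (u, v) -> F_free G -> F_free (del_edges G [:: (u, v)]).
Proof.
move=> sG bG uv simp ff; set G' := del_edges _ _.
have sG' : signed_graph G' by exact: del_signed.
have bG' : is_bipartition G' part by exact: del_bip.
move=> /contains_FP[N [es [fb /(contains_famP _ sG' (forbidden_gt0 fb))[t em]]]].
have [inj ad lb] := em; have [symG irrG symnG subG] := sG.
have [/andP[/existsP[i /eqP ui] /existsP[j /eqP vj]]|nI] :=
    boolP ([exists i : 'I_N, u == t i] && [exists j : 'I_N, v == t j]).
  have pij : part (t i) != part (t j) by rewrite -ui -vj bG.
  have [p [q [pN qN h]]] := forbidden_obstructed sG' bG' fb em (ltn_ord i) (ltn_ord j) pij.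
  move: h; rewrite -ui -vj => /and5P[up vq pv qu pq].
  apply: (obstructed_not_simplicial sG bG (bG _ _ uv) (p := t p) (q := t q)) simp.
  move: up vq => /andP[up _] /andP[vq _]; rewrite /obstructing up vq pv qu.
  apply: contra pq => /= /andP[-> npq]; rewrite (negbTE npq) /= andbT !inE !xpair_eqE.
  rewrite !negb_or !negb_and pv qu !orbT /= orbC.
  by rewrite (_ : t q != v) //; apply: contraTneq vq => ->; rewrite irrG.
apply: ff; apply/contains_FP; exists N, es; split=> //.
apply/(contains_famP _ sG (forbidden_gt0 fb)); exists t.
have keep a b : a < N -> b < N -> ((t a, t b) \in [:: (u, v)]) || ((t b, t a) \in [:: (u, v)]) = false.
  move=> aN bN; apply/negbTE; apply: contra nI; rewrite !inE !xpair_eqE.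
  by case/orP=> /andP[/eqP<- /eqP<-]; apply/andP; split; apply/existsP;
    [exists (Ordinal aN)|exists (Ordinal bN)|exists (Ordinal bN)|exists (Ordinal aN)].
split=> // [a b aN bN|a b aN bN].
  by rewrite -ad //= keep // andbT.
by have := lb a b aN bN; rewrite /= keep // andbT.
Qed.

Lemma chordal_of_simplicial :
  (forall G, signed_graph G -> is_bipartition G part -> F_free G ->
     (exists x y, sadj G x y) -> exists u v, sadj G u v /\ signed_simplicial G part (u, v)) ->
  forall G, signed_graph G -> is_bipartition G part -> F_free G -> chordal G part.
Proof.
move=> core G; have [m] := ubnP #|[set p | sadj G p.1 p.2]|.
elim: m => // m IH in G *; rewrite ltnS => cm sG bG ff.
have [symG irrG symnG subG] := sG.
have [|noe] := boolP [exists x, exists y, sadj G x y]; last first.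
  have noE x y : sadj G x y = false.
    apply/negbTE; apply: contra noe => xy.
    by apply/existsP; exists x; apply/existsP; exists y.
  exists [::]; split; first by split=> // x y; rewrite noE.
  by case.
case/existsP=> x /existsP[y xy].
have [|u [v [uv simp]]] := core G sG bG ff; first by exists x, y.
pose G' := del_edges G [:: (u, v)].
have [||||s [[sE sC] ss]] := IH G'.
- apply: leq_trans cm; apply: proper_card; apply/properP; split.
    by apply/subsetP => p; rewrite !inE /= => /andP[].
  by exists (u, v); rewrite inE /= uv // mem_head.
- exact: del_signed.
- exact: del_bip.
- exact: F_free_del.
exists ((u, v) :: s); split.
  split=> [p|a b ab]; first by rewrite inE => /orP[/eqP->//|/sE/andP[]].
  have [ab_uv|ab_uv] := boolP (((a, b) == (u, v)) || ((b, a) == (u, v))).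
    have -> : count (fun p => (p == (a, b)) || (p == (b, a))) ((u, v) :: s) =
        (count (fun p => (p == (a, b)) || (p == (b, a))) s).+1.
      by rewrite /= [(u, v) == _]eq_sym [(u, v) == (b, a)]eq_sym ab_uv.
    congr _.+1; apply/eqP; rewrite -leqn0 leqNgt -has_count; apply/negP=> /hasP[p ps hp].
    have /andP[_] := sE p ps.
    by case/orP: hp => /eqP->; rewrite !inE ?ab_uv // orbC ab_uv.
  rewrite /= [(u, v) == _]eq_sym [(u, v) == (b, a)]eq_sym (negbTE ab_uv) add0n.
  by apply: sC; rewrite /= ab !inE.
have delC s1 a b : sadj (del_edges G ((u, v) :: s1)) a b = sadj (del_edges G' s1) a b.
  by rewrite /= !inE -andbA; case: (sadj G a b) => //=;
    do 4 case: (_ \in _) || case: (_ == _).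
have delnC s1 a b : sneg (del_edges G ((u, v) :: s1)) a b = sneg (del_edges G' s1) a b.
  by rewrite /= !inE -andbA; case: (sneg G a b) => //=;
    do 4 case: (_ \in _) || case: (_ == _).
case=> [|e1 s1] e s2 /= [].
  move=> <- _; move: simp; rewrite /signed_simplicial /positive_biclique.
  have delN a b : sadj (del_edges G [::]) a b = sadj G a b by rewrite /= andbT.
  have delnN a b : sneg (del_edges G [::]) a b = sneg G a b by rewrite /= andbT.
  have -> : edge_nbh (del_edges G [::]) (u, v).1 (u, v).2 = edge_nbh G (u, v).1 (u, v).2.
    by apply/setP=> z; rewrite !inE /= !andbT.
  by case=> h1 h2; split=> a b aS bS; rewrite delN ?delnN; [apply: h1|apply: h2].
move=> <- /ss[h1 h2].
have nE : edge_nbh (del_edges G ((u, v) :: s1)) e.1 e.2 = edge_nbh (del_edges G' s1) e.1 e.2.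
  by apply/setP=> z; rewrite !in_setD !in_setU !in_set delC delC.
split=> a b; rewrite nE => aS bS; rewrite delC ?delnC; [exact: h1|exact: h2].
Qed.

End Edges.

Lemma tad_side0 two k : valid_tad two k -> tad_side k 0 = false.
Proof. by move=> /tad_gt0 k0; rewrite /tad_side k0. Qed.

Lemma tadjSS two k i j : tadj two k.+1 i.+1 j.+1 = tadj two k i j.
Proof. by rewrite /tadj /tarc !eqSS !ltnS. Qed.

Lemma tnegSS two k i j : tneg two k.+1 i.+1 j.+1 = tneg two k i j.
Proof. by rewrite /tneg /tnegarc !eqSS. Qed.

Ltac nlia := repeat match goal with
  | H : ?P |- _ => lazymatch type of P with
    | Prop => lazymatch P with
      | is_true (leq _ _) => fail
      | is_true (~~ (leq _ _)) => fail
      | is_true (leq _ _ && leq _ _) => fail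
      | is_true false => fail
      | is_true (odd _) => fail
      | is_true (~~ odd _) => fail
      | is_true (@eq_op _ _ _) => fail
      | is_true (~~ (@eq_op _ _ _)) => fail
      | is_true (@eq_op _ _ _ || @eq_op _ _ _) => fail
      | @eq nat _ _ => fail
      | _ <> _ => fail
      | _ => clear H
      end
    end
  end; lia.

(** Whatever the type, [x_k], [w], [y], [z] span the 4-cycle of the shortest tadpole;
    [tad_vs_vertex] puts a new end in front of it. *)
Lemma tadj_head two k i j : valid_tad two k -> i < 4 -> j < 4 ->
  tadj two k (i + k).-1 (j + k).-1 = tadj false 1 i j.
Proof.
move=> va i4 j4; rewrite /tadj /tarc.
by case: two va => /= va; apply/idP/idP=> h; bhyps; bgoal.
Qed.

(** * Levels *)

(* Here [X] and [Y] are the sides of a bigraph in which [a] in [X] and [b] in [Y] are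
   adjacent iff [rk b <= rk a], and [ng] are its negative edges. A vertex of rank 0
   or [r + 1] lies outside of the part under study. [sig m] are the negative edges which
   cross from a rank at most [m] to a rank above [m]. An edge [a b] as in [level_cover i]
   is not obstructed. *)
Section Levels.
Variables (T : finType) (X Y : {pred T}) (ng : rel T) (rk : T -> nat) (r : nat).

Definition sig m p q := ng p q && (rk q <= m < rk p).

(** The negative edges across the gap between ranks [m] and [m + 1] share their vertex in [X], and
    for [YT] their vertex in [Y]. Both hold iff at most one negative edge crosses. *)
Definition XT m := [forall p, forall q, forall p', forall q',
  sig m p q && sig m p' q' ==> (p == p')].
Definition YT m := [forall p, forall q, forall p', forall q',
  sig m p q && sig m p' q' ==> (q == q')].

Lemma XTP m : reflect (forall p q p' q', sig m p q -> sig m p' q' -> p = p') (XT m).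
Proof.
apply: (iffP forallP) => [h p q p' q' h1 h2|h p].
  have /forallP/(_ q)/forallP/(_ p')/forallP/(_ q') := h p.
  by rewrite h1 h2 => /eqP.
by apply/forallP=> q; apply/forallP=> p'; apply/forallP=> q'; apply/implyP=> /andP[h1 h2];
  apply/eqP/(h _ _ _ _ h1 h2).
Qed.

Lemma YTP m : reflect (forall p q p' q', sig m p q -> sig m p' q' -> q = q') (YT m).
Proof.
apply: (iffP forallP) => [h p q p' q' h1 h2|h p].
  have /forallP/(_ q)/forallP/(_ p')/forallP/(_ q') := h p.
  by rewrite h1 h2 => /eqP.
by apply/forallP=> q; apply/forallP=> p'; apply/forallP=> q'; apply/implyP=> /andP[h1 h2];
  apply/eqP/(h _ _ _ _ h1 h2).
Qed.

Hypotheses (r_gt0 : 0 < r)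
  (LX : forall i, 0 < i <= r -> exists2 a, a \in X & rk a = i)
  (LY : forall i, 0 < i <= r -> exists2 b, b \in Y & rk b = i)
  (ngXY : forall p q, ng p q -> p \in X /\ q \in Y)
  (rk_le : forall p q, ng p q -> rk p <= r.+1)
  (corner : forall p q, ng p q -> rk q = 0 -> rk p <= r)
  (star : forall m p q p' q', m <= r -> sig m p q -> sig m p' q' -> p = p' \/ q = q')
  (cov : forall i, 0 < i <= r -> exists a b, [/\ a \in X, b \in Y, i <= rk a, rk b <= i &
     forall p q, ng p q -> i <= rk p -> rk q <= i -> p = a \/ q = b])
  (X0 : XT 0) (Yr : YT r).

Definition level_cover i := exists a b, [/\ a \in X, b \in Y, rk a = i, rk b = i &
  forall p q, ng p q -> i <= rk p -> rk q <= i -> p = a \/ q = b].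

(** The germ of a tadpole of type 2 with [k = 2]: [p] is the end, [b0] the second path vertex, [b]
    is [w], and [a1], [a2] are [y], [z]. Uniqueness of the crossing edge is kept in order to compare
    levels. *)
Definition level_up i p b :=
  [/\ sig i p b, rk b = i, (forall p' q', ~~ sig i.-1 p' q'),
      (forall p' q', sig i p' q' -> p' = p /\ q' = b)
    & exists b0 a1 a2, [/\ b != b0, a1 != a2, rk b0 = i, rk a1 = i /\ rk a2 = i
        & ng a1 b0 /\ ng a2 b0]].

Definition level_down i a q :=
  [/\ sig i.-1 a q, rk a = i, (forall p' q', ~~ sig i p' q'),
      (forall p' q', sig i.-1 p' q' -> p' = a /\ q' = q)
    & exists a0 b1 b2, [/\ a != a0, b1 != b2, rk a0 = i, rk b1 = i /\ rk b2 = i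
        & ng a0 b1 /\ ng a0 b2]].

(** Pairwise meeting edges of a bipartite graph have a common vertex, for want of triangles. *)
Lemma XT_or_YT m : m <= r -> XT m || YT m.
Proof.
move=> mr; apply/negPn/negP; rewrite negb_or => /andP[/negP nx /negP ny].
case: nx; apply/XTP => p q p' q' h h'; apply/eqP/negPn/negP => pp.
have qq : q = q' by case: (star mr h h') => // E; rewrite E eqxx in pp.
case: ny; suff H u v : sig m u v -> v = q.
  by apply/YTP=> p1 q1 p2 q2 /H-> /H->.
move=> huv; case: (star mr huv h) => // up; case: (star mr huv h') => [up'|->//].
by rewrite -up -up' eqxx in pp.
Qed.

(** A covering vertex of rank other than [i] covers only edges across a gap next to [i]. By [XT] or
    [YT] and the last hypothesis these share one vertex of rank [i] on the other side, which may
    replace it. Only if both covering vertices then lie on the same side can a cover fail to result,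
    and the failure is [level_up] or [level_down]. *)
Lemma level_cases i : 0 < i <= r -> XT i.-1 -> YT i ->
  (forall p q, ng p q -> i < rk p -> i <= rk q) ->
  [\/ level_cover i, exists p b, level_up i p b | exists a q, level_down i a q].
Proof.
move=> i1r /XTP xt /YTP yt nocom; have [i1 ir] := andP i1r.
have [a [b [aX bY ia bi ab]]] := cov i1r.
have [a' a'X ra'] := LX i1r; have [b' b'Y rb'] := LY i1r.
have sigi p q : ng p q -> i < rk p -> rk q <= i -> sig i p q by rewrite /sig => -> -> ->.
have sigp p q : ng p q -> i <= rk p -> rk q < i -> sig i.-1 p q.
  by move=> h1 h2 h3; rewrite /sig h1; nlia.
have [eai|nai] := eqVneq (rk a) i; have [ebi|nbi] := eqVneq (rk b) i.
- by constructor 1; exists a, b.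
- have bi' : rk b < i by nlia.
  (* The edges at [b] under consideration cross the gap below [i], hence share the vertex [c], which
     replaces [b]. *)
  have [/existsP[c /and3P[ncb ca ic]]|] := boolP [exists c, [&& ng c b, c != a & i <= rk c]]; last first.
    rewrite negb_exists => /forallP h; constructor 1; exists a, b'; split=> // p q npq ip qi.
    case: (ab p q npq ip qi) => [->|qb]; [by left|left].
    by move: (h p); rewrite -qb npq ip andbT /= negbK => /eqP.
  have rc : rk c = i by apply/eqP; rewrite eqn_leq ic andbT leqNgt; apply/negP=> /(nocom _ _ ncb); nlia.
  (* If [a] has at most one negative neighbour here, this neighbour and [c] are a cover. *)
  have [/existsP[b1 /existsP[b2 /and5P[b12 n1 n2 r1 r2]]]|] := boolP [exists b1, exists b2,
      [&& b1 != b2, ng a b1, ng a b2, rk b1 <= i & rk b2 <= i]].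
    have lvl q : ng a q -> rk q <= i -> rk q = i.
      move=> naq qi; apply/eqP; rewrite eqn_leq qi /= leqNgt; apply/negP=> qi'.
      have := xt _ _ _ _ (sigp _ _ ncb ic bi') (sigp _ _ naq ia qi').
      by move: ca => /eqP.
    constructor 3; exists c, b; split=> //.
    + by apply: sigp.
    + move=> p' q'; apply/negP=> /andP[npq /andP[qi ip]].
      case: (ab p' q' npq (ltnW ip) qi) => E.
        by move: ip; rewrite E eai ltnn.
      by have := nocom _ _ npq ip; rewrite E; nlia.
    + move=> p' q' h; have pc := xt _ _ _ _ h (sigp _ _ ncb ic bi'); split=> //.
      have /andP[npq /andP[qi ip]] := h.
      by case: (ab p' q' npq _ _) => //; [nlia|nlia|move=> E; move: ca; rewrite -pc E eqxx].
    + exists a, b1, b2; split=> //; split; exact: lvl.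
  rewrite negb_exists => /forallP h; constructor 1.
  have h2 b1 b2 : ng a b1 -> ng a b2 -> rk b1 <= i -> rk b2 <= i -> b1 = b2.
    move=> m1 m2 l1 l2; have := h b1; rewrite negb_exists => /forallP/(_ b2).
    by rewrite m1 m2 l1 l2 !andbT negbK => /eqP.
  have [/existsP[b1 /andP[nb1 rb1]]|] := boolP [exists b1, ng a b1 && (rk b1 <= i)].
    have rb1i : rk b1 = i.
      apply/eqP; rewrite eqn_leq rb1 leqNgt /=; apply/negP=> l.
      have := xt _ _ _ _ (sigp _ _ ncb ic bi') (sigp _ _ nb1 ia l).
      by move: ca => /eqP.
    exists c, b1; split=> //; [exact: (ngXY ncb).1|exact: (ngXY nb1).2|].
    move=> p q npq ip qi; case: (ab p q npq ip qi) => E.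
      by right; apply: h2 => //; rewrite -E.
    by left; apply: xt (sigp _ _ npq ip _) (sigp _ _ ncb ic bi'); rewrite E.
  rewrite negb_exists => /forallP h3.
  exists c, b'; split=> //; first exact: (ngXY ncb).1.
  move=> p q npq ip qi; case: (ab p q npq ip qi) => E.
    by have := h3 q; rewrite -E npq qi.
  by left; apply: xt (sigp _ _ npq ip _) (sigp _ _ ncb ic bi'); rewrite E.
- have ia' : i < rk a by nlia.
  have [/existsP[c /and3P[nac cb ci]]|] := boolP [exists c, [&& ng a c, c != b & rk c <= i]]; last first.
    rewrite negb_exists => /forallP h; constructor 1; exists a', b; split=> // p q npq ip qi.
    case: (ab p q npq ip qi) => [pa|->]; [right|by right].
    by move: (h q); rewrite -pa npq qi andbT /= negbK => /eqP.
  have rc : rk c = i by apply/eqP; rewrite eqn_leq ci; exact: (nocom _ _ nac).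
  have [/existsP[a1 /existsP[a2 /and5P[a12 n1 n2 r1 r2]]]|] := boolP [exists a1, exists a2,
      [&& a1 != a2, ng a1 b, ng a2 b, i <= rk a1 & i <= rk a2]].
    have lvl p : ng p b -> i <= rk p -> rk p = i.
      move=> npb ip; apply/eqP; rewrite eqn_leq ip andbT leqNgt; apply/negP=> ip'.
      have := yt _ _ _ _ (sigi _ _ nac ia' ci) (sigi _ _ npb ip' bi).
      by move: cb => /eqP.
    constructor 2; exists a, c; split=> //.
    + by apply: sigi.
    + move=> p' q'; apply/negP=> /andP[npq /andP[qi ip]].
      case: (ab p' q' npq _ _) => [||E|E]; [nlia|nlia| |].
        by have := nocom _ _ npq _; rewrite E => /(_ ia'); nlia.
      by move: qi; rewrite E ebi; nlia.
    + move=> p' q' h; have qc := yt _ _ _ _ h (sigi _ _ nac ia' ci); split=> //.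
      have /andP[npq /andP[qi ip]] := h.
      by case: (ab p' q' npq _ _) => //; [nlia|move=> E; move: cb; rewrite -qc E eqxx].
    + exists b, a1, a2; split=> //; split; exact: lvl.
  rewrite negb_exists => /forallP h; constructor 1.
  have h2 a1 a2 : ng a1 b -> ng a2 b -> i <= rk a1 -> i <= rk a2 -> a1 = a2.
    move=> m1 m2 l1 l2; have := h a1; rewrite negb_exists => /forallP/(_ a2).
    by rewrite m1 m2 l1 l2 !andbT negbK => /eqP.
  have [/existsP[a1 /andP[na1 ra1]]|] := boolP [exists a1, ng a1 b && (i <= rk a1)].
    have ra1i : rk a1 = i.
      apply/eqP; rewrite eqn_leq ra1 andbT leqNgt; apply/negP=> l.
      have := yt _ _ _ _ (sigi _ _ nac ia' ci) (sigi _ _ na1 l bi).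
      by move: cb => /eqP.
    exists a1, c; split=> //; [exact: (ngXY na1).1|exact: (ngXY nac).2|].
    move=> p q npq ip qi; case: (ab p q npq ip qi) => E.
      by right; apply: yt (sigi _ _ npq _ qi) (sigi _ _ nac ia' ci); rewrite E.
    by left; apply: h2 => //; rewrite -E.
  rewrite negb_exists => /forallP h3.
  exists a', c; split=> //; first exact: (ngXY nac).2.
  move=> p q npq ip qi; case: (ab p q npq ip qi) => E.
    by right; apply: yt (sigi _ _ npq _ qi) (sigi _ _ nac ia' ci); rewrite E.
  by have := h3 p; rewrite -E npq ip.
- have ia' : i < rk a by nlia.
  have bi' : rk b < i by nlia.
  constructor 1.
  have [a1 [a1X ra1 ha1]] : exists a1, [/\ a1 \in X, rk a1 = i &
      forall p, ng p b -> i <= rk p -> p = a1].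
    have [/existsP[c /andP[ncb ic]]|] := boolP [exists c, ng c b && (i <= rk c)].
      exists c; split; first exact: (ngXY ncb).1.
        by apply/eqP; rewrite eqn_leq ic andbT leqNgt; apply/negP=> /(nocom _ _ ncb); nlia.
      move=> p npb ip; exact: xt (sigp _ _ npb ip bi') (sigp _ _ ncb ic bi').
    rewrite negb_exists => /forallP h; exists a'; split=> // p npb ip.
    by have := h p; rewrite npb ip.
  have [b1 [b1Y rb1 hb1]] : exists b1, [/\ b1 \in Y, rk b1 = i &
      forall q, ng a q -> rk q <= i -> q = b1].
    have [/existsP[c /andP[nac ci]]|] := boolP [exists c, ng a c && (rk c <= i)].
      exists c; split; first exact: (ngXY nac).2.
        by apply/eqP; rewrite eqn_leq ci; exact: (nocom _ _ nac).
      move=> q naq qi; exact: yt (sigi _ _ naq ia' qi) (sigi _ _ nac ia' ci).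
    rewrite negb_exists => /forallP h; exists b'; split=> // q naq qi.
    by have := h q; rewrite naq qi.
  exists a1, b1; split=> // p q npq ip qi; case: (ab p q npq ip qi) => E.
    by right; apply: hb1; rewrite -?E.
  by left; apply: ha1; rewrite -?E.
Qed.

Lemma switch (P : nat -> bool) a b : a <= b -> ~~ P a -> P b ->
  exists i, [/\ a <= i, i < b, ~~ P i & P i.+1].
Proof.
move=> ab nPa; elim: b ab => [|b IH].
  by rewrite leqn0 => /eqP<-; rewrite (negbTE nPa).
rewrite leq_eqVlt => /orP[/eqP<-|]; first by rewrite (negbTE nPa).
rewrite ltnS => ab Pb; have [Pb'|nPb] := boolP (P b).
  by have [i [h1 h2 h3 h4]] := IH ab Pb'; exists i; split=> //; nlia.
by exists b.
Qed.

(** Without a cover, every gap is crossed by at most one negative edge: where [YT] or [XT] changes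
    its value [level_cases] applies, and its other outcomes leave at most one edge on each of the
    two gaps. The lowest crossing edge then connects two levels, or a level with rank 0 or
    [r + 1]. *)
Lemma levels : [\/ exists2 i, 0 < i <= r & level_cover i,
  exists i p b, [/\ 0 < i <= r, level_up i p b & rk p = r.+1],
  exists i a q, [/\ 0 < i <= r, level_down i a q & rk q = 0]
  | exists i j p q, [/\ 0 < i <= r, 0 < j <= r, i < j, level_up i p q & level_down j p q]].
Proof.
pose cover := [exists i : 'I_r.+1, [exists a, [exists b,
  [&& 0 < i, a \in X, b \in Y, rk a == i, rk b == i & [forall p, [forall q,
     [&& ng p q, i <= rk p & rk q <= i] ==> (p == a) || (q == b)]]]]]].
have [/existsP[i /existsP[a /existsP[b /and5P[i0 aX bY ra /andP[rb /forallP h]]]]]|noc] := boolP cover.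
  constructor 1; exists i; first by rewrite i0 -ltnS ltn_ord.
  exists a, b; split=> //; [exact/eqP|exact/eqP|move=> p q npq ip qi].
  have /forallP/(_ q) := h p; rewrite npq ip qi.
  by case/orP=> /eqP; [left|right].
have {}noc i : 0 < i <= r -> ~ level_cover i.
  case/andP=> i0 ir [a [b [aX bY ra rb ab]]]; case/negP: noc.
  have ir' : i < r.+1 by [].
  apply/existsP; exists (Ordinal ir'); apply/existsP; exists a; apply/existsP; exists b.
  rewrite i0 aX bY ra rb eqxx /=; apply/forallP=> p; apply/forallP=> q.
  by apply/implyP=> /and3P[npq ip qi]; apply/orP; case: (ab p q npq ip qi) => ->; rewrite eqxx; auto.
have up_YT i p b : level_up i p b -> XT i && YT i && XT i.-1 && YT i.-1.
  case=> _ _ h1 h2 _; rewrite -!andbA; apply/and4P; split.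
  - by apply/XTP=> p1 q1 p2 q2 /h2[-> _] /h2[->].
  - by apply/YTP=> p1 q1 p2 q2 /h2[_ ->] /h2[_ ->].
  - by apply/XTP=> p1 q1 p2 q2 h; case/negP: (h1 p1 q1).
  - by apply/YTP=> p1 q1 p2 q2 h; case/negP: (h1 p1 q1).
have down_YT i p b : level_down i p b -> XT i && YT i && XT i.-1 && YT i.-1.
  case=> _ _ h1 h2 _; rewrite -!andbA; apply/and4P; split.
  - by apply/XTP=> p1 q1 p2 q2 h; case/negP: (h1 p1 q1).
  - by apply/YTP=> p1 q1 p2 q2 h; case/negP: (h1 p1 q1).
  - by apply/XTP=> p1 q1 p2 q2 /h2[-> _] /h2[->].
  - by apply/YTP=> p1 q1 p2 q2 /h2[_ ->] /h2[_ ->].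
have allYT m : m <= r -> YT m.
  move=> mr; apply/negPn/negP=> nY.
  have [i [mi ir nYi Yi]] := switch mr nY Yr.
  have Xi : XT i by have := XT_or_YT (ltnW ir); rewrite (negbTE nYi) orbF.
  have i1r : 0 < i.+1 <= r by rewrite ir.
  case: (level_cases i1r Xi Yi) => [p q npq ip|/noc|[p [b /up_YT]]|[a [q /down_YT]]] //.
  (* By [XT i] all edges across gap [i] end in [p]; as [p] is above [i + 1] they cross gap [i + 1]
     too, and [YT] is inherited from there. *)
  - rewrite ltnNge; apply/negP=> qi; case/negP: nYi; apply/YTP.
    have spq : sig i p q by rewrite /sig npq qi ltnW.
    have sS u v : sig i u v -> sig i.+1 u v.
      move=> h; have up := XTP _ Xi _ _ _ _ h spq; move: h.
      by rewrite /sig up ip => /andP[-> /andP[h _]]; rewrite (leq_trans h).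
    by move=> p1 q1 p2 q2 /sS h1 /sS h2; exact: YTP _ Yi _ _ _ _ h1 h2.
  - by rewrite (negbTE nYi) andbF.
  - by rewrite (negbTE nYi) andbF.
have allXT m : m <= r -> XT m.
  move=> mr; apply/negPn/negP=> nX.
  have [] := @switch (fun i => ~~ XT i) 0 m (leq0n _) _ nX; first by rewrite negbK.
  move=> i [_ im]; rewrite negbK => Xi nXi.
  have i1r : 0 < i.+1 <= r by rewrite (leq_trans im).
  have Yi : YT i.+1 by apply: allYT; case/andP: i1r.
  case: (level_cases i1r Xi Yi) => [p q npq ip|/noc|[p [b /up_YT]]|[a [q /down_YT]]] //.
  - rewrite ltnNge; apply/negP=> qi; case/negP: nXi; apply/XTP.
    have spq : sig i.+1 p q by rewrite /sig npq ip (leq_trans qi).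
    have sS u v : sig i.+1 u v -> sig i u v.
      move=> h; have up := YTP _ Yi _ _ _ _ h spq; move: h.
      by rewrite /sig up qi => /andP[-> /andP[_ h]]; rewrite ltnW.
    by move=> p1 q1 p2 q2 /sS h1 /sS h2; exact: XTP _ Xi _ _ _ _ h1 h2.
  - by rewrite (negbTE nXi).
  - by rewrite (negbTE nXi).
have uniq_sig m p q p' q' : m <= r -> sig m p q -> sig m p' q' -> p = p' /\ q = q'.
  by move=> mr h h'; split; [exact: XTP _ (allXT m mr) _ _ _ _ h h'|exact: YTP _ (allYT m mr) _ _ _ _ h h'].
have lvl i : 0 < i <= r -> (forall p q, ng p q -> i < rk p -> i <= rk q) ->
    (exists p b, level_up i p b) \/ exists a q, level_down i a q.
  move=> i1r nocom; have [i0 ir] := andP i1r.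
  have ipr : i.-1 <= r by apply: leq_trans (leq_pred _) ir.
  by case: (level_cases i1r (allXT _ ipr) (allYT _ ir) nocom) => [/(noc _ i1r)|h|h]; auto.
have [/existsP[p /existsP[q pq0]]|no0] := boolP [exists p, [exists q, sig 0 p q]].
  have /andP[npq /andP[q0 p0]] := pq0; have {}q0 : rk q = 0 by apply/eqP; rewrite -leqn0.
  (* An edge from rank 0 may not run up to rank [r + 1], where there is no level to analyse. *)
  have pr := corner npq q0; have j1r : 0 < rk p <= r by rewrite p0.
  have sp : sig (rk p).-1 p q by rewrite /sig npq q0 /= prednK.
  have pr' : (rk p).-1 <= r by apply: leq_trans (leq_pred _) pr.
  case: (lvl _ j1r) => [p' q' npq' pp'|[p' [b [_ _ h _ _]]]|[a [q' h]]].
  - rewrite leqNgt; apply/negP=> qp.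
    have sp' : sig (rk p).-1 p' q'.
      by rewrite /sig npq' (leq_ltn_trans (leq_pred _) pp') andbT -ltnS prednK.
    by have [pE _] := uniq_sig _ _ _ _ _ pr' sp sp'; rewrite -pE ltnn in pp'.
  - by have := h p q; rewrite sp.
  - constructor 3; exists (rk p), a, q'; split=> //.
    by have [h1 _ _ _ _] := h; have [_ <-] := uniq_sig _ _ _ _ _ pr' sp h1.
have {}no0 p q : ~~ sig 0 p q.
  by move: no0; rewrite negb_exists => /forallP/(_ p); rewrite negb_exists => /forallP/(_ q).
have l1 : 0 < 1 <= r by [].
case: (lvl 1 l1) => [p q npq p1|[p [b up1]]|[a [q [h _ _ _ _]]]]; last first.
- by case/negP: (no0 a q).
- have [s1 rb _ u1 _] := up1; have /andP[npb /andP[_ p1]] := s1.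
  have [pr|pr] := leqP (rk p) r; last first.
    by constructor 2; exists 1, p, b; split=> //; apply/eqP; rewrite eqn_leq pr (rk_le npb).
  have j1r : 0 < rk p <= r by rewrite (ltnW p1).
  have sp : sig (rk p).-1 p b by rewrite /sig npb rb -ltnS prednK ?p1 /= //; exact: ltnW.
  have pr' : (rk p).-1 <= r by apply: leq_trans (leq_pred _) pr.
  case: (lvl _ j1r) => [p' q' npq' pp'|[p' [b' [_ _ h _ _]]]|[a [q' h]]].
  + rewrite leqNgt; apply/negP=> qp.
    have sp' : sig (rk p).-1 p' q'.
      by rewrite /sig npq' (leq_ltn_trans (leq_pred _) pp') andbT -ltnS prednK // ltnW.
    by have [pE _] := uniq_sig _ _ _ _ _ pr' sp sp'; rewrite -pE ltnn in pp'.
  + by have := h p b; rewrite sp.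
  + have [h1 _ _ _ _] := h; have [pE bE] := uniq_sig _ _ _ _ _ pr' sp h1.
    rewrite -pE -bE in h.
    by constructor 4; exists 1, (rk p), p, b; split.
- by rewrite lt0n; apply/negP=> /eqP q0; case/negP: (no0 p q); rewrite /sig npq q0 /=; exact: ltnW.
Qed.

End Levels.

(** * Ranks from a chain of neighbourhoods *)

Section Ranks.
Variables (T : finType) (e : rel T) (part : T -> bool) (K : {set T}).
Hypotheses (symG : symmetric e) (bG : forall x y, e x y -> part x != part y)
  (x0 : T) (x0K : x0 \in K)
  (hK : forall x, x \in K -> exists2 y, y \in K & e x y)
  (chain : forall a a' b b', a \in K -> a' \in K -> b \in K -> b' \in K ->
     part a -> part a' -> e a b -> e a' b' -> e a b' || e a' b).

(* [C] is the chain of the neighbourhoods of the vertices on the side [part]. Such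
   a vertex is ranked by the position of its neighbourhood in [C], and a vertex on
   the other side by the first position of [C] at which it occurs. *)
Let N a := [set b in K | e a b].
Let C : {set {set T}} := [set N a | a in K & part a].
Let D (c : {set T}) : {set {set T}} := [set c' in C | c' \subset c].
Let U (b : T) : {set {set T}} := [set c in C | b \in c].
Let r := #|C|.
Let rk x := if part x then #|D (N x)| else r.+1 - #|U x|.

Let CP c : reflect (exists2 a, (a \in K) && part a & c = N a) (c \in C).
Proof. by apply: (iffP imsetP) => [[a]|[a]]; rewrite ?inE => h ->; exists a; rewrite ?inE. Qed.

Let CN a : a \in K -> part a -> N a \in C.
Proof. by move=> aK pa; apply/CP; exists a; rewrite ?aK. Qed.

Let Dsub c : D c \subset C. Proof. by apply/subsetP=> x; rewrite inE => /andP[]. Qed.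
Let Usub c : U c \subset C. Proof. by apply/subsetP=> x; rewrite inE => /andP[]. Qed.

Let Ctotal c c' : c \in C -> c' \in C -> (c \subset c') || (c' \subset c).
Proof.
move=> /CP[a /andP[aK pa] ->] /CP[a' /andP[aK' pa'] ->].
apply/negPn/negP; rewrite negb_or => /andP[/subsetPn[b] + + /subsetPn[b']].
rewrite !inE => /andP[bK ab] + /andP[bK' ab']; rewrite bK bK' /= => h h'.
by have := chain aK aK' bK bK' pa pa' ab ab'; rewrite (negbTE h) (negbTE h').
Qed.

Let Dself c : c \in C -> c \in D c.
Proof. by rewrite inE => ->; rewrite subxx. Qed.

Let Dlt c c' : c \in C -> c' \in C -> c \proper c' -> #|D c| < #|D c'|.
Proof.
move=> cC cC' /properP[cc [b bc' bc]]; apply: proper_card; apply/properP; split.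
  by apply/subsetP=> d; rewrite !inE => /andP[-> h]; exact: subset_trans h cc.
by exists c'; rewrite ?Dself // inE cC' /=; apply/subsetPn; exists b.
Qed.

Let Dinj : {in C &, injective (fun c => #|D c|)}.
Proof.
move=> c c' cC cC' /= h; apply/eqP; rewrite eqEsubset.
have [cc|ncc] := boolP (c \subset c'); have [cc'|ncc'] := boolP (c' \subset c) => //.
- by have := Dlt cC cC'; rewrite properE cc ncc' h ltnn => /(_ isT).
- by have := Dlt cC' cC; rewrite properE cc' ncc h ltnn => /(_ isT).
- by have := Ctotal cC cC'; rewrite (negbTE ncc) (negbTE ncc').
Qed.

(** The sizes are [r] distinct positive numbers which are at most [r]. *)
Let Dsurj i : 0 < i <= r -> exists2 c, c \in C & #|D c| = i.
Proof.
case/andP=> i0 ir.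
have Dr c : #|D c| < r.+1 by rewrite ltnS subset_leq_card.
pose f c : 'I_r.+1 := Ordinal (Dr c).
have fi : {in C &, injective f} by move=> c c' cC cC' /(congr1 val); exact: Dinj.
have fE : f @: C = [set~ ord0].
  apply/eqP; rewrite eqEcard card_in_imset // cardsC1 card_ord leqnn andbT.
  apply/subsetP=> _ /imsetP[c cC ->]; rewrite !inE -val_eqE /= -lt0n.
  by apply/card_gt0P; exists c; exact: Dself.
have ir' : i < r.+1 by [].
have : Ordinal ir' \in f @: C by rewrite fE !inE -val_eqE /= -lt0n.
by case/imsetP=> c cC /(congr1 val) /= ->; exists c.
Qed.

Let nparts x y : e x y -> part y = ~~ part x.
Proof. by move/bG; case: (part x); case: (part y). Qed.

(** [D (N a)] is an initial and [U b] a final segment of the chain. If [a b] is an edge, they cover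
    the chain and overlap, and otherwise they are disjoint, so their sizes decide. *)
Let rkE a b : a \in K -> b \in K -> part a -> ~~ part b -> e a b = (rk b <= rk a).
Proof.
move=> aK bK pa pb; rewrite /rk pa (negbTE pb).
have cUI := cardsUI (D (N a)) (U b); have NC := CN aK pa.
have [ab|nab] := boolP (e a b).
  have -> : r = #|D (N a) :|: U b|.
    apply: eq_card => c; rewrite !inE; have [cC|//] := boolP (c \in C); rewrite /=.
    have [cN|ncN] := boolP (c \subset N a) => //=; symmetry.
    have Nc : N a \subset c by have := Ctotal cC NC; rewrite (negbTE ncN).
    by apply: (subsetP Nc); rewrite inE bK.
  have : 0 < #|D (N a) :&: U b|.
    by apply/card_gt0P; exists (N a); rewrite !inE NC subxx bK ab.
  lia.
have : #|D (N a) :|: U b| <= r by apply: subset_leq_card; rewrite subUset Dsub Usub.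
have : #|D (N a) :&: U b| = 0.
  apply/eqP; rewrite cards_eq0; apply/eqP/setP=> c; rewrite !inE.
  apply/negbTE/negP=> /andP[/andP[_ cN] /andP[_ bc]].
  by have := subsetP cN b bc; rewrite inE (negbTE nab) andbF.
lia.
Qed.

Lemma chain_ranks : exists (r : nat) (rk : T -> nat),
  [/\ 0 < r, forall x, x \in K -> 0 < rk x <= r,
      forall a b, a \in K -> b \in K -> part a -> ~~ part b -> e a b = (rk b <= rk a),
      forall i, 0 < i <= r -> exists2 a, (a \in K) && part a & rk a = i
    & forall i, 0 < i <= r -> exists2 b, (b \in K) && ~~ part b & rk b = i].
Proof.
have rk_bound x : x \in K -> 0 < rk x <= r.
  move=> xK; rewrite /rk; case px: (part x).
    rewrite subset_leq_card // andbT; apply/card_gt0P; exists (N x).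
    exact/Dself/CN.
  have [y yK xy] := hK xK.
  have : #|U x| <= r by exact: subset_leq_card.
  have : 0 < #|U x|.
    apply/card_gt0P; exists (N y); rewrite !inE CN ?(nparts xy) ?px //.
    by rewrite xK symG xy.
  lia.
exists r, rk; split=> //.
- by have := rk_bound x0 x0K; lia.
- by move=> i /Dsurj[c /CP[a aKp ->] <-]; exists a; rewrite // /rk (andP aKp).2.
move=> i ir; have [c /CP[a /andP[aK pa] cE] ci] := Dsurj ir.
have rka : rk a = i by rewrite /rk pa -cE.
have [i1|i1] := leqP i 1.
  have [b bK ab] := hK aK; have pb : ~~ part b by rewrite (nparts ab) pa.
  exists b; first by rewrite bK.
  have := rk_bound b bK; have := rkE aK bK pa pb; rewrite ab rka; lia.
have [|c' /CP[a' /andP[aK' pa'] cE'] ci'] := @Dsurj i.-1; first by lia.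
have rka' : rk a' = i.-1 by rewrite /rk pa' -cE'.
(* A vertex that is new at position [i] of the chain has rank [i]. *)
have /subsetPn[b] : ~~ (N a \subset N a').
  apply/negP=> sub; have : #|D (N a)| <= #|D (N a')|.
    apply: subset_leq_card; apply/subsetP=> d; rewrite !inE => /andP[-> h].
    exact: subset_trans h sub.
  by rewrite -cE -cE' ci ci'; lia.
rewrite !inE => /andP[bK ab]; rewrite bK /= => nab'.
have pb : ~~ part b by rewrite (nparts ab) pa.
exists b; first by rewrite bK.
have := rkE aK bK pa pb; have := rkE aK' bK pa' pb.
by rewrite ab (negbTE nab') rka rka'; lia.
Qed.

End Ranks.

(** * Forbidden patterns as rules for adjacency and signs *)

Section Core.
Variables (T : finType) (G : sgraph T) (part : T -> bool).
Hypotheses (sG : signed_graph G) (bG : is_bipartition G part) (ff : F_free G).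
Local Notation e := (sadj G).
Local Notation n := (sneg G).

Let symG : symmetric e. Proof. by case: sG. Qed.
Let symnG : symmetric n. Proof. by case: sG. Qed.
Let irrG : irreflexive e. Proof. by case: sG. Qed.

Implicit Types (D K B L : {set T}).

Lemma neg_adj x y : n x y -> e x y. Proof. by case: sG => _ _ _; apply. Qed.

Lemma no_embedding N es t : forbidden N es -> ~ embeds G N es t.
Proof.
move=> fb em; apply: ff; apply/contains_FP; exists N, es; split=> //.
by apply/(contains_famP _ sG (forbidden_gt0 fb)); exists t.
Qed.

Lemma same_part_nadj x y : part x = part y -> e x y = false.
Proof. by move=> xy; apply/negP => /bG; rewrite xy eqxx. Qed.

Lemma common_part x y z : e x z -> e y z -> part x = part y.
Proof. by move=> /bG xz /bG; move: xz; do 3 case: (part _). Qed.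

(** Only pairs across the sides remain to be checked; within a side the bipartition excludes
    edges. *)
Lemma no_bip_pattern (s1 s2 : seq T) x0 es :
  forbidden (size s1 + size s2) es ->
  all (fun x => (x.1.1 < size s1) && (size s1 <= x.1.2)) es ->
  uniq s1 -> uniq s2 ->
  (forall a b, a \in s1 -> b \in s1 -> part a = part b) ->
  (forall a b, a \in s2 -> b \in s2 -> part a = part b) ->
  (forall a b, a \in s1 -> b \in s2 -> part a != part b) ->
  (forall i j, i < size s1 -> j < size s2 ->
     (e (nth x0 s1 i) (nth x0 s2 j) == has (pmatch i (size s1 + j)) es) &&
     all (fun x => pmatch i (size s1 + j) x ==> lbl_ok x.2 (n (nth x0 s1 i) (nth x0 s2 j))) es) ->
  False.
Proof.
move=> fb cut u1 u2 p1 p2 p12 h.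
apply: (@no_embedding _ _ (nth x0 (s1 ++ s2)) fb).
set N := _ + _.
have nthE i : nth x0 (s1 ++ s2) i =
    if i < size s1 then nth x0 s1 i else nth x0 s2 (i - size s1).
  exact: nth_cat.
have inn i j : (i < size s1) && (j < size s1) || (size s1 <= i) && (size s1 <= j) ->
    has (pmatch i j) es = false.
  move=> ij; apply/negbTE; rewrite -all_predC; apply: sub_all cut => x /= hx.
  by rewrite /pmatch; lia.
have mm i j b : has (pmatch i j) es = false -> 
    all (fun x => pmatch i j x ==> lbl_ok x.2 b) es.
  move=> /negbT; rewrite -all_predC; apply: sub_all => x /= /negbTE->//.
apply: embeds_le => // i j; rewrite /N !nthE => iN jN ij.
have [j1|j1] := ltnP j (size s1).
  have i1 : i < size s1 by lia.
  rewrite i1 inn ?i1 ?j1 //; split; [| |by apply: mm; rewrite inn ?i1 ?j1].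
    by move/eqP; rewrite nth_uniq // => /eqP.
  by apply: same_part_nadj; apply: p1; exact: mem_nth.
have j2 : j - size s1 < size s2 by lia.
have [i1|i1] := ltnP i (size s1).
  have := h i (j - size s1) i1 j2; rewrite subnKC // => /andP[/eqP-> al]; split=> //.
  by move=> eq; have := p12 _ _ (mem_nth x0 i1) (mem_nth x0 j2); rewrite eq eqxx.
have i2 : i - size s1 < size s2 by lia.
rewrite inn ?i1 ?j1 ?orbT //; split; [| |by apply: mm; rewrite inn ?i1 ?j1 ?orbT].
  by move/eqP; rewrite nth_uniq // => /eqP; lia.
by apply: same_part_nadj; apply: p2; exact: mem_nth.
Qed.

(** Distinctness is not assumed, since any two vertices of a side are told apart by their adjacency
    to a third vertex. *)
Lemma no_D a1 a2 a3 b1 b2 b3 : e a1 b1 -> e a1 b2 -> e a2 b1 -> e a2 b3 ->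
  e a3 b2 -> e a3 b3 -> ~~ e a1 b3 -> ~~ e a3 b1 -> ~~ n a2 b2.
Proof.
move=> e11 e12 e21 e23 e32 e33 /negbTE n13 /negbTE n31; apply/negP=> n22.
have e22 := neg_adj n22.
have P12 := common_part e11 e21; have P32 := common_part e33 e23.
have Q12 : part b1 = part b2 by apply: (@common_part _ _ a1); rewrite symG.
have Q32 : part b3 = part b2 by apply: (@common_part _ _ a3); rewrite symG.
apply: (@no_bip_pattern [:: a1; a2; a3] [:: b1; b2; b3] a1 Dpat) => //=.
- by constructor.
- rewrite !inE !andbT negb_or -andbA; apply/and3P; split; apply/eqP=> E.
  + by rewrite E e23 in n13.
  + by rewrite E e33 in n13.
  + by rewrite -E e21 in n31.
- rewrite !inE !andbT negb_or -andbA; apply/and3P; split; apply/eqP=> E.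
  + by rewrite E e32 in n31.
  + by rewrite E e33 in n31.
  + by rewrite -E e12 in n13.
- by move=> a b; rewrite !inE => /or3P[]/eqP-> /or3P[]/eqP->; rewrite ?P12 ?P32.
- by move=> a b; rewrite !inE => /or3P[]/eqP-> /or3P[]/eqP->; rewrite ?Q12 ?Q32.
- by move=> a b; rewrite !inE => /or3P[]/eqP-> /or3P[]/eqP->;
    rewrite ?P12 ?P32 ?Q12 ?Q32 bG.
- by case=> [|[|[|i]]] [|[|[|j]]] //= _ _; rewrite ?e11 ?e12 ?e21 ?e22 ?e23 ?e32 ?e33 ?n13 ?n31 ?n22.
Qed.

Lemma no_F5 a1 a2 a3 b1 b2 b3 : a2 != a3 -> b1 != b2 ->
  e a1 b1 -> e a1 b2 -> e a2 b1 -> e a2 b2 -> e a2 b3 ->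
  e a3 b1 -> e a3 b2 -> e a3 b3 -> ~~ e a1 b3 -> n a2 b1 -> ~~ n a3 b2.
Proof.
move=> a23 b12 e11 e12 e21 e22 e23 e31 e32 e33 /negbTE n13 n21; apply/negP=> n32.
have P12 := common_part e11 e21; have P32 := common_part e33 e23.
have Q12 : part b1 = part b2 by apply: (@common_part _ _ a1); rewrite symG.
have Q32 : part b3 = part b2 by apply: (@common_part _ _ a3); rewrite symG.
apply: (@no_bip_pattern [:: a1; a2; a3] [:: b1; b2; b3] a1 F5) => //=.
- by constructor.
- rewrite !inE !andbT negb_or a23 andbT; apply/andP; split; apply/eqP=> E.
  + by rewrite E e23 in n13.
  + by rewrite E e33 in n13.
- rewrite !inE !andbT negb_or b12 /=; apply/andP; split; apply/eqP=> E.
  + by rewrite -E e11 in n13.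
  + by rewrite -E e12 in n13.
- by move=> a b; rewrite !inE => /or3P[]/eqP-> /or3P[]/eqP->; rewrite ?P12 ?P32.
- by move=> a b; rewrite !inE => /or3P[]/eqP-> /or3P[]/eqP->; rewrite ?Q12 ?Q32.
- by move=> a b; rewrite !inE => /or3P[]/eqP-> /or3P[]/eqP->;
    rewrite ?P12 ?P32 ?Q12 ?Q32 bG.
- by case=> [|[|[|i]]] [|[|[|j]]] //= _ _;
    rewrite ?e11 ?e12 ?e21 ?e22 ?e23 ?e31 ?e32 ?e33 ?n13 ?n21 ?n32.
Qed.

Lemma no_F6 a1 a2 a3 a4 b1 b2 b3 b4 : uniq [:: a1; a2; a3; a4] ->
  uniq [:: b1; b2; b3; b4] ->
  e a1 b2 -> e a2 b2 -> e a3 b1 -> e a3 b3 -> e a3 b4 -> e a4 b1 -> e a4 b2 ->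
  ~~ e a1 b3 -> ~~ e a1 b4 -> ~~ e a2 b3 -> ~~ e a2 b4 ->
  n a1 b1 -> n a2 b1 -> n a3 b2 -> n a4 b3 -> ~~ n a4 b4.
Proof.
move=> ua ub e12 e22 e31 e33 e34 e41 e42 /negbTE n13 /negbTE n14 /negbTE n23 /negbTE n24.
move=> n11 n21 n32 n43; apply/negP=> n44.
have [e11 e21] := (neg_adj n11, neg_adj n21).
have [e32 e43 e44] := And3 (neg_adj n32) (neg_adj n43) (neg_adj n44).
have P1 := common_part e11 e41; have P2 := common_part e21 e41; have P3 := common_part e31 e41.
have Q1 : part b1 = part b4 by apply: (@common_part _ _ a4); rewrite symG.
have Q2 : part b2 = part b4 by apply: (@common_part _ _ a4); rewrite symG.
have Q3 : part b3 = part b4 by apply: (@common_part _ _ a4); rewrite symG.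
apply: (@no_bip_pattern [:: a1; a2; a3; a4] [:: b1; b2; b3; b4] a1 F6) => //.
- by constructor.
- by move=> a b; rewrite !inE => /or4P[]/eqP-> /or4P[]/eqP->; rewrite ?P1 ?P2 ?P3.
- by move=> a b; rewrite !inE => /or4P[]/eqP-> /or4P[]/eqP->; rewrite ?Q1 ?Q2 ?Q3.
- by move=> a b; rewrite !inE => /or4P[]/eqP-> /or4P[]/eqP->;
    rewrite ?P1 ?P2 ?P3 ?Q1 ?Q2 ?Q3 bG.
- by case=> [|[|[|[|i]]]] [|[|[|[|j]]]] //= _ _;
    rewrite ?e11 ?e12 ?e21 ?e22 ?e31 ?e32 ?e33 ?e34 ?e41 ?e42 ?e43 ?e44
      ?n13 ?n14 ?n23 ?n24 ?n11 ?n21 ?n32 ?n43 ?n44.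
Qed.

(* On a biclique only the negative edges matter for the patterns F1 to F4. *)
Lemma no_biclique_pattern (s1 s2 : seq T) x0 es :
  forbidden (size s1 + size s2) es ->
  all (fun x => (x.1.1 < size s1) && (size s1 <= x.1.2)) es ->
  all (fun i => all (fun j => has (pmatch i (size s1 + j)) es) (iota 0 (size s2)))
    (iota 0 (size s1)) ->
  all (fun x => if x.2 is Pos then false else true) es ->
  0 < size s1 -> 0 < size s2 -> uniq s1 -> uniq s2 ->
  (forall a b, a \in s1 -> b \in s2 -> e a b) ->
  all (fun x => (if x.2 is Neg then true else false) ==>
    n (nth x0 s1 x.1.1) (nth x0 s2 (x.1.2 - size s1))) es ->
  False.
Proof.
move=> fb cut full nPos z1 z2 u1 u2 ad ng.
have [a0 a0s] : exists a0, a0 \in s1 by exists (nth x0 s1 0); rewrite mem_nth.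
have [b0 b0s] : exists b0, b0 \in s2 by exists (nth x0 s2 0); rewrite mem_nth.
apply: (@no_bip_pattern s1 s2 x0 es fb cut u1 u2) => [a b ha hb|a b ha hb|a b ha hb|i j i1 j2].
- exact: common_part (ad a b0 ha b0s) (ad b b0 hb b0s).
- by apply: (@common_part _ _ a0); rewrite symG ad.
- exact/bG/ad.
- rewrite ad ?mem_nth // (allP (allP full i _) j _) ?mem_iota // eqxx /=.
  elim: es cut ng nPos {fb full} => //= -[[a b] l] es IH /= /andP[c1 c2] /andP[g1 g2] /andP[p1 p2].
  rewrite IH // andbT /pmatch /=; apply/implyP => m.
  have [ai bj] : a = i /\ b = size s1 + j by clear -c1 c2 m i1 j2; lia.
  by move: g1 p1; rewrite ai bj addKn; case: l.
Qed.

(** * Induced paths and the vertices which see both ends *)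

Definition ipath (p : nat -> T) m :=
  forall i j, i <= m -> j <= m -> e (p i) (p j) = (j == i.+1) || (i == j.+1).

Lemma ipath_part p m i : ipath p m -> i <= m -> part (p i) = part (p 0) (+) odd i.
Proof.
move=> ip; elim: i => [|i IH] im; first by rewrite addbF.
have /bG : e (p i) (p i.+1) by rewrite ip ?eqxx //; lia.
by rewrite IH /=; [do 2 case: (part _); case: (odd i)|lia].
Qed.

(** If [v] missed [p i], its nearest neighbours [p a] and [p b] on both sides of [i] would close an
    induced cycle through [v]. All three indices are even, so its length [b - a + 2] is at least
    6. *)
Lemma fan p m v i : ipath p m -> e v (p 0) -> e v (p m) -> i <= m -> ~~ odd i -> e v (p i).
Proof.
move=> ip v0 vm im oi; case vi: (e v (p i)) => //; exfalso.
have i0 : 0 < i by case: (posnP i) => // i0; rewrite i0 v0 in vi.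
have im' : i < m.
  by rewrite ltn_neqAle im andbT; apply/eqP=> i_m; rewrite i_m vm in vi.
have [a a_i [va amax]] : exists2 a, a < i & e v (p a) /\ forall c, a < c < i -> ~~ e v (p c).
  have exP : exists a, (a < i) && e v (p a) by exists 0; rewrite i0.
  have ub c : (c < i) && e v (p c) -> c <= i by case/andP=> /ltnW.
  case: (ex_maxnP exP ub) => a /andP[ai va] mx; exists a => //; split=> // c ci.
  by apply/negP=> vc; have := mx c; rewrite vc andbT; lia.
have [b i_b [bm [vb bmin]]] : exists2 b, i < b & b <= m /\ e v (p b) /\ forall c, i < c < b -> ~~ e v (p c).
  have exP : exists b, (i < b <= m) && e v (p b) by exists m; rewrite im' leqnn.
  case: (ex_minnP exP) => b /andP[/andP[ib bm] vb] mn; exists b => //; do 2!split=> //.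
  move=> c ci; apply/negP=> vc; have := mn c; rewrite vc andbT; lia.
have {amax bmin} gap c : a < c < b -> e v (p c) = false.
  move=> ci; apply/negbTE; have [ci'|ic|->] := ltngtP c i; last by rewrite vi.
    by apply: amax; lia.
  by apply: bmin; lia.
have pv c : c <= m -> e v (p c) -> part v = ~~ part (p 0) (+) odd c.
  move=> cm /bG; rewrite (ipath_part ip cm).
  by do 2 case: (part _); case: (odd c).
have oa : ~~ odd a.
  have := pv 0 (leq0n _) v0; rewrite (pv a) //; last by lia.
  by case: (part _); case: (odd a).
have ob : ~~ odd b.
  by have := pv 0 (leq0n _) v0; rewrite (pv b) //; case: (part _); case: (odd b).
have ab : a + 4 <= b by lia.
pose L := b - a + 2.
pose t i := if i == 0 then v else p (a + i.-1).
have t0 : t 0 = v by [].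
have tS c : t c.+1 = p (a + c) by [].
have Lk : L = 2 * L./2 by rewrite /L; lia.
have L3 : 3 <= L./2 by rewrite /L; lia.
have vne c : a <= c <= b -> v <> p c.
  move=> cab vc; have cm : c <= m by lia.
  have := va; rewrite vc ip; [|lia|lia].
  have := vb; rewrite vc ip; [|lia|lia]; lia.
(* [ipath] does not demand distinct vertices, as a path of length 2 may return to its start;
   [b - a >= 4] excludes this. *)
have pinj c d : a <= c <= b -> a <= d <= b -> p c = p d -> c = d.
  wlog cd : c d / c < d => [hw|].
    have [cd|dc|//] := ltngtP c d; first exact: hw.
    by move=> hc hd /esym h; symmetry; apply: hw.
  move=> hc hd cde; exfalso.
  have nb f : f <= m -> e (p c) (p f) = e (p d) (p f) by rewrite cde.
  have cm : c <= m by lia.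
  have dm : d <= m by lia.
  have [db|db] := eqVneq d b; last first.
    by have := nb d.+1; rewrite !ip ?eqxx; lia.
  have [ca|ca] := eqVneq c a; last first.
    by have := nb c.-1; rewrite !ip; lia.
  by have := nb c.+1; rewrite !ip ?eqxx; lia.
have adv c : c < L.-1 -> e v (p (a + c)) = (c == 0) || (c == L - 2).
  rewrite /L => cL; have [->|c0] := posnP c; first by rewrite addn0 va.
  have [cb|cb] := eqVneq c (b - a + 2 - 2).
    have -> : a + c = b by lia.
    by rewrite vb; lia.
  by rewrite gap; lia.
apply: (no_embedding (t := t) (forb_cycle L3)); rewrite -Lk.
have L0 : 0 < L by rewrite /L; lia.
have md c : c < L -> c.+1 %% L = if c.+1 == L then 0 else c.+1.
  by move=> h; case: eqP => [->|?]; [rewrite modnn|rewrite modn_small //; lia].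
split.
- case=> [|c] [|d] cL dL //.
  + by rewrite t0 tS => /vne[]; rewrite /L in dL; lia.
  + by rewrite t0 tS => /esym/vne[]; rewrite /L in cL; lia.
  + rewrite !tS => /pinj h; have : a + c = a + d by apply: h; rewrite /L in cL dL; lia.
    by lia.
- move=> c d cL dL; rewrite has_cycle // !md //.
  case: c d cL dL => [|c] [|d] cL dL.
  + by rewrite !t0 irrG; case: (eqVneq 1 L); rewrite /L; lia.
  + rewrite t0 tS adv; last by lia.
    case: (eqVneq 1 L) => [h|_]; first by rewrite /L in h; lia.
    by case: (eqVneq d.+2 L) => hd; apply/idP/idP; rewrite ?eqxx ?orbT //; lia.
  + rewrite t0 tS symG adv; last by lia.
    case: (eqVneq 1 L) => [h|_]; first by rewrite /L in h; lia.
    by case: (eqVneq c.+2 L) => hd; apply/idP/idP; rewrite ?eqxx ?orbT //; lia.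
  + rewrite !tS ip; [|by rewrite /L in cL; lia|by rewrite /L in dL; lia].
    case: (eqVneq c.+2 L) => hc; case: (eqVneq d.+2 L) => hd; apply/idP/idP; lia.
- move=> c d _ _; rewrite all_map; apply/allP=> x _ /=; exact: implybT.
Qed.

Lemma no_sum t1 k1 t t2 k2 t' : tad G t1 k1 t -> tad G t2 k2 t' -> t 0 = t' 0 ->
  (forall i j, 0 < i < k1 + 3 -> 0 < j < k2 + 3 ->
     t i <> t' j /\ ~~ e (t i) (t' j)) -> False.
Proof.
move=> tt tt' t0 cr; have [v1 _ _ _] := tt; have [v2 _ _ _] := tt'.
have [s em] := sum_of_tads v1 v2 sG tt tt' t0 cr.
exact: (no_embedding (forb_sum v1 v2) em).
Qed.

Lemma no_join t1 k1 t t2 k2 t' : tad G t1 k1 t -> tad G t2 k2 t' ->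
  (forall i j, i < k1 + 3 -> j < k2 + 3 -> t i <> t' j) ->
  (forall i j, 0 < i < k1 + 3 -> 0 < j < k2 + 3 -> ~~ e (t i) (t' j)) ->
  (forall j, j < k2 + 3 -> part (t 0) != part (t' j) -> e (t 0) (t' j)) ->
  (forall i, i < k1 + 3 -> part (t i) != part (t' 0) -> e (t i) (t' 0)) ->
  (forall j, j < k2 + 3 -> n (t 0) (t' j) ->
     [&& part (t 0) != part (t' 0), ~~ t2, k2 == 1 & j == k2]) ->
  (forall i, i < k1 + 3 -> n (t i) (t' 0) ->
     [&& part (t 0) != part (t' 0), ~~ t1, k1 == 1 & i == k1]) -> False.
Proof.
move=> tt tt' dif nad c1 c2 p1 p2; have [v1 _ _ _] := tt; have [v2 _ _ _] := tt'.
pose o := part (t 0) != part (t' 0).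
have [s em] : exists s, embeds G (join_size k1 k2) (join_pat t1 k1 t2 k2 o) s.
  have pt := tad_part bG tt; have pt' := tad_part bG tt'.
  apply: (join_of_tads v1 v2 sG tt tt') => [i j ik jk|j jk _ ng|i ik _ ng].
  - split; first exact: dif.
    rewrite /join_cross.
    have [i0|i0] := posnP i; have [j0|j0] := posnP j; rewrite ?i0 ?j0 /=.
    + rewrite (tad_side0 v1) (tad_side0 v2).
      rewrite addbF addFb orbb /o; apply/idP/idP => [/bG//|]; apply: c1; lia.
    + rewrite orbF (_ : _ (+) _ = (part (t 0) != part (t' j))).
        by apply/idP/idP => [/bG//|]; apply: c1.
      by rewrite (pt' j) // /o; do 2 case: (part _); case: (tad_side _ _).
    + rewrite (_ : _ (+) _ = (part (t i) != part (t' 0))).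
        by apply/idP/idP => [/bG//|]; apply: c2.
      by rewrite (pt i) // /o; do 2 case: (part _); case: (tad_side _ _).
    + by apply/negbTE/nad; rewrite ?i0 ?j0.
  - exact: p1.
  - exact: p2.
exact: (no_embedding (forb_join o v1 v2) em).
Qed.

(** * Tadpoles with a changed end *)

Lemma tad_cons two k t v : tad G two k t -> e v (t 0) ->
  (forall j, 0 < j < k + 3 -> ~~ e v (t j)) -> (forall j, j < k + 3 -> v <> t j) ->
  tad G two k.+1 (fun i => if i is i'.+1 then t i' else v).
Proof.
case=> va inj ad ng v0 vj vt; have k0 := tad_gt0 va.
have ad0 j : j < k + 3 -> tadj two k.+1 0 j.+1 = e v (t j).
  move=> jk; case: (posnP j) => [->|j0].
    by rewrite v0; apply/idP; rewrite /tadj /tarc; bgoal.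
  rewrite (negbTE (vj _ _)) ?j0 //; apply/negP; rewrite /tadj /tarc.
  by move: va; case: (two) => /= va h; bhyps; lia.
split.
- by move: va; case: (two) => //=; lia.
- case=> [|i] [|j] // ik jk; first by move/vt => []; lia.
    by move/esym/vt => []; lia.
  by move/inj=> -> //; lia.
- case=> [|i] [|j] ik jk; rewrite ?tadjSS ?ad //; try by lia.
  + by rewrite irrG; apply/esym/negP=> /tadj_lt []//; move: va; case: (two) => //=; lia.
  + by rewrite ad0 //; lia.
  + by rewrite symG tadjC ad0 //; lia.
- have ng0 j : tneg two k.+1 0 j = false.
    apply/negP; rewrite /tneg /tnegarc.
    by move: va; case: (two) => /= va h; bhyps; lia.
  case=> [|i] [|j] ik jk; rewrite ?ng0 //.
    by rewrite tnegC ng0.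
  by rewrite tnegSS; apply: ng; lia.
Qed.

(** If a single path vertex is left, the negative edge of type 2 has gone with its vertex [x_{k-1}],
    and the rest has type 1. *)
Lemma tad_drop two k t : tad G two k.+1 t -> 0 < k ->
  tad G (two && (1 < k)) k (fun i => t i.+1).
Proof.
case=> va inj ad ng k0.
have twoE : two && (1 < k) = two \/ k = 1 /\ two && (1 < k) = false.
  by case: (two) => /=; [case: ltnP; lia|left].
split.
- by case: (two) => //=; case: ltnP.
- by move=> i j ik jk /inj h; apply: succn_inj; apply: h; lia.
- move=> i j ik jk; rewrite ad; [|lia|lia]; rewrite tadjSS.
  case: twoE => [->//|[-> ->]]; rewrite /tadj /tarc /=.
  by rewrite !andbF.
- move=> i j ik jk h; apply: ng; [lia|lia|rewrite tnegSS].
  case: twoE h => [->//|[_ ->]]; rewrite /tneg /tnegarc /= !orbF.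
  by case/orP=> ->; rewrite ?orbT.
Qed.

Definition Tad (D : {pred T}) (x : T) :=
  exists two k t, [/\ tad G two k t, t 0 = x & forall i, 0 < i < k + 3 -> t i \in D].

Lemma Tad_sub (D D' : {pred T}) x : {subset D <= D'} -> Tad D x -> Tad D' x.
Proof.
move=> DD [two [k [t [tt t0 tD]]]]; exists two, k, t; split=> // i ik.
exact/DD/tD.
Qed.

(** The path is cut at the last neighbour of [v], in front of which [v] becomes the new end. *)
Lemma Tad_reach (D : {pred T}) two k t v j : tad G two k t ->
  (forall i, i < k + 3 -> v <> t i) -> (forall i, i < k + 3 -> t i \in D) ->
  ~~ e v (t k) -> ~~ e v (t k.+1) -> ~~ e v (t k.+2) -> j < k -> e v (t j) -> Tad D v.
Proof.
elim: k two t j => // k IH two t j tt vt tD vw vy vz jk vj.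
have [[i i0 [ik vi]]|no] :
    (exists2 i, 0 < i & i < k.+1 /\ e v (t i)) \/ forall i, 0 < i < k.+1 -> ~~ e v (t i).
  have [/existsP[i /andP[i0 vi]]|] := boolP [exists i : 'I_k.+1, (0 < i) && e v (t i)].
    by left; exists i.
  rewrite negb_exists => /forallP h; right=> i /andP[i0 ik].
  by have := h (Ordinal ik); rewrite /= i0.
- apply: (IH _ (fun i => t i.+1) i.-1 (tad_drop tt _)) => //; try lia.
  + by move=> l lk; apply: vt; lia.
  + by move=> l lk; apply: tD; lia.
  + by rewrite prednK.
- have j0 : j = 0.
    by case: (posnP j) => // j0; have := no j; rewrite j0 jk vj => /(_ isT).
  exists two, k.+2, (fun i => if i is i'.+1 then t i' else v); split=> //.
    apply: tad_cons => // [|i /andP[i0 ik]]; first by rewrite -j0.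
    have [ik'|ik'] := ltnP i k.+1; first by apply: no; rewrite i0.
    have [->//|?] := eqVneq i k.+1; have [->//|?] := eqVneq i k.+2.
    by have -> : i = k.+3 by lia.
  by case=> // i ik; apply: tD; lia.
Qed.

Lemma ipath_rcons p m z : ipath p m -> e (p m) z -> (forall i, i < m -> ~~ e (p i) z) ->
  ipath (fun i => if i <= m then p i else z) m.+1.
Proof.
move=> ip mz nz i j im jm; case: (leqP i m) => hi; case: (leqP j m) => hj.
- by rewrite ip.
- have -> : j = m.+1 by lia.
  have [->|ne] := eqVneq i m; first by rewrite mz eqxx.
  by rewrite (negbTE (nz _ _)); lia.
- have -> : i = m.+1 by lia.
  have [->|ne] := eqVneq j m; first by rewrite symG mz eqxx orbT.
  by rewrite symG (negbTE (nz _ _)); lia.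
- by rewrite irrG; lia.
Qed.

(** By [fan], [v] also sees [p (i - 2)] and [p (i + 2)], so a negative edge from [v] to [p i] would
    be the middle edge of [D]. The bounds on [i] make room for these two vertices. *)
Lemma fan_pos p m v i : ipath p m -> e v (p 0) -> e v (p m) -> ~~ odd i ->
  1 < i -> i + 2 <= m -> ~~ n v (p i).
Proof.
move=> ip v0 vm oi i1 im.
have f j : j <= m -> ~~ odd j -> e v (p j) by apply: (fan ip v0 vm).
apply: (no_D (a1 := p i.-1) (b1 := p i.-2) (a3 := p i.+1) (b3 := p i.+2));
  rewrite ?ip ?f //; lia.
Qed.

Lemma no_F4 a1 a2 a3 b1 b2 b3 : uniq [:: a1; a2; a3] -> uniq [:: b1; b2; b3] ->
  (forall a b, a \in [:: a1; a2; a3] -> b \in [:: b1; b2; b3] -> e a b) ->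
  n a1 b1 -> n a2 b2 -> ~~ n a3 b3.
Proof.
move=> ua ub ad n1 n2; apply/negP=> n3.
apply: (@no_biclique_pattern [:: a1; a2; a3] [:: b1; b2; b3] a1 F4) => //=.
  by constructor.
by rewrite n1 n2 n3.
Qed.

Lemma no_F1 a1 a2 b1 b2 : a1 != a2 -> b1 != b2 ->
  n a1 b1 -> n a1 b2 -> n a2 b1 -> ~~ n a2 b2.
Proof.
move=> ua ub n11 n12 n21; apply/negP=> n22.
apply: (@no_biclique_pattern [:: a1; a2] [:: b1; b2] a1 F1) => //=; rewrite ?inE ?andbT //; first by constructor.
  by move=> a b; rewrite !inE => /orP[]/eqP-> /orP[]/eqP->; apply: neg_adj.
by rewrite n11 n12 n21 n22.
Qed.

Lemma no_F2 a1 a2 b1 b2 b3 : uniq [:: a1; a2] -> uniq [:: b1; b2; b3] ->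
  e a1 b3 -> e a2 b1 -> n a1 b1 -> n a1 b2 -> n a2 b2 -> ~~ n a2 b3.
Proof.
move=> ua ub e13 e21 n11 n12 n22; apply/negP=> n23.
apply: (@no_biclique_pattern [:: a1; a2] [:: b1; b2; b3] a1 F2) => //; first by constructor.
  by move=> a b; rewrite !inE => /orP[]/eqP-> /or3P[]/eqP->; rewrite ?e13 ?e21 ?(neg_adj n11) ?(neg_adj n12) ?(neg_adj n22) ?(neg_adj n23).
by rewrite /= n11 n12 n22 n23.
Qed.

Lemma no_F3 a1 a2 b1 b2 b3 b4 : uniq [:: a1; a2] -> uniq [:: b1; b2; b3; b4] ->
  (forall a b, a \in [:: a1; a2] -> b \in [:: b1; b2; b3; b4] -> e a b) ->
  n a1 b1 -> n a1 b2 -> n a2 b3 -> ~~ n a2 b4.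
Proof.
move=> ua ub ad n11 n12 n23; apply/negP=> n24.
apply: (@no_biclique_pattern [:: a1; a2] [:: b1; b2; b3; b4] a1 F3) => //; first by constructor.
by rewrite /= n11 n12 n23 n24.
Qed.

(** [F4] excludes three disjoint negative edges, so by König's theorem two vertices cover all of
    them. If both had to lie on one side, each would have two negative neighbours; [F1], [F2], [F3]
    exclude that these pairs share two, one or no vertices. *)
Lemma biclique_cover (A B : {pred T}) x0 y0 : x0 \in A -> y0 \in B ->
  (forall a b, a \in A -> b \in B -> e a b) ->
  exists a b, [/\ a \in A, b \in B &
    forall p q, p \in A -> q \in B -> n p q -> p = a \/ q = b].
Proof.
move=> x0A y0B ad.
have [/existsP[a /existsP[b /and3P[aA bB /forallP h]]]|] := boolP [exists a, [exists b,
    [&& a \in A, b \in B & [forall p, [forall q,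
      [&& p \in A, q \in B & n p q] ==> (p == a) || (q == b)]]]]].
  exists a, b; split=> // p q pA qB npq; have /forallP/(_ q) := h p.
  by rewrite pA qB npq => /orP[]/eqP; [left|right].
rewrite negb_exists => /forallP noc; exfalso.
have step a b : a \in A -> b \in B -> exists p q,
    [/\ p \in A, q \in B, n p q, p != a & q != b].
  move=> aA bB; have := noc a; rewrite negb_exists => /forallP/(_ b).
  rewrite aA bB negb_forall => /existsP[p]; rewrite negb_forall => /existsP[q].
  rewrite negb_imply negb_or => /andP[/and3P[pA qB npq] /andP[pa qb]].
  by exists p, q.
(* A cover of the matching [a1 b1], [a2 b2] with a vertex on each side is [(a1, b2)] or [(a2, b1)];
   one more edge refutes each. *)
have [a1 [b1 [a1A b1B n11 _ _]]] := step x0 y0 x0A y0B.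
have [a2 [b2 [a2A b2B n22 a21 b21]]] := step a1 b1 a1A b1B.
have [a3 [b3 [a3A b3B n33 a31 b32]]] := step a1 b2 a1A b2B.
have [a4 [b4 [a4A b4B n44 a42 b41]]] := step a2 b1 a2A b1B.
have adt a b : a \in A -> b \in B -> e b a by move=> aA bB; rewrite symG ad.
have F4 p1 p2 p3 q1 q2 q3 : p1 \in A -> p2 \in A -> p3 \in A ->
    q1 \in B -> q2 \in B -> q3 \in B -> uniq [:: p1; p2; p3] -> uniq [:: q1; q2; q3] ->
    n p1 q1 -> n p2 q2 -> n p3 q3 -> False.
  move=> h1 h2 h3 k1 k2 k3 u1 u2 m1 m2 m3; move/negP: m3; case.
  apply/negP/(no_F4 u1 u2 _ m1 m2).
  by move=> a b; rewrite !inE => /or3P[]/eqP-> /or3P[]/eqP->; rewrite ad.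
have un2 (x y : T) : x != y -> uniq [:: x; y] by rewrite /= inE andbT.
have un3 (x y z : T) : x != y -> x != z -> y != z -> uniq [:: x; y; z].
  by move=> xy xz yz; rewrite /= !inE negb_or xy xz yz.
have un4 (x y z u : T) : x != y -> x != z -> x != u -> y != z -> y != u -> z != u ->
    uniq [:: x; y; z; u].
  by move=> xy xz xu yz yu zu; rewrite /= !inE !negb_or xy xz xu yz yu zu.
have F2 p1 p2 q1 q2 q3 : p1 \in A -> p2 \in A -> q1 \in B -> q3 \in B ->
    p1 != p2 -> q1 != q2 -> q1 != q3 -> q2 != q3 ->
    n p1 q1 -> n p1 q2 -> n p2 q2 -> n p2 q3 -> False.
  move=> h1 h2 k1 k3 p12 q12 q13 q23 m1 m2 m3; apply/negP.
  by apply: no_F2 m1 m2 m3; rewrite ?un2 ?un3 ?ad.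
have F2t q1 q2 p1 p2 p3 : q1 \in B -> q2 \in B -> p1 \in A -> p3 \in A ->
    q1 != q2 -> p1 != p2 -> p1 != p3 -> p2 != p3 ->
    n p1 q1 -> n p2 q1 -> n p2 q2 -> n p3 q2 -> False.
  move=> h1 h2 k1 k3 p12 q12 q13 q23 m1 m2 m3; apply/negP.
  rewrite symnG; rewrite symnG in m1; rewrite symnG in m2; rewrite symnG in m3.
  by apply: no_F2 m1 m2 m3; rewrite ?un2 ?un3 ?adt.
(* [F4] excludes a negative matching of size 3, so the edges [a3 b3] and [a4 b4]
   meet the matching [a1 b1], [a2 b2] *)
have c3 : (a3 == a2) || (b3 == b1).
  apply/negPn/negP; rewrite negb_or => /andP[h1 h2].
  by apply: (@F4 a1 a2 a3 b1 b2 b3) => //; apply: un3; rewrite // eq_sym.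
have c4 : (a4 == a1) || (b4 == b2).
  apply/negPn/negP; rewrite negb_or => /andP[h1 h2].
  by apply: (@F4 a1 a2 a4 b1 b2 b4) => //; apply: un3; rewrite // eq_sym.
have a12 : a1 != a2 by rewrite eq_sym.
have b12 : b1 != b2 by rewrite eq_sym.
have a13 : a1 != a3 by rewrite eq_sym.
have b23 : b2 != b3 by rewrite eq_sym.
have a24 : a2 != a4 by rewrite eq_sym.
have b14 : b1 != b4 by rewrite eq_sym.
have [e3|n3] := eqVneq a3 a2; have [f3|m3] := eqVneq b3 b1;
  rewrite ?e3 ?f3 ?(negbTE n3) ?(negbTE m3) // in c3 n33 *;
have [e4|n4] := eqVneq a4 a1; have [f4|m4] := eqVneq b4 b2;
  rewrite ?e4 ?f4 ?(negbTE n4) ?(negbTE m4) // in c4 n44 *.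
- by move: (no_F1 a12 b12 n11 n44 n33); rewrite n22.
- by apply: (@F2 a1 a2 b4 b1 b2); rewrite // eq_sym.
- by apply: (@F2t b1 b2 a1 a2 a4); rewrite // eq_sym.
- by apply: (@F2 a1 a2 b1 b2 b3); rewrite // eq_sym.
- have [e34|n34] := eqVneq b3 b4.
    by rewrite e34 in n33 m3 b23; apply: (@F2 a1 a2 b1 b4 b2); rewrite // eq_sym.
  have := n33; apply/negP.
  apply: (@no_F3 a1 a2 b1 b4 b2 b3) => //; first exact: un2.
    by apply: un4; rewrite // eq_sym.
  by move=> a b; rewrite !inE => /orP[]/eqP-> /or4P[]/eqP->; rewrite ad.
- by apply: (@F4 a1 a2 a4 b1 b3 b2); rewrite // un3 // eq_sym.
- by apply: (@F2t b1 b2 a3 a1 a2); rewrite // eq_sym.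
- by apply: (@F4 a3 a1 a2 b1 b4 b2); rewrite // un3 // eq_sym.
- have [e34|n34] := eqVneq a3 a4.
    by rewrite e34 in n33 n3 a13; apply: (@F2t b1 b2 a1 a4 a2); rewrite // eq_sym.
  have := n44; rewrite symnG; apply/negP.
  apply: (@no_F3 b1 b2 a1 a3 a2 a4); rewrite 1?symnG //; first exact: un2.
  - by apply: un4; rewrite // eq_sym.
  - by move=> a b; rewrite !inE => /orP[]/eqP-> /or4P[]/eqP->; rewrite adt.
Qed.

(** * A vertex outside of a tadpole *)

Section Vertex.

(* [c 0, ..., c (s - 1), t 0, ..., t (k - 1)] is an induced path which starts at a
   neighbour of [v] outside of the tadpole. *)
Variables (D : {pred T}) (two : bool) (k : nat) (t : nat -> T) (v : T)
  (s : nat) (c : nat -> T).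
Hypotheses (tt : tad G two k t) (vt : forall i, i < k + 3 -> v <> t i)
  (tD : forall i, 0 < i < k + 3 -> t i \in D)
  (s1 : 0 < s) (s2 : s <= 2) (v0 : e v (c 0))
  (ipc : ipath (fun i => if i < s then c i else t (i - s)) s)
  (ct : forall i j, i < s -> 0 < j < k + 3 -> ~~ e (c i) (t j)).

Let va : valid_tad two k. Proof. by case: tt. Qed.
Let k0 : 0 < k. Proof. exact: tad_gt0 va. Qed.
Let ad i j : i < k + 3 -> j < k + 3 -> e (t i) (t j) = tadj two k i j.
Proof. by case: tt => _ _ h _; apply: h. Qed.
Let ng i j : i < k + 3 -> j < k + 3 -> tneg two k i j -> n (t i) (t j).
Proof. by case: tt => _ _ _ h; apply: h. Qed.

Let P i := if i < s then c i else t (i - s).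

Let P_c i : i < s -> P i = c i. Proof. by rewrite /P => ->. Qed.
Let P_t j : P (s + j) = t j.
Proof. by rewrite /P ltnNge leq_addr /= addKn. Qed.

Let ipP : ipath P (s + k - 1).
Proof.
move=> i j; wlog ij : i j / i <= j => [hw ik jk|ik jk].
  by case: (leqP i j) => ij; [apply: hw|rewrite symG hw // 1?orbC //; nlia].
have [js|js] := leqP j s; first by apply: ipc => //; nlia.
have [is_|si] := ltnP i s.
  rewrite (P_c is_) -(subnKC (ltnW js)) P_t (negbTE (ct _ _)) //; nlia.
rewrite -(subnKC si) -(subnKC (ltnW js)) !P_t ad; [|nlia|nlia].
rewrite /tadj /tarc; apply/idP/idP => h; bhyps; bgoal.
Qed.

Let ty (a : nat) : bool := (a == k.+1) || (a == k.+2).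

Let tyk a : ty a -> a < k + 3. Proof. by rewrite /ty; nlia. Qed.

Let x_y a : ty a -> n (t k.-1) (t a).
Proof.
by move=> ya; apply: ng; [nlia|exact: tyk|]; move: ya; rewrite /ty /tneg /tnegarc;
  case/orP=> h; bgoal.
Qed.

Let w_y a : ty a -> e (t k) (t a).
Proof.
move=> ya; rewrite ad; [|nlia|exact: tyk].
by move: ya; rewrite /ty /tadj /tarc; case/orP=> h; bgoal.
Qed.

Let P_y a i : ty a -> i < s + k - 1 -> ~~ e (P i) (t a).
Proof.
move=> ya ik; have [is_|si] := ltnP i s.
  by rewrite (P_c is_) ct //; move: ya; rewrite /ty; nlia.
rewrite -(subnKC si) P_t ad; [|nlia|exact: tyk].
apply/negP; move: ya; rewrite /ty /tadj /tarc => ya h; bhyps; nlia.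
Qed.

Let Q a i := if i <= s + k - 1 then P i else t a.

Let ipQ a : ty a -> ipath (Q a) (s + k - 1).+1.
Proof.
move=> ya; apply: (ipath_rcons ipP) => [|i ik]; last exact: P_y.
by rewrite -addnBA // P_t subn1 (neg_adj) ?x_y.
Qed.

(* the vertex [P (s + k - 2)] precedes [t k.-1] on the path; it is [c 0] if [k = 1] *)
Let pre_w : two = false -> ~~ e (P (s + k - 2)) (t k).
Proof.
move=> tw; have [ks|ks] := ltnP (s + k - 2) s.
  by rewrite (P_c ks) ct //; nlia.
rewrite -(subnKC ks) P_t ad; [|nlia|nlia].
by apply/negP; rewrite tw /tadj /tarc => h; bhyps; nlia.
Qed.

Let pre_w2 : two -> n (t k) (P (s + k - 2)) /\ 1 < k.
Proof.
move=> tw; have k1 : 1 < k by move: va; rewrite tw.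
have -> : s + k - 2 = s + k.-2 by nlia.
by split=> //; rewrite P_t; apply: ng; [nlia|nlia|rewrite /tneg /tnegarc tw; bgoal].
Qed.

Let x_pre : e (t k.-1) (P (s + k - 2)).
Proof.
have -> : t k.-1 = P (s + k - 1) by rewrite -addnBA // P_t subn1.
by rewrite ipP; nlia.
Qed.

Let t_neq i j : i < k + 3 -> j < k + 3 -> i != j -> t i != t j.
Proof. exact: (tad_neq tt). Qed.

(** A vertex that sees [y] or [z] sees both ends of the induced path which leads there. *)
Let sideA a : ty a -> e v (t a) -> forall i, i <= s + k -> ~~ odd i -> e v (Q a i).
Proof.
move=> ya vy i ik oi.
apply: (fan (ipQ ya)) => //; last by nlia.
  by rewrite /Q leq0n /P s1.
by rewrite /Q ifF //; nlia.
Qed.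

Let sideA_par a : ty a -> e v (t a) -> ~~ odd (s + k).
Proof.
move=> ya vy; have h := ipath_part (ipQ ya) (leqnn _).
have v0' : e v (Q a 0) by rewrite /Q leq0n /P s1.
have vm : e v (Q a (s + k - 1).+1) by rewrite /Q ifF //; nlia.
have -> : s + k = (s + k - 1).+1 by nlia.
by have := bG v0'; have := bG vm; rewrite h; do 2 case: (part _); case: (odd _).
Qed.

Let sideA_pre a : ty a -> e v (t a) -> e v (P (s + k - 2)).
Proof.
move=> ya vy; have := sideA ya vy (i := s + k - 2).
rewrite /Q ifT; last by nlia.
apply; first by nlia.
by have := sideA_par ya vy; nlia.
Qed.

(** If [v] missed [t b], then in type 1 the negative edge from [x_k] to [t a] would be the middle
    edge of [D]; in type 2 it gives [F5] together with the negative edge from [w] to [x_{k-1}]. *)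
Let sideA_other a b : ty a -> ty b -> e v (t a) -> e v (t b).
Proof.
move=> ya yb vy; have [<-//|nab] := eqVneq a b.
apply/negPn/negP => nvb.
have vd := sideA_pre ya vy.
have xa := x_y ya; have xb := neg_adj (x_y yb).
case tw: two; last first.
  apply/negP: xa; apply: (no_D (a1 := v) (b1 := P (s + k - 2)) (a3 := t k) (b3 := t b));
    rewrite ?x_pre ?w_y //.
  by rewrite symG; exact: pre_w.
have [wd k1] := pre_w2 tw.
apply/negP: wd.
apply: (no_F5 (a1 := v) (a2 := t k.-1) (b1 := t a) (b3 := t b));
  rewrite ?x_pre ?w_y // ?(neg_adj (x_y _)) //.
- by apply: t_neq; nlia.
- have -> : s + k - 2 = s + k.-2 by nlia.
  by rewrite P_t; apply: t_neq; move: ya; rewrite /ty; nlia.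
- exact: neg_adj (pre_w2 tw).1.
Qed.

(** A negative edge from [v] to [t a] and the one from [x_k] to [t b] are those of [F5] in type 1;
    in type 2 the negative edge from [w] to [x_{k-1}] completes [F4]. *)
Let sideA_pos a b : ty a -> ty b -> a != b -> e v (t a) -> ~~ n v (t a).
Proof.
move=> ya yb ab vy; have vb := sideA_other ya yb vy.
have vd := sideA_pre ya vy.
apply/negP=> na.
case tw: two; last first.
  apply/negP: (x_y yb).
  apply: (no_F5 (a1 := t k) (a2 := v) (b1 := t a) (b3 := P (s + k - 2)));
    rewrite ?x_pre ?w_y // ?(neg_adj (x_y _)) //.
  + by apply/eqP; apply: vt; nlia.
  + by apply: t_neq; rewrite ?tyk.
  + by rewrite symG; exact: pre_w.
have [wd k1] := pre_w2 tw.
have dE : P (s + k - 2) = t k.-2 by rewrite -P_t; congr P; nlia.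
apply/negP: wd.
apply: (no_F4 (a1 := v) (a2 := t k.-1) (b1 := t a) (b2 := t b)) => //.
- rewrite /= !inE negb_or !andbT -andbA; apply/and3P; split.
  + by apply/eqP/vt; nlia.
  + by apply/eqP/vt; nlia.
  + by apply: t_neq; nlia.
- rewrite /= !inE negb_or !andbT -andbA dE; move: ya yb ab; rewrite /ty => ya yb ab.
  by apply/and3P; split; apply: t_neq; nlia.
- move=> x y; rewrite !inE => /or3P[]/eqP-> /or3P[]/eqP->; rewrite ?x_pre ?w_y ?(neg_adj (x_y _)) //.
  exact: neg_adj (pre_w2 tw).1.
- exact: x_y.
Qed.

(** The second alternative is what a join requires of the end [v] of the other tadpole, including
    the exceptional sign. The cases are whether [v] sees [y] or [z], only the head [w], or no
    head. *)
Lemma tad_vs_vertex : (exists2 j, 0 < j < k + 3 & e v (t j)) ->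
  Tad D v \/
  (forall j, j < k + 3 -> part v != part (t j) -> e v (t j)) /\
  (forall j, j < k + 3 -> n v (t j) -> [&& ~~ two, k == 1 & j == k]).
Proof.
move=> vM.
have vP i : i < s + k -> part v = part (P i) (+) ~~ odd i.
  move=> ik; rewrite (ipath_part ipP); last by nlia.
  have v0' : e v (P 0) by rewrite /P s1.
  by have := bG v0'; do 2 case: (part _); case: (odd i).
have vtE j : j < k -> part v = part (t j) (+) ~~ odd (s + j).
  by move=> jk; rewrite -P_t; apply: vP; nlia.
have ty1 : ty k.+1 by rewrite /ty eqxx.
have ty2 : ty k.+2 by rewrite /ty eqxx orbT.
have wy1 := common_part (neg_adj (x_y ty1)) (w_y ty1).
have y12 : part (t k.+1) = part (t k.+2).
  by apply: (common_part (z := t k)); rewrite symG w_y.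
have cases j : j < k + 3 -> [\/ j < k, j = k | ty j].
  move=> jk; rewrite /ty; case: (ltngtP j k) => h; [by constructor 1| |by constructor 2].
  by constructor 3; nlia.
have [vy|nvy] := boolP (e v (t k.+1) || e v (t k.+2)).
  right; have vy1 : e v (t k.+1).
    by case/orP: vy => // h; apply: sideA_other ty2 ty1 h.
  have vy2 := sideA_other ty1 ty2 vy1.
  have par := sideA_par ty1 vy1.
  have low j : j < k -> ~~ odd (s + j) -> e v (t j) /\ ~~ n v (t j).
    move=> jk oj; have Qj : Q k.+1 (s + j) = t j by rewrite /Q ifT ?P_t //; nlia.
    rewrite -Qj; split; first by apply: sideA => //; nlia.
    apply: (fan_pos (ipQ ty1)) => //; try nlia.
      by rewrite /Q leq0n /P s1.
    by rewrite /Q ifF //; nlia.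
  split=> j jk.
  - case/cases: (jk) => [jk'|->|/orP[]/eqP-> //].
      by rewrite (vtE j jk') => h; case: (low j) => //; move: h; case: (part _); case: (odd _).
    have ok : odd (s + k.-1) by nlia.
    by rewrite -wy1 (vtE k.-1) ?ok ?addbF ?eqxx //; nlia.
  - move=> nj; exfalso; have vj := neg_adj nj; case/cases: (jk) => [jk'|jk'|yj].
    + by have [] := low j jk'; rewrite ?nj //; have := bG vj; rewrite (vtE j jk'); case: (part _); case: (odd _).
    + have ok : odd (s + k.-1) by nlia.
      by have := bG vj; rewrite jk' -wy1 (vtE k.-1) ?ok ?addbF ?eqxx //; nlia.
    + case/orP: (yj) => /eqP jE.
        by have ne : j != k.+2 by [rewrite jE; nlia]; have := sideA_pos yj ty2 ne vj; rewrite nj.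
      by have ne : j != k.+1 by [rewrite jE; nlia]; have := sideA_pos yj ty1 ne vj; rewrite nj.
move: nvy; rewrite negb_or => /andP[nvy1 nvy2].
have [vw|nvw] := boolP (e v (t k)); last first.
  left; have [j jM vj] := vM.
  have jk : j < k.
    case/cases: (proj2 (andP jM)) => // [jE|/orP[]/eqP jE].
    - by rewrite jE (negbTE nvw) in vj.
    - by rewrite jE (negbTE nvy1) in vj.
    - by rewrite jE (negbTE nvy2) in vj.
  have k1 : 0 < k.-1 by nlia.
  have tt' : tad G two k.-1.+1 t by rewrite prednK.
  (* The end is dropped first because it need not belong to [D]; the neighbour [t j] of [v] is not
     the end. *)
  apply: (Tad_reach (tad_drop tt' k1) (j := j.-1)); rewrite ?prednK //; try nlia.
  + by move=> i ik; apply: vt; nlia.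
  + by move=> i ik; apply: tD; nlia.
(* the last vertex of the path is [t k.-1], so [v] is on the side of the [y]'s *)
have oddsk : ~~ odd (s + k.-1) .
  have := bG vw; rewrite -wy1 (vtE k.-1); last by nlia.
  by case: (part _); case: (odd _).
have [vx low] : e v (t k.-1) /\ forall j, j < k -> ~~ odd (s + j) ->
    e v (t j) /\ (~~ n v (t j) \/ two /\ j = k.-1).
  case tw: two; last first.
    (* A path which ends in [w], a neighbour of [v]: in type 1 it passes through [x_k] and [y], in
       type 2 it turns to [w] at [x_{k-1}]. *)
    pose R i := if i <= (s + k - 1).+1 then Q k.+1 i else t k.
    have ipR : ipath R (s + k - 1).+2.
      apply: (ipath_rcons (ipQ ty1)) => [|i ik].
        by rewrite /Q ifF; [rewrite symG w_y|nlia].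
      rewrite /Q ifT; last by nlia.
      have [is_|si] := ltnP i s; first by rewrite (P_c is_) ct //; nlia.
      rewrite -(subnKC si) P_t ad; [|nlia|nlia].
      by apply/negP; rewrite tw /tadj /tarc => h; bhyps; nlia.
    have R0 : e v (R 0) by rewrite /R /Q /= /P s1.
    have Rm : e v (R (s + k - 1).+2) by rewrite /R ifF //; nlia.
    have RE j : j < k -> R (s + j) = t j.
      by move=> jk; rewrite /R ifT /Q ?ifT ?P_t //; nlia.
    have vj j : j < k -> ~~ odd (s + j) -> e v (t j).
      by move=> jk oj; rewrite -RE //; apply: (fan ipR) => //; nlia.
    split; first by apply: vj => //; nlia.
    move=> j jk oj; split; first exact: vj.
    by left; rewrite -RE //; apply: (fan_pos ipR) => //; nlia.
  have [wd k1] := pre_w2 tw.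
  have dE : P (s + k - 2) = t k.-2 by rewrite -P_t; congr P; nlia.
  pose R i := if i <= s + k - 2 then P i else t k.
  have ipR : ipath R (s + k - 2).+1.
    apply: (ipath_rcons) => [i j ik jk||i ik]; first by apply: ipP; nlia.
      by rewrite symG; apply: neg_adj wd.
    have [is_|si] := ltnP i s; first by rewrite (P_c is_) ct //; nlia.
    rewrite -(subnKC si) P_t ad; [|nlia|nlia].
    by apply/negP; rewrite /tadj /tarc => h; bhyps; nlia.
  have R0 : e v (R 0) by rewrite /R /= /P s1.
  have Rm : e v (R (s + k - 2).+1) by rewrite /R ifF //; nlia.
  have RE i : i <= s + k - 2 -> R i = P i by rewrite /R => ->.
  have vp i : i <= s + k - 2 -> ~~ odd i -> e v (P i).
    by move=> jk oj; rewrite -RE //; apply: (fan ipR) => //; nlia.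
  have vd2 : e v (P (s + k - 3)) by apply: vp; nlia.
  have dd2 : e (P (s + k - 2)) (P (s + k - 3)) by rewrite ipP; nlia.
  have ynd2 : ~~ e (P (s + k - 3)) (t k.+1) by apply: P_y => //; nlia.
  have we := neg_adj wd.
  have vx : e v (t k.-1).
    apply/negPn/negP=> nvx; apply/negP: wd.
    apply: (no_D (a1 := P (s + k - 3)) (b1 := v) (a3 := t k.-1) (b3 := t k.+1)) => //.
    + by rewrite symG.
    + by rewrite symG.
    + by rewrite symG.
    + exact: w_y.
    + exact: neg_adj (x_y ty1).
    + by rewrite symG.
  have xE : t k.-1 = P (s + k - 1) by rewrite -addnBA // P_t subn1.
  split=> // j jk oj; have [jE|jE] := eqVneq j k.-1.
    by rewrite jE; split=> //; right.
  have jE' : j < k.-2 by nlia.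
  rewrite -P_t; split; first by apply: vp => //; nlia.
  left; apply: (fan_pos ipP) => //; try nlia.
  by rewrite -xE.
(* With a negative edge [v w], the vertices [v], [x_k] and the heads form a tadpole of type 2. For
   [k = 1] the vertex [x_k] is the end, which need not be in [D]: the exception of joins. *)
have [nw|pw] := boolP (n v (t k) && (1 < k)).
  left; case/andP: nw => nw k1.
  pose u i := if i is i'.+1 then (if i' is i''.+1 then t (i'' + k) else t k.-1) else v.
  have uE i : u i.+2 = t (i + k) by [].
  exists true, 2, u; split=> //; last first.
    by case=> [|[|i]] // ik; rewrite /u; apply: tD; nlia.
  split=> //.
  - have ui i : 0 < i < 2 + 3 -> u i = t (i + k - 2).
      by case: i => [|[|i]] // ik; rewrite /u; congr t; nlia.
    have vu i : 0 < i < 2 + 3 -> v <> u i by move=> ik; rewrite ui //; apply: vt; nlia.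
    case=> [|i] [|j] // ik jk; [by move/vu => []; nlia|by move/esym/vu => []; nlia|].
    rewrite !ui //; try nlia.
    case: (tt) => _ inj _ _ /inj h.
    have {}h : i.+1 + k - 2 = j.+1 + k - 2 by apply: h; nlia.
    by nlia.
  - have vE i : i < 4 -> e v (u i.+1) = tadj true 2 0 i.+1.
      by case: i => [|[|[|[|i]]]] // _; rewrite ?uE /u ?add0n ?add1n ?add2n
        ?vx ?vw ?(negbTE nvy1) ?(negbTE nvy2).
    case=> [|i] [|j] ik jk; first by rewrite irrG.
    + by rewrite vE //; nlia.
    + by rewrite symG vE // tadjC.
    + have ui l : l < 4 -> u l.+1 = t (l + k).-1.
        by case: l => [|l] // lk; rewrite /u; congr t; nlia.
      rewrite !ui // ad; [|nlia|nlia].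
      have -> : tadj true 2 i.+1 j.+1 = tadj false 1 i j by case: i j {ik jk} => [|[|[|[|[|i]]]]] [|[|[|[|[|j]]]]].
      exact: tadj_head.
  - have vw' : n (t k) v by rewrite symnG.
    have vn i : i < 5 -> tneg true 2 0 i -> n v (u i).
      by case: i => [|[|[|[|[|i]]]]] // _ _; rewrite uE add0n.
    have xn i : i < 4 -> tneg true 2 1 i.+1 -> n (u 1) (u i.+1).
      by case: i => [|[|[|[|i]]]] // _ _; rewrite uE ?add1n ?add2n; apply: x_y.
    move=> i j ik jk h; case: i ik h => [|[|i]] ik h; first exact: vn.
      by case: j jk h => [|j] jk h; [rewrite symnG; apply: vn; rewrite // tnegC|exact: xn].
    rewrite tnegC in h; rewrite symnG.
    case: j jk h => [|[|j]] jk h; [exact: vn|exact: xn|].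
    by case: i j ik jk h => [|[|[|i]]] [|[|[|j]]].
right; split=> j jk.
  case/cases: (jk) => [jk'|->//|yj].
    by rewrite (vtE j jk') => h; case: (low j) => //; move: h; case: (part _); case: (odd _).
  have -> : part (t j) = part (t k.+1) by case/orP: yj => /eqP->.
  have := bG vw; have := bG (w_y ty1); by do 3 case: (part _).
move=> nj; have vj := neg_adj nj; case/cases: (jk) => [jk'|jk'|yj].
- exfalso; have [|_ []] := low j jk'.
  + by have := bG vj; rewrite (vtE j jk'); case: (part _); case: (odd _).
  + by rewrite nj.
  (* In type 2 [x_k] is off the path to [w], so [fan_pos] does not apply to it; [F5] with the
     negative edge from [w] to [x_{k-1}] does. *)
  + case=> tw jE; have [wd k1] := pre_w2 tw.
    have dE : P (s + k - 2) = t k.-2 by rewrite -P_t; congr P; nlia.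
    apply/negP: wd.
    have vd2 : e v (P (s + k - 3)).
      have [k2|k2] := leqP 3 k.
        have -> : s + k - 3 = s + (k - 3) by nlia.
        by rewrite P_t; apply: (low _ _ _).1; nlia.
      have -> : s + k - 3 = 0 by nlia.
      by rewrite /P s1.
    apply: (no_F5 (a1 := P (s + k - 3)) (a2 := t k.-1) (b1 := v) (b3 := t k.+1)).
    * by apply: t_neq; nlia.
    * by rewrite dE; apply/eqP/vt; nlia.
    * by rewrite symG.
    * by rewrite ipP; nlia.
    * by rewrite symG.
    * exact: x_pre.
    * exact: neg_adj (x_y ty1).
    * by rewrite symG.
    * exact: neg_adj (pre_w2 tw).1.
    * exact: w_y.
    * by apply: P_y => //; nlia.
    * by rewrite symnG -jE.
- move: pw; rewrite -jk' nj /= jk' eqxx andbT -leqNgt => k1.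
  have kE : k = 1 by nlia.
  by rewrite kE eqxx andbT; apply/negP=> tw; case: (pre_w2 tw); nlia.
- by case/orP: yj => /eqP jE; rewrite jE in vj; move: nvy1 nvy2; rewrite vj.
Qed.

End Vertex.

Lemma Tad1 (D : {pred T}) x w y z : w \in D -> y \in D -> z \in D ->
  x != w -> y != z -> n x y -> n x z -> e w y -> e w z -> Tad D x.
Proof.
move=> wD yD zD xw yz xy xz wy wz; exists false, 1, (nth x [:: x; w; y; z]).
have [exy exz] := (neg_adj xy, neg_adj xz).
have Pxw := common_part exy wy.
have Pyz : part y = part z by apply: (common_part (z := x)); rewrite symG.
have exw : e x w = false by apply: same_part_nadj Pxw.
have eyz : e y z = false by apply: same_part_nadj Pyz.
have ne a b : e a b -> a != b by move=> h; apply: contraTneq h => ->; rewrite irrG.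
have u : uniq [:: x; w; y; z].
  by rewrite /= !inE !negb_or xw yz !ne.
split=> //; last by case=> [|[|[|[|i]]]].
split=> //.
- by move=> i j ik jk /eqP; rewrite nth_uniq // => /eqP.
- by case=> [|[|[|[|i]]]] [|[|[|[|j]]]] //= _ _;
    rewrite ?irrG ?exy ?exz ?wy ?wz ?exw ?eyz // symG ?exy ?exz ?wy ?wz ?exw ?eyz.
- by case=> [|[|[|[|i]]]] [|[|[|[|j]]]] //= _ _ _; rewrite ?xy ?xz // symnG.
Qed.

Lemma Tad2 (D : {pred T}) x x2 w y z : x2 \in D -> w \in D -> y \in D -> z \in D ->
  x2 != w -> y != z -> x != y -> x != z ->
  e x x2 -> n x w -> n x2 y -> n x2 z -> e w y -> e w z -> Tad D x.
Proof.
move=> x2D wD yD zD x2w yz xy xz exx2 nxw n2y n2z ewy ewz.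
exists true, 2, (nth x [:: x; x2; w; y; z]).
have [exw e2y e2z] := And3 (neg_adj nxw) (neg_adj n2y) (neg_adj n2z).
have P2w := common_part e2y ewy.
have Pyz : part y = part z by apply: (common_part (z := x2)); rewrite symG.
have Pxy : part x = part y by apply: (common_part (z := x2)); rewrite // symG.
have Pxz : part x = part z by rewrite Pxy.
have e2w : e x2 w = false by apply: same_part_nadj P2w.
have eyz : e y z = false by apply: same_part_nadj Pyz.
have exy : e x y = false by apply: same_part_nadj Pxy.
have exz : e x z = false by apply: same_part_nadj Pxz.
have ne a b : e a b -> a != b by move=> h; apply: contraTneq h => ->; rewrite irrG.
have u : uniq [:: x; x2; w; y; z].
  by rewrite /= !inE !negb_or x2w yz xy xz !ne.
split=> //; last by case=> [|[|[|[|[|i]]]]].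
split=> //.
- by move=> i j ik jk /eqP; rewrite nth_uniq // => /eqP.
- by case=> [|[|[|[|[|i]]]]] [|[|[|[|[|j]]]]] //= _ _;
    rewrite ?irrG ?exx2 ?exw ?exy ?exz ?e2w ?e2y ?e2z ?ewy ?ewz ?eyz // symG
      ?exx2 ?exw ?exy ?exz ?e2w ?e2y ?e2z ?ewy ?ewz ?eyz.
- by case=> [|[|[|[|[|i]]]]] [|[|[|[|[|j]]]]] //= _ _ _; rewrite ?nxw ?n2y ?n2z // symnG.
Qed.

Section Base.
Variables (K S : {set T}) (x0 : T).
Hypotheses (x0K : x0 \in K)
  (hK : forall x, x \in K -> exists2 y, y \in K & e x y)
  (hN : forall x y, x \in K -> e x y -> (y \in K) || (y \in S))
  (KS : forall x, x \in K -> x \notin S)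
  (hS : forall s x, s \in S -> x \in K -> part s != part x -> e s x)
  (hSS : forall s s', s \in S -> s' \in S -> part s != part s' -> e s s' && ~~ n s s')
  (chain : forall a a' b b', a \in K -> a' \in K -> b \in K -> b' \in K ->
     part a -> part a' -> e a b -> e a' b' -> e a b' || e a' b)
  (hF5 : forall s s' b b', s \in S -> s' \in S -> s != s' -> b \in K -> b' \in K ->
     b != b' -> part s = part s' -> n s b -> ~~ n s' b').

Lemma base_tadpole :
  (forall a b, a \in K -> b \in K -> e a b -> exists p q, obstructing G a b p q) ->
  exists2 x, x \in S & Tad (mem K) x.
Proof.
move=> obs.
have [r [rk0 [r0 rk0b adK LX0 LY0]]] := chain_ranks symG bG x0K hK chain.
(* As [S] is complete to [K], the extreme ranks extend the comparison of ranks to [S]. *)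
pose rk x := if x \in S then (if part x then r.+1 else 0) else rk0 x.
pose W := [pred x | (x \in K) || (x \in S)].
pose X := [pred x | W x && part x].
pose Y := [pred x | W x && ~~ part x].
pose ng p q := [&& X p, Y q & n p q].
have rkK x : x \in K -> rk x = rk0 x by move=> xK; rewrite /rk (negbTE (KS xK)).
have rkKb x : x \in K -> 0 < rk x <= r by move=> xK; rewrite rkK ?rk0b.
have rkSX x : x \in S -> part x -> rk x = r.+1 by rewrite /rk => -> ->.
have rkSY x : x \in S -> ~~ part x -> rk x = 0 by rewrite /rk => -> /negbTE->.
have inK x : W x -> 0 < rk x <= r -> x \in K.
  rewrite /rk => /orP[//|xS]; rewrite xS; case: (part x); nlia.
have inS0 x : W x -> rk x = 0 -> x \in S.
  by move=> /orP[xK|//] h; have := rkKb x xK; rewrite h.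
have inSr x : W x -> r < rk x -> x \in S.
  by move=> /orP[xK|//] h; have /andP[_] := rkKb x xK; rewrite leqNgt h.
have adW p q : X p -> Y q -> e p q = (rk q <= rk p).
  case/andP=> pW pp /andP[qW pq].
  have pnq : part p != part q by rewrite pp; case: (part q) pq.
  case/orP: pW => [pK|pS]; case/orP: qW => [qK|qS].
  - by rewrite !rkK // adK.
  - by rewrite (rkSY q) // symG hS // eq_sym.
  - by rewrite (rkSX p) // hS // ltnW // ltnS; case/andP: (rkKb q qK).
  - by rewrite (rkSY q) //; case/andP: (hSS pS qS pnq).
have ngXY p q : ng p q -> X p /\ Y q by case/and3P.
have ngW p q : ng p q -> W p /\ W q by case/and3P=> /andP[-> _] /andP[-> _].
have ngn p q : ng p q -> n p q by case/and3P.
have ngSS p q : ng p q -> p \in S -> q \in S -> False.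
  case/and3P=> /andP[_ pp] /andP[_ pq] npq pS qS.
  have pnq : part p != part q by rewrite pp; case: (part q) pq.
  by have /andP[_] := hSS pS qS pnq; rewrite npq.
have LX i : 0 < i <= r -> exists2 a, a \in X & rk a = i.
  by move/LX0=> [a /andP[aK pa] <-]; exists a; rewrite ?rkK // inE /= aK.
have LY i : 0 < i <= r -> exists2 b, b \in Y & rk b = i.
  by move/LY0=> [a /andP[aK pa] <-]; exists a; rewrite ?rkK // inE /= aK.
have rk_le p q : ng p q -> rk p <= r.+1.
  case/ngW => /orP[pK|pS] _; first by have /andP[_] := rkKb p pK; nlia.
  by rewrite /rk pS; case: (part p).
have corner p q : ng p q -> rk q = 0 -> rk p <= r.
  move=> npq q0; rewrite leqNgt; apply/negP=> pr.
  by case: (ngSS p q npq); [apply: inSr pr; case: (ngW _ _ npq)|apply: inS0 q0; case: (ngW _ _ npq)].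
have star m p q p' q' : m <= r -> sig ng rk m p q -> sig ng rk m p' q' -> p = p' \/ q = q'.
  move=> mr /andP[npq /andP[qm mp]] /andP[npq' /andP[qm' mp']].
  have [Wp Wq] := ngW _ _ npq; have [Wp' Wq'] := ngW _ _ npq'.
  have [->|pp] := eqVneq p p'; first by left.
  have [->|qq] := eqVneq q q'; first by right.
  exfalso; have [Xp Yq] := ngXY _ _ npq; have [Xp' Yq'] := ngXY _ _ npq'.
  have parq : part q = part q' by move: Yq Yq' => /andP[_ /negbTE->] /andP[_ /negbTE->].
  have parp : part p = part p' by move: Xp Xp' => /andP[_ ->] /andP[_ ->].
  (* At the gaps 0 and [r] one of the vertices [w], [c] used for [F5] below has no counterpart of
     the required rank; [hF5] takes the place of [no_F5]. *)
  have [m0|m0] := posnP m.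
    have qS : q \in S by apply: inS0 => //; nlia.
    have qS' : q' \in S by apply: inS0 => //; nlia.
    have pK : p \in K by case/orP: Wp => // pS; case: (ngSS _ _ npq).
    have pK' : p' \in K by case/orP: Wp' => // pS; case: (ngSS _ _ npq').
    have := hF5 qS qS' qq pK pK' pp parq; rewrite !(symnG q) (symnG q') !ngn //.
    by move=> /(_ isT).
  have [mr'|mr'] := eqVneq m r.
    have pS : p \in S by apply: inSr; rewrite -?mr'.
    have pS' : p' \in S by apply: inSr; rewrite -?mr'.
    have qK : q \in K by case/orP: Wq => // qS; case: (ngSS _ _ npq).
    have qK' : q' \in K by case/orP: Wq' => // qS; case: (ngSS _ _ npq').
    by have := hF5 pS pS' pp qK qK' qq parp; rewrite !ngn // => /(_ isT).
  (* The non-edge of [F5]: [w] and [c] have ranks [m] and [m + 1], hence just miss each other but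
     see all ends of the crossing edges on the opposite side. *)
  have [w wX rw] := LX m (introT andP (conj m0 mr)).
  have [|c cY rc] := LY m.+1; first by rewrite /= ltn_neqAle mr'.
  have := ngn _ _ npq'; apply/negP.
  apply: (no_F5 (a1 := w) (a2 := p) (b1 := q) (b3 := c)) => //;
    rewrite ?adW ?rw ?rc //; try exact: ngn; nlia.
have cov i : 0 < i <= r -> exists a b, [/\ a \in X, b \in Y, i <= rk a, rk b <= i &
     forall p q, ng p q -> i <= rk p -> rk q <= i -> p = a \/ q = b].
  move=> ir; have [a aX ra] := LX i ir; have [b bY rb] := LY i ir.
  pose A := [pred x | X x && (i <= rk x)]; pose B := [pred x | Y x && (rk x <= i)].
  have aA : a \in A by rewrite inE [X a]aX ra leqnn.
  have bB : b \in B by rewrite inE [Y b]bY rb leqnn.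
  have adAB p q : p \in A -> q \in B -> e p q.
    by rewrite !inE => /andP[pX ip] /andP[qY qi]; rewrite adW //; apply: leq_trans ip.
  have [p [q [/andP[pX ip] /andP[qY qi] h]]] := biclique_cover aA bB adAB.
  exists p, q; split=> // p' q' npq ip' qi'; have [pX' qY'] := ngXY _ _ npq.
  by apply: h; [apply/andP|apply/andP|exact: ngn].
have lvlK x i : 0 < i <= r -> W x -> rk x = i -> x \in K by move=> ir xW xi; apply: inK; rewrite ?xi.
have tadX p q p' q' : ng p q -> ng p' q' -> p != p' -> q = q' -> q \in S ->
    exists2 x, x \in S & Tad (mem K) x.
  move=> npq npq' pp qq qS; exists q => //; rewrite -qq in npq'.
  have [w wY rw] := LY 1 (introT andP (conj (ltnSn 0) r0)).
  have pK : p \in K by case: (ngW _ _ npq) => /orP[//|pS] _; case: (ngSS _ _ npq).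
  have pK' : p' \in K by case: (ngW _ _ npq') => /orP[//|pS] _; case: (ngSS _ _ npq').
  have wK : w \in K by apply: (lvlK w 1); rewrite ?r0 //; case/andP: wY.
  apply: (@Tad1 _ q w p p') => //.
  - by apply: contraTneq wK => <-; apply: contraL qS; apply: KS.
  - by rewrite symnG ngn.
  - by rewrite symnG ngn.
  - by rewrite symG adW ?rw //; [case/andP: (rkKb p pK)|case: (ngXY _ _ npq)].
  - by rewrite symG adW ?rw //; [case/andP: (rkKb p' pK')|case: (ngXY _ _ npq')].
have tadY p q p' q' : ng p q -> ng p' q' -> q != q' -> p = p' -> p \in S ->
    exists2 x, x \in S & Tad (mem K) x.
  move=> npq npq' qq pp pS; exists p => //; rewrite -pp in npq'.
  have [w wX rw] := LX r (introT andP (conj r0 (leqnn r))).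
  have qK : q \in K by case: (ngW _ _ npq) => _ /orP[//|qS]; case: (ngSS _ _ npq).
  have qK' : q' \in K by case: (ngW _ _ npq') => _ /orP[//|qS]; case: (ngSS _ _ npq').
  have wK : w \in K by apply: (lvlK w r); rewrite ?r0 ?leqnn //; case/andP: wX.
  apply: (@Tad1 _ p w q q') => //.
  - by apply: contraTneq wK => <-; apply: contraL pS; apply: KS.
  - by rewrite ngn.
  - by rewrite ngn.
  - by rewrite adW ?rw //; [case/andP: (rkKb q qK)|case: (ngXY _ _ npq)].
  - by rewrite adW ?rw //; [case/andP: (rkKb q' qK')|case: (ngXY _ _ npq')].
(* Otherwise two negative edges share a vertex of rank 0, which lies in [S], and a vertex of rank 1
   closes a tadpole of type 1 with [k = 1]. *)
have [X0|nX0] := boolP (XT ng rk 0); last first.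
  move: nX0; do ![rewrite negb_forall => /existsP[?]].
  rewrite negb_imply => /andP[/andP[s1 s2] pp].
  have [/andP[n1 /andP[q0 _]] /andP[n2 _]] := (s1, s2).
  have [pE|qE] := star _ _ _ _ _ (leq0n r) s1 s2; first by rewrite pE eqxx in pp.
  by apply: (tadX _ _ _ _ n1 n2 pp qE); apply: inS0; [case: (ngW _ _ n1)|nlia].
have [Yr|nYr] := boolP (YT ng rk r); last first.
  move: nYr; do ![rewrite negb_forall => /existsP[?]].
  rewrite negb_imply => /andP[/andP[s1 s2] qq].
  have [/andP[n1 /andP[_ p1]] /andP[n2 _]] := (s1, s2).
  have [pE|qE] := star _ _ _ _ _ (leqnn r) s1 s2; last by rewrite qE eqxx in qq.
  by apply: (tadY _ _ _ _ n1 n2 qq pE); apply: inSr => //; case: (ngW _ _ n1).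
case: (levels (X := X) (Y := Y) r0 LX LY ngXY rk_le corner star cov X0 Yr).
- case=> i ir [a [b [aX bY ra rb ab]]].
  have aK : a \in K by apply: (lvlK a i) => //; case/andP: aX.
  have bK : b \in K by apply: (lvlK b i) => //; case/andP: bY.
  have eab : e a b by rewrite adW // ra rb.
  have [p [q /and5P[ap bq pb qa npq]]] := obs a b aK bK eab.
  have pY : Y p by rewrite /= (hN aK ap) /=; have := bG ap; case/andP: aX => _; case: (part p); case: (part a).
  have qX : X q by rewrite /= (hN bK bq) /=; have := bG bq; case/andP: bY => _; case: (part q); case: (part b).
  have pi : rk p <= i by rewrite -ra -adW.
  have qi : i <= rk q by rewrite -rb -adW // symG.
  have eqp : e p q by rewrite symG adW // (leq_trans pi).
  have nqp : ng q p by rewrite /ng qX pY symnG /=; move: npq; rewrite eqp /= negbK.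
  by case: (ab q p nqp qi pi) => E; [move: qa|move: pb]; rewrite E eqxx.
- case=> i [p [b [ir [/andP[npb _] rb _ _ [b0 [a1 [a2 [bb aa rb0 [ra1 ra2] [n1 n2]]]]]] rp]]].
  have [[Wp Wb] [Wa1 Wb0] [Wa2 _]] := And3 (ngW _ _ npb) (ngW _ _ n1) (ngW _ _ n2).
  have [[Xp Yb] [Xa1 Yb0] [Xa2 _]] := And3 (ngXY _ _ npb) (ngXY _ _ n1) (ngXY _ _ n2).
  have pS : p \in S by apply: inSr; rewrite ?rp.
  have pnot x : rk x = i -> p != x by move=> rx; apply/eqP=> E; move: rp; rewrite E rx; nlia.
  exists p => //; apply: (@Tad2 _ p b0 b a1 a2); rewrite ?(lvlK _ i) ?pnot //.
  + by rewrite eq_sym.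
  + by rewrite adW // rb0 rp; nlia.
  + exact: ngn.
  + by rewrite symnG ngn.
  + by rewrite symnG ngn.
  + by rewrite symG adW // rb ra1.
  + by rewrite symG adW // rb ra2.
- case=> i [a [q [ir [/andP[naq _] ra _ _ [a0 [b1 [b2 [aa bb ra0 [rb1 rb2] [n1 n2]]]]]] rq]]].
  have [[Wa Wq] [Wa0 Wb1] [_ Wb2]] := And3 (ngW _ _ naq) (ngW _ _ n1) (ngW _ _ n2).
  have [[Xa Yq] [Xa0 Yb1] [_ Yb2]] := And3 (ngXY _ _ naq) (ngXY _ _ n1) (ngXY _ _ n2).
  have qS : q \in S by apply: inS0.
  have qnot x : rk x = i -> q != x by move=> rx; apply/eqP=> E; move: rq; rewrite E rx; nlia.
  exists q => //; apply: (@Tad2 _ q a0 a b1 b2); rewrite ?(lvlK _ i) ?qnot //.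
  + by rewrite eq_sym.
  + by rewrite symG adW // rq.
  + by rewrite symnG ngn.
  + exact: ngn.
  + exact: ngn.
  + by rewrite adW // ra rb1.
  + by rewrite adW // ra rb2.
(* The edge [p q] shared by both levels is the edge [a3 b2] of [F6]. *)
- case=> i [j [p [q [ir jr ij [/andP[npq _] rq _ _ [b0 [a1 [a2 [bb aa rb0 [ra1 ra2] [n1 n2]]]]]]]]]].
  case=> _ rp _ _ [a0 [b3 [b4 [pa b34 ra0 [rb3 rb4] [n3 n4]]]]].
  have [[Xa1 Yb0] [Xa2 _] [Xa0 Yb3]] := And3 (ngXY _ _ n1) (ngXY _ _ n2) (ngXY _ _ n3).
  have [[Xp Yq] [_ Yb4]] := (ngXY _ _ npq, ngXY _ _ n4).
  have rne x y : rk x = i -> rk y = j -> x != y.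
    by move=> xi yj; apply/eqP=> E; move: xi; rewrite E yj; nlia.
  exfalso; have := ngn _ _ n4; apply/negP.
  apply: (no_F6 (a1 := a1) (a2 := a2) (a3 := p) (b1 := b0) (b2 := q) (b3 := b3));
    try exact: ngn; rewrite ?adW ?ra1 ?ra2 ?rb0 ?rb3 ?rb4 ?rp ?rq ?ra0 //; try nlia.
  + by rewrite /= !inE !negb_or aa pa !rne.
  + by rewrite /= !inE !negb_or b34 [b0 == q]eq_sym bb !rne.
Qed.

End Base.

(** * Connected sets and full pairs *)

Definition within D := [rel u v | [&& u \in D, v \in D & e u v]].

Definition walk (D : {set T}) (p : nat -> T) m :=
  (forall i, i <= m -> p i \in D) /\ (forall i, i < m -> e (p i) (p i.+1)).

Lemma within_sym D : symmetric (within D).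
Proof. by move=> u v; rewrite /= symG; case: (u \in D); case: (v \in D). Qed.

Lemma conn_sym D x y : connect (within D) x y = connect (within D) y x.
Proof. exact: (sym_connect_sym (within_sym D)). Qed.

Lemma conn_walk D x y : x \in D -> connect (within D) x y ->
  exists p m, [/\ walk D p m, p 0 = x & p m = y].
Proof.
move=> xD /connectP[s]; elim: s x xD => [|z s IH] x xD /=.
  by move=> _ ->; exists (fun=> x), 0; split=> //; split=> // i; rewrite ltn0.
case/andP=> /and3P[_ zD xz] ps ly; have [p [m [[pD pe] p0 pm]]] := IH z zD ps ly.
exists (fun i => if i is i'.+1 then p i' else x), m.+1; split=> //; split.
  by case=> // i im; apply: pD.
by case=> [|i] im; [rewrite p0|apply: pe].
Qed.

Lemma walk_conn D p m i j : walk D p m -> i <= j <= m -> connect (within D) (p i) (p j).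
Proof.
case=> pD pe /andP[]; elim: j => [|j IH]; first by rewrite leqn0 => /eqP->.
rewrite leq_eqVlt => /orP[/eqP->//|ij] jm.
apply: connect_trans (IH ij (ltnW jm)) (connect1 _).
by rewrite /= pe // !pD // ltnW.
Qed.

Lemma conn_closed (D C : {set T}) x y : (forall u v, u \in C -> v \in D -> e u v -> v \in C) ->
  x \in D -> x \in C -> connect (within D) x y -> y \in C.
Proof.
move=> cl xD xC /(conn_walk xD)[p [m [[pD pe] p0 <-]]].
suff h i : i <= m -> p i \in C by exact: h.
elim: i => [|i IH] im; first by rewrite p0.
by apply: (cl (p i)); [exact/IH/ltnW|exact: pD|exact: pe].
Qed.

(* Induction on the length: a chord, a repetition or an earlier visit of [P] gives
   a shorter walk. *)
Lemma walk_ipath D (P : pred T) p m : walk D p m -> P (p m) ->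
  exists q l, [/\ ipath q l, q 0 = p 0, P (q l),
    forall i, i < l -> ~~ P (q i)
    & (forall i, i <= l -> q i \in D) /\
      (forall i j, i <= l -> j <= l -> q i = q j -> i = j)].
Proof.
have [k] := ubnP m; elim: k => // k IH in p m *; rewrite ltnS => mk [pD pe] pP.
have [[i im Pi]|noP] : (exists2 i, i < m & P (p i)) \/ forall i, i < m -> ~~ P (p i).
  have [/existsP[i Pi]|] := boolP [exists i : 'I_m, P (p i)]; first by left; exists i.
  rewrite negb_exists => /forallP h; right=> i im; exact: (h (Ordinal im)).
  apply: (IH p i) => //; first exact: leq_trans mk.
  by split=> [j ji|j ji]; [apply: pD|apply: pe]; lia.
have short i j : i < j -> j <= m -> (e (p i) (p j.+1) && (j < m)) || (p i == p j) ->
    exists q l, [/\ l < m, walk D q l, q 0 = p 0 & q l = p m].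
  move=> ij jm h.

  have [hj|hj] := boolP (p i == p j).
    exists (fun l => if l <= i then p l else p (l + (j - i))), (m - (j - i)); split=> //.
    - lia.
    - split=> l lm; first by case: ifP => ?; apply: pD; lia.
      case: (ltngtP l i) => li; [by apply: pe; lia|by rewrite addSn; apply: pe; lia|].
      by rewrite li (eqP hj) (_ : i.+1 + (j - i) = j.+1); [apply: pe|]; lia.
    - case: leqP => mi; last by congr p; lia.
      have -> : m - (j - i) = i by lia.
      by rewrite (eqP hj); congr p; lia.
  move: h; rewrite (negbTE hj) orbF => /andP[ee jm'].
  exists (fun l => if l <= i then p l else p (l + (j - i))), (m - (j - i)); split=> //.
  - lia.
  - split=> l lm; first by case: ifP => ?; apply: pD; lia.
    case: (ltngtP l i) => li; [by apply: pe; lia|by rewrite addSn; apply: pe; lia|].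
    by rewrite li (_ : i.+1 + (j - i) = j.+1) //; lia.
  - by rewrite ifF; [congr p|]; lia.
have redo q l : l < m -> walk D q l -> q 0 = p 0 -> q l = p m ->
  exists q l, [/\ ipath q l, q 0 = p 0, P (q l),
    forall i, i < l -> ~~ P (q i)
    & (forall i, i <= l -> q i \in D) /\
      (forall i j, i <= l -> j <= l -> q i = q j -> i = j)].
  move=> lm wq q0 ql; have [||q' [l' [h1 h2 h3 h4 h5]]] := IH q l _ wq; rewrite ?ql //.
    exact: leq_trans mk.
  by exists q', l'; rewrite h2.
have [/existsP[i /existsP[j /andP[ij hj]]]|] := boolP [exists i : 'I_m.+1, [exists j : 'I_m.+1,
    (i < j) && ((e (p i) (p j.+1) && (j < m)) || (p i == p j))]].
  have [q [l [lm wq q0 ql]]] := short i j ij (ltn_ord j) hj.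
  exact: redo q0 ql.
rewrite negb_exists => /forallP no.
have no' i j : i < j -> j <= m -> ~~ (e (p i) (p j.+1) && (j < m)) && (p i != p j).
  move=> ij jm; have im : i < m.+1 by lia.
  have := no (Ordinal im); rewrite negb_exists => /forallP/(_ (Ordinal (jm : j < m.+1))).
  by rewrite /= ij /= negb_or.
exists p, m; split=> //.
- suff H i j : i <= j -> j <= m -> e (p i) (p j) = (j == i.+1) || (i == j.+1).
    move=> i j im jm; case: (leqP i j) => ij; first exact: H.
    by rewrite symG H 1?orbC // ltnW.
  move=> ij jm; case: (ltngtP i j) ij => // [ij _|-> _]; last by rewrite irrG; lia.
  have [->|ne] := eqVneq j i.+1; first by rewrite pe //; lia.
  have := no' i j.-1; rewrite prednK; last by lia.
  by case: (e (p i) (p j)) => // /(_ _ _)/andP[]; lia.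
- split=> // i j; wlog ij : i j / i < j => [hw im jm h|].
    by case: (ltngtP i j) => // ij; [apply: hw|apply/esym/hw].
  move=> im jm h; have := no' i j ij jm; rewrite h eqxx andbF; lia.
Qed.

Lemma conn_ipath D (P : pred T) x y : x \in D -> connect (within D) x y -> P y ->
  exists q l, [/\ ipath q l, q 0 = x, P (q l),
    forall i, i < l -> ~~ P (q i)
    & (forall i, i <= l -> q i \in D) /\
      (forall i j, i <= l -> j <= l -> q i = q j -> i = j)].
Proof.
move=> xD /(conn_walk xD)[p [m [wp <- <-]]] Pm.
exact: walk_ipath wp Pm.
Qed.

Definition conn_set (D : {set T}) := [forall x in D, forall y in D, connect (within D) x y].

Lemma conn_setP (D : {set T}) :
  reflect {in D &, forall x y, connect (within D) x y} (conn_set D).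
Proof.
apply: (iffP forall_inP) => [h x y xD yD|h x xD]; first by have /forall_inP := h x xD; apply.
by apply/forall_inP=> y yD; apply: h.
Qed.

Definition nb (D : {set T}) := [set v | (v \notin D) && [exists k in D, e k v]].

Lemma nbP (D : {set T}) v : reflect (v \notin D /\ exists2 k, k \in D & e k v) (v \in nb D).
Proof. by rewrite inE; apply: (iffP andP) => -[vD /exists_inP]. Qed.

Lemma conn_mono (D D' : {set T}) x y : D \subset D' ->
  connect (within D) x y -> connect (within D') x y.
Proof.
move=> /subsetP DD; apply: connect_sub => u v /= /and3P[uD vD uv].
by apply: connect1; rewrite /= !DD.
Qed.

Definition component (D : {set T}) x := [set y in D | connect (within D) x y].

Lemma comp_self D x : x \in D -> x \in component D x.
Proof. by move=> xD; rewrite inE xD connect0. Qed.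

Lemma comp_sub D x : component D x \subset D.
Proof. by apply/subsetP=> y; rewrite inE => /andP[]. Qed.

Lemma comp_closed D x u v : u \in component D x -> v \in D -> e u v -> v \in component D x.
Proof.
rewrite !inE => /andP[uD xu] vD uv; rewrite vD /=.
by apply: connect_trans xu (connect1 _); rewrite /= uD vD.
Qed.

Lemma comp_conn D x : x \in D -> conn_set (component D x).
Proof.
move=> xD; have c y : y \in component D x -> connect (within (component D x)) x y.
  rewrite inE => /andP[yD /(conn_walk xD)[p [m [wp p0 <-]]]].
  rewrite -p0; apply: (@walk_conn _ _ m); last by rewrite leqnn.
  case: wp => pD pe; split=> // i im; rewrite inE pD //=.
  by apply: (@walk_conn _ _ m); [split|].
apply/conn_setP => y z yC zC; apply: connect_trans (c z zC).
by rewrite conn_sym c.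
Qed.

Lemma comp_max (D A : {set T}) x a : conn_set A -> A \subset D -> a \in A ->
  a \in component D x -> A \subset component D x.
Proof.
move=> /conn_setP cA AD aA; rewrite inE => /andP[aD xa]; apply/subsetP=> y yA.
rewrite inE (subsetP AD) //=; apply: connect_trans xa _.
exact: conn_mono AD (cA _ _ aA yA).
Qed.

Lemma conn_closed_sub (A C : {set T}) a : conn_set A -> a \in A -> a \in C ->
  (forall u v, u \in C -> v \in A -> e u v -> v \in C) -> A \subset C.
Proof.
move=> /conn_setP cA aA aC cl; apply/subsetP=> y yA.
exact: conn_closed cl aA aC (cA _ _ aA yA).
Qed.

Definition has_edge (D : {set T}) := [exists x in D, exists y in D, e x y].

Lemma has_edgeP (D : {set T}) :
  reflect (exists x y, [/\ x \in D, y \in D & e x y]) (has_edge D).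
Proof.
apply: (iffP exists_inP) => [[x xD /exists_inP[y yD xy]]|[x [y [xD yD xy]]]].
  by exists x, y.
by exists x => //; apply/exists_inP; exists y.
Qed.

(* [K] and [B] are two components of the complement of their common neighbourhood. *)
Definition full_pair (K B : {set T}) :=
  [&& conn_set K, conn_set B, [disjoint K & B], has_edge K, has_edge B & nb K == nb B].

Lemma full_pairC K B : full_pair K B = full_pair B K.
Proof.
rewrite /full_pair disjoint_sym [nb K == _]eq_sym.
by case: (conn_set K); case: (conn_set B); case: (has_edge K); case: (has_edge B).
Qed.

Lemma full_pair_nadj K B x y : full_pair K B -> x \in K -> y \in B -> (x != y) && ~~ e x y.
Proof.
case/and5P=> _ _ dKB _ /andP[_ /eqP nKB] xK yB.
have yK : y \notin K by rewrite (disjointFl dKB).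
apply/andP; split; first by apply: contraNneq yK => <-.
apply/negP=> xy; have : y \in nb K by apply/nbP; split=> //; exists x.
by rewrite nKB => /nbP[]; rewrite yB.
Qed.

Lemma conn_nbr D x : conn_set D -> has_edge D -> x \in D -> exists2 y, y \in D & e x y.
Proof.
move=> /conn_setP cD /has_edgeP[a [b [aD bD ab]]] xD.
have [ax|ax] := eqVneq x a; first by exists b; rewrite ?ax.
have [p [m [[pD pe] p0 pm]]] := conn_walk xD (cD _ _ xD aD).
case: m pD pe pm => [|m] pD pe pm; first by rewrite -p0 pm eqxx in ax.
by exists (p 1); [apply: pD|rewrite -p0; apply: pe].
Qed.

(** As for minimal separators: the component [B] of [c] outside the closed neighbourhood of [A0] has
    its neighbourhood inside [nb A0]. Removing [nb B] only, the component [A] of [A0] is still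
    separated from [B], and every vertex of [nb B] has a neighbour in [A0]. *)
Lemma full_pair_of_edge (A0 : {set T}) c d : conn_set A0 -> has_edge A0 ->
  c \notin A0 :|: nb A0 -> d \notin A0 :|: nb A0 -> e c d ->
  exists A, [/\ full_pair A (component (~: (A0 :|: nb A0)) c), A0 \subset A,
    d \in component (~: (A0 :|: nb A0)) c & nb (component (~: (A0 :|: nb A0)) c) \subset nb A0].
Proof.
move=> cA0 eA0 cN dN cd; set D := ~: _; set B := component D c.
have cD : c \in D by rewrite inE.
have dD : d \in D by rewrite inE.
have cB : c \in B by exact: comp_self.
have dB : d \in B by apply: comp_closed cB dD cd.
have [a [b [aA0 bA0 ab]]] := has_edgeP _ eA0.
have BD x : x \in B -> (x \notin A0) && (x \notin nb A0).
  by move/(subsetP (comp_sub _ _)); rewrite !inE negb_or.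
have SN : nb B \subset nb A0.
  apply/subsetP=> s /nbP[sB [x xB xs]]; apply/negPn/negP=> sN.
  have [sA0|sA0] := boolP (s \in A0).
    have /andP[xA0] := BD x xB; case/negP; apply/nbP; split=> //.
    by exists s; rewrite 1?symG.
  by case/negP: sB; apply: comp_closed xB _ xs; rewrite inE in_setU negb_or sA0.
pose A := component (~: nb B) a.
have A0S x : x \in A0 -> x \in ~: nb B.
  by move=> xA0; rewrite in_setC; apply/negP => /(subsetP SN)/nbP[]; rewrite xA0.
have aA : a \in A by apply/comp_self/A0S.
have A0A : A0 \subset A by apply: (comp_max cA0 _ aA0 aA); apply/subsetP.
have AB : [disjoint A & B].
  rewrite -setI_eq0; apply/eqP/setP=> y; rewrite in_set0 in_setI; apply/negP=> /andP[].
  rewrite inE => /andP[yS ay] yB.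
  have : a \in B.
    apply: (@conn_closed (~: nb B) B y) => //; last by rewrite conn_sym.
    move=> u v uB vS uv; apply/negPn/negP=> vB; move: vS; rewrite in_setC; case/negP.
    by apply/nbP; split=> //; exists u.
  by move/BD; rewrite aA0.
exists A; split=> //; apply/and5P; split=> //; first by apply/comp_conn/A0S.
- exact: comp_conn.
- apply/has_edgeP; exists a, b; split=> //; exact: (subsetP A0A).
- apply/andP; split; first by apply/has_edgeP; exists c, d.
  rewrite eqEsubset; apply/andP; split; apply/subsetP=> s.
    case/nbP=> sA [x xA xs]; apply/negPn/negP=> sB; case/negP: sA.
    by apply: comp_closed xA _ xs; rewrite in_setC.
  move=> sB; have /nbP[sA0 [x xA0 xs]] := subsetP SN s sB; apply/nbP; split.
    by apply/negP=> /(subsetP (comp_sub _ _)); rewrite in_setC sB.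
  by exists x => //; apply: (subsetP A0A).
Qed.

Lemma nb_adj K s : s \in nb K -> exists2 k, k \in K & e s k.
Proof. by case/nbP=> _ [k kK]; rewrite symG; exists k. Qed.

Lemma pair_conn x y : e x y -> conn_set [set x; y] /\ has_edge [set x; y].
Proof.
move=> xy; split; last first.
  by apply/has_edgeP; exists x, y; rewrite !inE !eqxx orbT.
apply/conn_setP => u v; rewrite !inE => /orP[]/eqP-> /orP[]/eqP-> //; apply: connect1;
  by rewrite /= !inE !eqxx ?orbT //= 1?symG.
Qed.

Lemma nb_pair x y s : s \in nb [set x; y] -> e x s || e y s.
Proof. by case/nbP=> _ [k]; rewrite !inE => /orP[]/eqP->->; rewrite ?orbT. Qed.

(** * Minimal full pairs *)

Definition complete_to K :=
  forall s x, s \in nb K -> x \in K -> part s != part x -> e s x.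

Definition unsplit K := forall a a' b b', a \in K -> a' \in K -> b \in K -> b' \in K ->
  part a -> part a' -> e a b -> e a' b' -> e a b' || e a' b.

(* the two edges form an induced [2K_2] *)
Lemma split_edges a a' b b' : part a -> part a' -> e a b -> e a' b' ->
  ~~ e a b' -> ~~ e a' b ->
  (a' \notin [set a; b] :|: nb [set a; b]) && (b' \notin [set a; b] :|: nb [set a; b]).
Proof.
move=> pa pa' ab ab' nab' nab.
have pb : part b = false by have := bG ab; rewrite pa; case: (part b).
have pb' : part b' = false by have := bG ab'; rewrite pa'; case: (part b').
have na x y : part x = part y -> e x y = false by move=> h; exact: (same_part_nadj h).
apply/andP; split; rewrite !in_setU !in_set1 !negb_or -andbA; apply/and3P; split.
- by apply: contraNneq nab' => <-.
- by apply/eqP=> E; rewrite -E pa' in pb.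
- apply/negP => /nb_pair; rewrite na ?pa ?pa' //= symG; exact/negP.
- by apply/eqP=> E; rewrite E pa in pb'.
- by apply: contraNneq nab => <-.
- apply/negP => /nb_pair; rewrite [e b b']na ?pb ?pb' // orbF; exact/negP.
Qed.

(** An edge [x y] of [K] yields a full pair with first component inside [K], hence equal to [K]. So
    [nb K] is contained in the neighbourhood of [x] and [y], and the sides leave only [x] for
    [s]. *)
Lemma min_complete K B L : full_pair K B -> K \subset L ->
  (forall K1 B1, full_pair K1 B1 -> K1 \subset L -> #|K| <= #|K1|) -> complete_to K.
Proof.
move=> fKB KL mn s x sN xK psx.
have /and5P[cK cB dKB eK /andP[eB /eqP nKB]] := fKB.
have [y yK xy] := conn_nbr cK eK xK.
have [cA eA] := pair_conn xy.
have [c [d [cInB dInB cd]]] := has_edgeP _ eB.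
have BD z : z \in B -> z \notin [set x; y] :|: nb [set x; y].
  move=> zB; have n1 := full_pair_nadj fKB xK zB; have n2 := full_pair_nadj fKB yK zB.
  rewrite in_setU in_set2 !negb_or eq_sym (andP n1).1 eq_sym (andP n2).1 /=.
  by apply/negP => /nb_pair; rewrite (negbTE (andP n1).2) (negbTE (andP n2).2).
have [A [fA A0A dInB1 nbS]] := full_pair_of_edge cA eA (BD c cInB) (BD d dInB) cd.
set D := ~: _ in fA dInB1 nbS; set B1 := component D c in fA dInB1 nbS.
have cD : c \in D by rewrite in_setC BD.
have BB1 : B \subset B1.
  apply: (comp_max cB _ cInB); last exact: comp_self.
  by apply/subsetP=> z zB; rewrite in_setC BD.
have /and5P[cA1 cB1 dAB eA1 /andP[eB1 /eqP nAB]] := fA.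
have NA s' : s' \in nb K -> s' \notin A.
  move=> sN'; have [b bB sb] : exists2 b, b \in B & e s' b by apply: nb_adj; rewrite -nKB.
  have [sB1|sB1] := boolP (s' \in B1).
    by rewrite (disjointFl dAB sB1).
  apply/negP=> sA; have : s' \in nb B1.
    by apply/nbP; split=> //; exists b; rewrite 1?symG //; apply: (subsetP BB1).
  by rewrite -nAB => /nbP[]; rewrite sA.
have xA : x \in A by apply: (subsetP A0A); rewrite !inE eqxx.
have AK : A \subset K.
  apply: (conn_closed_sub cA1 xA xK) => u v uK vA uv; apply/negPn/negP=> vK.
  by move: (NA v); rewrite vA; case/(_ _)/negP => //; apply/nbP; split=> //; exists u.
have AE : A = K.
  by apply/eqP; rewrite eqEcard AK; apply: mn fA _; apply: subset_trans KL.
have : s \in nb [set x; y] by apply: (subsetP nbS); rewrite -nAB AE.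
move/nb_pair; case/orP; rewrite symG // => sy.
by have := bG sy; have := bG xy; move: psx; do 3 case: (part _).
Qed.

(** From an induced 2K_2 in [K], one edge yields a full pair whose first component lies in [K] and
    misses the other edge, against minimality. *)
Lemma min_unsplit K B L : full_pair K B -> K \subset L ->
  (forall K1 B1, full_pair K1 B1 -> K1 \subset L -> #|K| <= #|K1|) -> unsplit K.
Proof.
move=> fKB KL mn a a' b b' aK aK' bK bK' pa pa' ab ab'.
apply/negPn/negP; rewrite negb_or => /andP[nab' nab].
have compl := min_complete fKB KL mn.
have /andP[aN bN] := split_edges pa pa' ab ab' nab' nab.
have [cA eA] := pair_conn ab.
have [A [fA A0A bB1 nbS]] := full_pair_of_edge cA eA aN bN ab'.
set D := ~: _ in fA bB1 nbS; set B1 := component D a' in fA bB1 nbS.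
have aB1 : a' \in B1 by apply: comp_self; rewrite in_setC.
have /and5P[cA1 cB1 dAB eA1 /andP[eB1 /eqP nAB]] := fA.
have pb : part b = false by have := bG ab; rewrite pa; case: (part b).
have pb' : part b' = false by have := bG ab'; rewrite pa'; case: (part b').
have NA s : s \in nb K -> s \notin A.
  move=> sN; have sK : s \notin K by case/nbP: sN.
  have sA0 : s \in nb [set a; b].
    apply/nbP; rewrite !inE negb_or; split.
      by apply/andP; split; apply: contraNneq sK => ->.
    case ps: (part s); [exists b|exists a]; rewrite ?inE ?eqxx ?orbT // symG compl ?ps ?pa ?pb //.
  have [z zB1 sz] : exists2 z, z \in B1 & e s z.
    by case ps: (part s); [exists b'|exists a']; rewrite ?compl ?ps ?pa' ?pb'.
  have sB1 : s \notin B1.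
    by apply/negP=> /(subsetP (comp_sub _ _)); rewrite in_setC in_setU sA0 orbT.
  apply/negP=> sA; have : s \in nb B1 by apply/nbP; split=> //; exists z; rewrite 1?symG.
  by rewrite -nAB => /nbP[]; rewrite sA.
have aA : a \in A by apply: (subsetP A0A); rewrite !inE eqxx.
have AK : A \subset K.
  apply: (conn_closed_sub cA1 aA aK) => u v uK vA uv; apply/negPn/negP=> vK.
  by move: (NA v); rewrite vA; case/(_ _)/negP => //; apply/nbP; split=> //; exists u.
have := mn _ _ fA (subset_trans AK KL); rewrite leqNgt; case/negP.
apply: proper_card; apply/properP; split=> //; exists a' => //.
by rewrite (disjointFl dAB aB1).
Qed.

(** * The common neighbourhood of a full pair *)

Section Attach.
Variables (K B : {set T}).
Hypotheses (fKB : full_pair K B) (compl : complete_to K).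

Let nKB : nb K = nb B. Proof. by case/and5P: fKB => _ _ _ _ /andP[_ /eqP]. Qed.

Let cB : {in B &, forall x y, connect (within B) x y}.
Proof. by case/and5P: fKB => _ /conn_setP. Qed.

Let sB s : s \in nb K -> s \notin B. Proof. by rewrite nKB => /nbP[]. Qed.
Let sK s : s \in nb K -> s \notin K. Proof. by case/nbP. Qed.

Let KB x y : x \in K -> y \in B -> ~~ e x y.
Proof. by move=> xK yB; case/andP: (full_pair_nadj fKB xK yB). Qed.

Lemma side_vertex c : exists2 x, x \in K & part x = c.
Proof.
have /has_edgeP[x [y [xK yK /bG xy]]] : has_edge K by case/and5P: fKB.
by move: xy; case px: (part x); case py: (part y) => // _; case: c;
  [exists x|exists y|exists y|exists x].
Qed.

Lemma square_through s s' : s \in nb K -> s' \in nb K -> part s != part s' ->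
  exists k1 k2, [/\ k1 \in K, k2 \in K, e s k1, e s' k2 & e k2 k1].
Proof.
move=> sN sN' pss; have /has_edgeP[x [y [xK yK xy]]] : has_edge K by case/and5P: fKB.
have pxy := bG xy; have [pys|pys] := boolP (part y == part s).
  by exists x, y; split; rewrite // ?(symG y) // compl //; move: pxy pys pss; do 4 case: (part _).
by exists y, x; split; rewrite // compl //; move: pxy pys pss; do 4 case: (part _).
Qed.

(** With vertices of [K] in front of [s] the path remains induced, and [s'] sees both of its ends;
    this feeds [fan]. *)
Lemma attach_path s s' : s \in nb K -> s' \in nb K ->
  exists p m, [/\ ipath p m, p 0 = s, (p m \in B) && e s' (p m),
    forall i, i < m -> ~~ ((p i \in B) && e s' (p i))
    & forall i, 0 < i <= m -> p i \in B].
Proof.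
move=> sN sN'.
have [b bB sb] : exists2 b, b \in B & e s b by apply: nb_adj; rewrite -nKB.
have [b' bB' sb'] : exists2 b, b \in B & e s' b by apply: nb_adj; rewrite -nKB.
have sD : s \in s |: B by rewrite setU11.
have con : connect (within (s |: B)) s b'.
  apply: (@connect_trans _ _ b).
    by apply: connect1; rewrite /= setU11 in_setU bB orbT sb.
  by apply: conn_mono (cB bB bB'); apply: subsetUr.
have [|p [m [ip p0 Pm noP [pD inj]]]] :=
  conn_ipath sD con (P := [pred y | (y \in B) && e s' y]); first by rewrite /= bB' sb'.
exists p, m; split=> // i /andP[i0 im].
have := pD i im; rewrite in_setU1 => /orP[/eqP E|//].
by have := inj i 0 im (leq0n m); rewrite p0 => /(_ E) h; rewrite h in i0.
Qed.

Lemma ipath_cons p m x : ipath p m -> e x (p 0) ->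
  (forall i, 0 < i <= m -> ~~ e x (p i)) ->
  ipath (fun i => if i is i'.+1 then p i' else x) m.+1.
Proof.
move=> ip xp nx; have h i : i <= m -> e x (p i) = (i == 0).
  by move=> im; case: (posnP i) => [->//|i0]; rewrite (negbTE (nx _ _)) ?i0 //; case: i i0 {im}.
case=> [|i] [|j] im jm.
- by rewrite irrG.
- by rewrite h // eqSS orbF.
- by rewrite symG h // eqSS.
- by rewrite ip // !eqSS.
Qed.

(** One vertex of [K] in front of [s] puts the first vertex of the path in [B] at position 2. *)
Lemma attach_common s s' : s \in nb K -> s' \in nb K -> part s = part s' ->
  exists2 c, c \in B & e s c && e s' c.
Proof.
move=> sN sN' pss; have [p [m [ip p0 /andP[pmB spm] noP pB]]] := attach_path sN sN'.
have m0 : 0 < m by case: (posnP m) pmB => // ->; rewrite p0 (negbTE (sB sN)).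
have [k kK pk] := side_vertex (~~ part s).
have ks : e s k by apply: compl; rewrite // pk; case: (part s).
have ks' : e s' k by apply: compl; rewrite // pk -pss; case: (part s).
have ip' : ipath (fun i => if i is i'.+1 then p i' else k) m.+1.
  by apply: ipath_cons => //; [rewrite p0 symG|move=> i im; apply: KB => //; apply: pB].
have s'p1 : e s' (p 1) by apply: (fan ip' (i := 2)).
exists (p 1); first exact: pB.
by rewrite s'p1 andbT -p0 ip.
Qed.

(** Two vertices of [K] in front put [s] itself at position 2. *)
Lemma attach_adj s s' : s \in nb K -> s' \in nb K -> part s != part s' -> e s s'.
Proof.
move=> sN sN' pss; have [p [m [ip p0 /andP[pmB spm] noP pB]]] := attach_path sN sN'.
have [k1 [k2 [k1K k2K sk1 sk2 k12]]] := square_through sN sN' pss.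
have ip1 : ipath (fun i => if i is i'.+1 then p i' else k1) m.+1.
  by apply: ipath_cons => //; [rewrite p0 symG|move=> i im; apply: KB => //; apply: pB].
have ip2 : ipath (fun i => if i is i'.+1 then (if i' is i''.+1 then p i'' else k1) else k2) m.+2.
  apply: (ipath_cons ip1) => // -[//|[|i]] im.
    by rewrite p0 (same_part_nadj (common_part k12 sk1)).
  by apply: KB => //; apply: pB.
have : e s' (p 0) by apply: (fan ip2 (i := 2)).
by rewrite p0 symG.
Qed.

Lemma attach_square s s' : s \in nb K -> s' \in nb K -> part s != part s' ->
  exists c1 c2, [/\ c1 \in B, c2 \in B, e s c1, e s' c2 & e c1 c2].
Proof.
move=> sN sN' pss; have [p [m [ip p0 /andP[pmB spm] noP pB]]] := attach_path sN sN'.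
have m0 : 0 < m by case: (posnP m) pmB => // ->; rewrite p0 (negbTE (sB sN)).
have s'p0 : e s' (p 0) by rewrite p0 symG attach_adj.
have om : ~~ odd m.
  have := bG spm; rewrite (ipath_part ip (leqnn m)) p0.
  by move: pss; do 2 case: (part _); case: (odd m).
have m2 : 2 <= m by case: (m) m0 om => [|[|]].
have sp2 : e s' (p 2) by apply: (fan ip (i := 2)).
by exists (p 1), (p 2); split=> //; [apply: pB|apply: pB|rewrite -p0 ip|rewrite ip // ltnW].
Qed.

(** The edge lies in a square through [K] and in one through [B], so it is the middle edge of
    [D]. *)
Lemma attach_pos s s' : s \in nb K -> s' \in nb K -> part s != part s' -> ~~ n s s'.
Proof.
move=> sN sN' pss; have [c1 [c2 [c1B c2B sc1 sc2 c12]]] := attach_square sN sN' pss.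
have [k1 [k2 [k1K k2K sk1 sk2 k12]]] := square_through sN sN' pss.
apply: (no_D (a1 := k2) (b1 := k1) (a3 := c2) (b3 := c1)) => //; try by rewrite symG.
  exact: KB.
by rewrite symG KB.
Qed.

Lemma min_tadpole : unsplit K ->
  (forall a b, a \in K -> b \in K -> e a b -> exists p q, obstructing G a b p q) ->
  exists2 x, x \in nb K & Tad (mem K) x.
Proof.
move=> uns obs; have /has_edgeP[x0 [y0 [x0K _ _]]] : has_edge K by case/and5P: fKB.
have /and5P[cK _ _ eK _] := fKB.
apply: (base_tadpole x0K) => // [x xK|x y xK xy|x xK|s s' sN sN' pss|].
- exact: conn_nbr.
- by have [//|yK] := boolP (y \in K); apply/nbP; split=> //; exists x.
- by apply/negP=> /nbP[]; rewrite xK.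
- by rewrite attach_adj // attach_pos.
(* The non-edge of [F5] joins a common neighbour [w] of [b], [b'] in [K] with a common neighbour [c]
   of [s], [s'] in [B]. *)
move=> s s' b b' sN sN' ss bK bK' bb pss nsb; apply/negP=> nsb'.
have [c cInB /andP[sc sc']] := attach_common sN sN' pss.
have [esb esb'] := (neg_adj nsb, neg_adj nsb').
have [w wK /andP[wb wb']] : exists2 w, w \in K & e w b && e w b'.
  have [w wK bw] := conn_nbr cK eK bK; have [w' wK' bw'] := conn_nbr cK eK bK'.
  have pbb : part b = part b' by have := bG esb; have := bG esb'; rewrite pss; do 3 case: (part _).
  case pb: (part b).
    have pb' : part b' by rewrite -pbb.
    have := uns b b' w w' bK bK' wK wK' pb pb' bw bw'.
    case/orP=> h; [exists w'|exists w] => //; by rewrite symG ?h ?bw //= symG ?bw' ?h.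
  have pw : part w by have := bG bw; rewrite pb; case: (part w).
  have pw' : part w' by have := bG bw'; rewrite -pbb pb; case: (part w').
  rewrite symG in bw; rewrite symG in bw'.
  have := uns w w' b b' wK wK' bK bK' pw pw' bw bw'.
  by case/orP=> h; [exists w|exists w'] => //; rewrite ?bw ?h ?bw'.
have esb2 : e s b' by apply: compl => //; rewrite pss bG.
have esb3 : e s' b by apply: compl => //; rewrite -pss bG.
move: nsb'; apply/negP.
by apply: (no_F5 (a1 := w) (a2 := s) (b1 := b) (b3 := c)) => //; exact: KB.
Qed.

End Attach.

(** * Tadpoles on both sides *)

Lemma tad_ext two k t t' : (forall i, i < k + 3 -> t i = t' i) -> tad G two k t -> tad G two k t'.
Proof.
move=> tE [va inj ad ng]; split=> // i j ik jk; rewrite -!tE //.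
- exact: inj.
- exact: ad.
- exact: ng.
Qed.

(** The path [r] leaves from the end [t 0 = r 0] and is read backwards, so the new end is [r m]; the
    shared vertex is taken from [t]. *)
Definition prepend (r : nat -> T) m t i := if i < m then r (m - i) else t (i - m).

Lemma tad_prepend two k t r m : tad G two k t -> ipath r m -> r 0 = t 0 ->
  (forall i j, i <= m -> j <= m -> r i = r j -> i = j) ->
  (forall i j, 0 < i <= m -> 0 < j < k + 3 -> r i <> t j /\ ~~ e (r i) (t j)) ->
  tad G two (k + m) (prepend r m t).
Proof.
move=> tt; elim: m => [|m IH] ip r0 inj cr.
  by rewrite addn0; apply: tad_ext tt => i ik; rewrite /prepend subn0.
have tm : tad G two (k + m) (prepend r m t).
  apply: IH => // [i j im jm|i j im jm|i j im jk].
  - by apply: ip; nlia.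
  - by apply: inj; nlia.
  - by apply: cr; nlia.
have pE j : 0 < j < k + m + 3 ->
    (exists2 i, i < m & prepend r m t j = r i) \/
    (exists2 i, 0 < i < k + 3 & prepend r m t j = t i).
  move=> jk; rewrite /prepend; case: ltnP => jm; first by left; exists (m - j) => //; nlia.
  have [jE|jm'] := eqVneq j m.
    by left; exists 0; [case/andP: jk; rewrite jE|rewrite jE subnn r0].
  by right; exists (j - m) => //; nlia.
have p0 : prepend r m t 0 = r m.
  by rewrite /prepend; case: ltnP => m0; [rewrite subn0|rewrite sub0n -r0; congr r; nlia].
rewrite addnS; apply: (@tad_ext _ _ (fun i => if i is i'.+1 then prepend r m t i' else r m.+1)).
  case=> [|i] ik; first by rewrite /prepend subn0.
  by rewrite /prepend ltnS !subSS.
apply: (tad_cons tm) => [|j jk|j jk].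
- by rewrite p0 ip ?eqxx ?orbT //; nlia.
- have [[i im ->]|[i ik ->]] := pE j jk.
    by rewrite ip; nlia.
  by case: (cr m.+1 i) => //; nlia.
- have [->|j0] := posnP j; first by rewrite p0 => /inj; nlia.
  have [|[i im ->]|[i ik ->]] := pE j; first by rewrite j0.
    by move/inj; nlia.
  by case: (cr m.+1 i) => //; nlia.
Qed.

Lemma prependE two k t r m i : tad G two k t -> r 0 = t 0 -> i < k + m + 3 ->
  (exists l, [/\ l <= m, prepend r m t i = r l & i = m - l]) \/
  (exists2 l, 0 < l < k + 3 & prepend r m t i = t l /\ i = m + l).
Proof.
move=> tt r0 ik; rewrite /prepend; case: ltnP => im.
  by left; exists (m - i); split=> //; nlia.
have [->|ne] := eqVneq i m; first by left; exists 0; rewrite subnn subn0 r0.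
by right; exists (i - m); [|split=> //]; nlia.
Qed.

Lemma ipath_ext p q m : (forall i, i <= m -> p i = q i) -> ipath p m -> ipath q m.
Proof. by move=> pq ip i j im jm; rewrite -!pq // ip. Qed.

(** All vertices except the end, not only the three heads. *)
Definition heads k (t : nat -> T) : {set T} := [set y | [exists j : 'I_(k + 3), (0 < j) && (y == t j)]].

Lemma headsP k t y : reflect (exists2 j, 0 < j < k + 3 & y = t j) (y \in heads k t).
Proof.
rewrite inE; apply: (iffP existsP) => [[j /andP[j0 /eqP->]]|[j /andP[j0 jk] ->]].
  by exists j; rewrite // j0 ltn_ord.
by exists (Ordinal jk); rewrite /= j0 eqxx.
Qed.

Lemma heads_conn two k t y z : tad G two k t -> y \in heads k t -> z \in heads k t ->
  connect (within (heads k t)) y z.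
Proof.
move=> tt; have [va _ ad _] := tt; have k0 := tad_gt0 va.
have step i j : 0 < i < k + 3 -> 0 < j < k + 3 -> tadj two k i j ->
    connect (within (heads k t)) (t i) (t j).
  move=> ik jk ij; apply: connect1; rewrite /= ad; [|nlia|nlia].
  by rewrite ij andbT; apply/andP; split; apply/headsP; [exists i|exists j].
have toy j : 0 < j < k + 3 -> connect (within (heads k t)) (t j) (t k.+1).
  have wy : connect (within (heads k t)) (t k) (t k.+1).
    by apply: step; [nlia|nlia|rewrite /tadj /tarc; bgoal].
  have xs i : 0 < k - i -> i < k -> 0 < i -> connect (within (heads k t)) (t (k - i)) (t k.+1).
    elim: i => // i IH ik ik' _; have [->|i0] := posnP i.
      apply: step; [nlia|nlia|].
      have -> : k - 1 = k.-1 by nlia.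
      by clear -k0; rewrite /tadj /tarc; bgoal.
    apply: connect_trans (IH _ _ i0); [|nlia|nlia].
    apply: step; [nlia|nlia|].
    have -> : k - i = (k - i.+1).+1 by nlia.
    have h : (k - i.+1).+1 < k by nlia.
    by rewrite /tadj /tarc eqxx h.
  move=> jk; have [jk'|kj] := ltnP j k.
    have -> : j = k - (k - j) by nlia.
    by apply: xs; nlia.
  have [->//|n1] := eqVneq j k; have [->//|n2] := eqVneq j k.+1.
  have -> : j = k.+2 by nlia.
  apply: connect_trans wy; apply: step; [nlia|nlia|].
  by clear; rewrite /tadj /tarc; bgoal.
move=> /headsP[i ik ->] /headsP[j jk ->].
by apply: connect_trans (toy i ik) _; rewrite (conn_sym) toy.
Qed.

Section Pair.
Variables (K B : {set T}).
Hypotheses (fKB : full_pair K B) (compl : complete_to K).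

Let KB x y : x \in K -> y \in B -> x <> y /\ ~~ e x y.
Proof. by move=> xK yB; case/andP: (full_pair_nadj fKB xK yB) => /eqP. Qed.

Let sB s : s \in nb K -> s \notin B.
Proof. by case/and5P: fKB => _ _ _ _ /andP[_ /eqP->] /nbP[]. Qed.
Let sK s : s \in nb K -> s \notin K. Proof. by case/nbP. Qed.

(** If [x] or [v] were the end of tadpoles on both sides, there would be a sum. This excludes the
    first alternative of [tad_vs_vertex] for [v] against [t] and for [z] against [t'], and the
    second one supplies the edges of a join. *)
Lemma tadpoles_meet x v : x \in nb K -> Tad (mem K) x ->
  v \in nb K -> ~ Tad (mem B) v.
Proof.
move=> xN [two1 [k1 [t [tt t0 tK]]]] vN [two2 [k2 [t' [tt' t0' tB]]]].
have [va1 inj1 ad1 ng1] := tt; have [va2 inj2 ad2 ng2] := tt'.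
have k10 := tad_gt0 va1; have k20 := tad_gt0 va2.
have noTv : ~ Tad (mem K) v.
  move=> [two [k [u [tu u0 uK]]]].
  apply: (no_sum tu tt'); first by rewrite u0 t0'.
  by move=> i j ik jk; apply: KB; [apply: uK|apply: tB].
have noTx : ~ Tad (mem B) x.
  move=> [two [k [u [tu u0 uB]]]].
  apply: (no_sum tt tu); first by rewrite u0 t0.
  by move=> i j ik jk; apply: KB; [apply: tK|apply: uB].
have xv : x <> v.
  by move=> xv; apply: noTv; rewrite -xv; exists two1, k1, t.
have vt i : i < k1 + 3 -> v <> t i.
  case: (posnP i) => [->|i0] ik; first by rewrite t0 => /esym.
  move=> E; have := sK vN; rewrite E => /negP; apply; apply: tK; nlia.
have xt' i : i < k2 + 3 -> x <> t' i.
  case: (posnP i) => [->|i0] ik; first by rewrite t0'.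
  move=> E; have := sB xN; rewrite E => /negP; apply; apply: tB; nlia.
have [complv posv] : (forall j, j < k1 + 3 -> part v != part (t j) -> e v (t j)) /\
    (forall j, j < k1 + 3 -> n v (t j) -> [&& ~~ two1, k1 == 1 & j == k1]).
  have M : exists2 j, 0 < j < k1 + 3 & e v (t j).
    have [j jk js] := tad_side_ex (part v (+) part x) k10.
    exists j => //; apply: compl => //; first exact: tK.
    rewrite (tad_part bG tt) ?t0; last by case/andP: jk.
    by move: js; do 2 case: (part _); case: (tad_side _ _).
  (* The path from [v] to [x] required by [tad_vs_vertex] runs through [B], with one or two inner
     vertices according to the sides. *)
  have [pxv|pxv] := boolP (part x == part v).
    have [c cInB /andP[xc vc]] := attach_common fKB compl xN vN (eqP pxv).
    case: (tad_vs_vertex (D := mem K) (s := 1) (c := fun=> c) tt vt tK isT isT vc _ _ M) => [||/noTv//|//].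
    - by move=> [|[|i]] [|[|j]] // _ _ /=; rewrite ?irrG ?subnn ?t0 // symG.
    - by move=> i j _ jk; rewrite symG; case: (KB (tK j jk) cInB).
  have [c1 [c2 [c1B c2B xc1 vc2 c12]]] := attach_square fKB compl xN vN pxv.
  have xc2 : e x c2 = false.
    by apply: (same_part_nadj); have := bG xc1; have := bG c12; do 3 case: (part _).
  case: (tad_vs_vertex (D := mem K) (s := 2) (c := fun i => if i == 0 then c2 else c1) tt vt tK isT isT vc2 _ _ M) => [||/noTv//|//].
  - by move=> [|[|[|i]]] [|[|[|j]]] // _ _ /=; rewrite ?irrG ?subnn ?t0 ?c12 ?xc1 ?xc2 // symG ?c12 ?xc1 ?xc2.
  - by move=> i j _ jk; rewrite symG; case: ifP => _; [case: (KB (tK j jk) c2B)|case: (KB (tK j jk) c1B)].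
pose M := heads k2 t'.
have MB y : y \in M -> y \in B by case/headsP=> j jk ->; exact: tB.
pose P y := [exists z in M, e y z].
have PP y : reflect (exists2 z, z \in M & e y z) (P y) by exact: exists_inP.
have MP y : y \in M -> P y.
  case/headsP=> j jk ->; have [p pk jp] : exists2 p, 0 < p < k2 + 3 & tadj two2 k2 j p.
    by apply: tadj_gt0 => //; nlia.
  apply/PP; exists (t' p); last by rewrite ad2; [|nlia|nlia].
  by apply/headsP; exists p.
have t1M : t' 1 \in M by apply/headsP; exists 1; rewrite // addn3.
(* The path stops at the first vertex with a neighbour in [M]; if this is [x] itself, then
   [m = 0]. *)
have [r [m [ipr r0 Prm noP [rD rinj]]]] : exists r m, [/\ ipath r m, r 0 = x, P (r m),
    forall i, i < m -> ~~ P (r i)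
    & (forall i, i <= m -> r i \in x |: B) /\
      (forall i j, i <= m -> j <= m -> r i = r j -> i = j)].
  have [b bB xb] : exists2 b, b \in B & e x b.
    by apply: (nb_adj); case/and5P: fKB => _ _ _ _ /andP[_ /eqP <-].
  apply: (conn_ipath (y := t' 1)); [exact: setU11| |exact: MP].
  apply: (@connect_trans _ _ b).
    by apply: connect1; rewrite /= setU11 in_setU bB orbT xb.
  apply: (conn_mono (D := B)); first exact: subsetUr.
  by case/and5P: fKB => _ /conn_setP cB _ _ _; apply: cB => //; apply: MB.
have rB i : 0 < i <= m -> r i \in B.
  move=> /andP[i0 im]; have := rD i im; rewrite in_setU1 => /orP[/eqP E|//].
  by have := rinj i 0 im (leq0n m); rewrite r0 => /(_ E) h; rewrite h in i0.
have rM i y : i < m -> y \in M -> ~~ e (r i) y.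
  by move=> im yM; apply: contra (noP i im) => h; apply/PP; exists y.
have rMne i y : i <= m -> y \in M -> r i <> y.
  move=> im yM E; have := MP y yM; rewrite -E => Pi.
  have im' : i = m.
    by apply/eqP; rewrite eqn_leq im leqNgt; apply/negP=> /noP; rewrite Pi.
  case: (posnP m) => m0; first by have := MB y yM; rewrite -E im' m0 r0 (negbTE (sB xN)).
  have h : m.-1 < m by nlia.
  by have := rM _ y h yM; rewrite -E im' ipr ?prednK ?eqxx //; nlia.
have vr i : i <= m -> v <> r i.
  move=> im E; have := rD i im; rewrite -E in_setU1 (negbTE (sB vN)) orbF.
  by move/eqP => /esym.
(* The [o] vertices of [K] in front of [r] begin at a neighbour of [v], so the even positions are
   those opposite to [v]. *)
have [o [kk [o0 o2 kkK ipk vk]]] : exists o kk, [/\ 0 < o, o <= 2,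
    forall i, i < o -> kk i \in K,
    ipath (fun i => if i < o then kk i else r (i - o)) (o + m) & e v (kk 0)].
  have rK y i : y \in K -> 0 < i <= m -> ~~ e y (r i).
    by move=> yK im; case: (KB yK (rB i im)).
  have [pxv|pxv] := boolP (part x == part v).
    have [k kK pk] := side_vertex fKB (~~ part v).
    have kx : e x k by apply: compl; rewrite // pk (eqP pxv); case: (part v).
    have kv : e v k by apply: compl; rewrite // pk; case: (part v).
    exists 1, (fun=> k); split=> //.
    apply: (@ipath_ext (fun i => if i is i'.+1 then r i' else k)); last first.
      by apply: (ipath_cons ipr) => [|i im]; [rewrite r0 symG|exact: rK].
    by case=> // i _; rewrite /= subn1.
  have [w1 [w2 [k1K k2K xk1 vk2 k12]]] := square_through fKB compl xN vN pxv.
  have ip1 : ipath (fun i => if i is i'.+1 then r i' else w1) m.+1.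
    by apply: (ipath_cons ipr) => [|i im]; [rewrite r0 symG|exact: rK].
  exists 2, (fun i => if i == 0 then w2 else w1); split=> //; first by move=> [|[|i]].
  apply: (@ipath_ext (fun i => if i is i'.+1 then (if i' is i''.+1 then r i'' else w1) else w2)).
    by case=> [|[|i]] // _; rewrite /= subSS subn1.
  apply: (ipath_cons ip1) => // -[//|[|i]] im; last exact: rK.
  by rewrite r0 (same_part_nadj (common_part k12 xk1)).
set rr := fun i => if i < o then kk i else r (i - o) in ipk.
have rrk i : i < o -> rr i = kk i by rewrite /rr => ->.
have rrr i : rr (o + i) = r i by rewrite /rr ifF ?addKn //; nlia.
have vrr0 : e v (rr 0) by rewrite rrk.
pose z := r m.
have zE : z = rr (o + m) by rewrite rrr.
have rrM i y : i < o + m -> y \in M -> ~~ e (rr i) y.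
  move=> im yM; have [io|oi] := ltnP i o.
    by rewrite rrk //; case: (KB (kkK i io) (MB y yM)).
  by rewrite -(subnKC oi) rrr; apply: rM => //; nlia.
have rrpart i : i <= o + m -> part v = part (rr i) (+) ~~ odd i.
  move=> im; rewrite (ipath_part ipk im); have := bG vrr0.
  by do 2 case: (part _); case: (odd i).
(* The path is continued from [z] through [M] to a neighbour of [v], so that [fan] applies. *)
have vrr i : i <= o + m -> ~~ odd i -> e v (rr i).
  move=> im oi.
  have [j /andP[j0 jk] vj] := tadj_gt0 va2 (ltn_addl k2 (isT : 0 < 3)).
  have jM : t' j \in M by apply/headsP; exists j; rewrite ?j0.
  have vj' : e v (t' j) by rewrite -t0' ad2 //; nlia.
  have [y1 y1M zy1] := PP _ Prm.
  have con : connect (within (z |: M)) z (t' j).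
    apply: (@connect_trans _ _ y1).
      by apply: connect1; rewrite /= setU11 in_setU y1M orbT.
    by apply: conn_mono (heads_conn tt' y1M jM); apply: subsetUr.
  have [q [l [ipq q0 vql _ [qD qinj]]]] := conn_ipath (P := e v) (setU11 _ _) con vj'.
  have qM a : 0 < a <= l -> q a \in M.
    move=> /andP[a0 al]; have := qD a al; rewrite in_setU1 => /orP[/eqP E|//].
    by have := qinj a 0 al (leq0n l); rewrite q0 => /(_ E) h; rewrite h in a0.
  pose R a := if a <= o + m then rr a else q (a - (o + m)).
  have Rq a : R (o + m + a) = q a.
    rewrite /R; case: leqP => h; last by rewrite addKn.
    by have -> : a = 0 by [nlia]; rewrite addn0 q0 zE.
  have ipR : ipath R (o + m + l).
    move=> a b; wlog ab : a b / a <= b => [hw al bl|al bl].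
      by case: (leqP a b) => ab; [apply: hw|rewrite symG hw // 1?orbC //; nlia].
    have [bm|mb] := leqP b (o + m).
      by rewrite /R bm (leq_trans ab bm) ipk // (leq_trans ab bm).
    have [am|ma] := ltnP a (o + m).
      have -> : R a = rr a by rewrite /R ifT // ltnW.
      rewrite -(subnKC (ltnW mb)) Rq (negbTE (rrM _ _ am _)); last by apply: qM; nlia.
      by apply/esym/negP => h; nlia.
    rewrite -(subnKC ma) -(subnKC (ltnW mb)) !Rq ipq; [|nlia|nlia].
    by rewrite -!addnS !eqn_add2l.
  have -> : rr i = R i by rewrite /R im.
  apply: (fan ipR) => //; last by nlia.
  by rewrite Rq.
have zt' i : i < k2 + 3 -> z <> t' i.
  have [->|i0] := posnP i; first by rewrite t0' => _ /esym; apply: vr.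
  by move=> ik; apply: rMne => //; apply/headsP; exists i; rewrite ?i0.
have t'M i : 0 < i < k2 + 3 -> t' i \in M by move=> ik; apply/headsP; exists i.
have zM : exists2 j, 0 < j < k2 + 3 & e z (t' j).
  by have [y /headsP[j jk ->] zy] := PP _ Prm; exists j.
(* Such a tadpole, prolonged along [r] back to [x], contradicts [noTx]. *)
have noTz : ~ Tad (mem M) z.
  move=> [two [k [u [tu u0 uM]]]]; apply: noTx.
  pose r' i := r (m - i).
  have ipr' : ipath r' m.
    move=> i j im jm; rewrite /r' ipr; [|nlia|nlia].
    by apply/idP/idP => h; nlia.
  have r'0 : r' 0 = u 0 by rewrite /r' subn0 u0.
  exists two, (k + m), (prepend r' m u); split.
  - apply: (tad_prepend tu) => // [i j im jm /rinj h|i j im jk].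
      by have : m - i = m - j by [apply: h; nlia]; nlia.
    by split; [apply: rMne; [nlia|exact: uM]|apply: rM; [nlia|exact: uM]].
  - rewrite /prepend; case: ltnP => m0; first by rewrite subn0 /r' subnn.
    by rewrite -r'0 /r'; rewrite -r0; congr r; nlia.
  - move=> i ik; have [|[l [lm -> iE]]|[l lk [-> _]]] := prependE (r := r') (m := m) (i := i) tu r'0.
    + by nlia.
    + by apply: rB; nlia.
    + exact/MB/uM.
have odd_z : (part v != part z) = ~~ odd (o + m).
  by rewrite (rrpart (o + m)) // -zE; case: (part z); case: (odd _).
have [complz posz] : (forall j, j < k2 + 3 -> part z != part (t' j) -> e z (t' j)) /\
    (forall j, j < k2 + 3 -> n z (t' j) -> [&& ~~ two2, k2 == 1 & j == k2]).
  (* Going back from [z] by [s] steps reaches an even position, that is, a neighbour of [v]. *)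
  pose s := if odd (o + m) then 1 else 2.
  have som : s <= o + m by rewrite /s; case: (boolP (odd (o + m))) => h; nlia.
  have zc : e z (rr (o + m - 1 - 0)) by rewrite zE ipk; [apply/orP; right|..]; nlia.
  case: (tad_vs_vertex (D := mem M) (s := s) (c := fun i => rr (o + m - 1 - i)) tt' zt' t'M _ _ zc _ _ zM) => [||||/noTz//|//].
  - by rewrite /s; case: ifP.
  - by rewrite /s; case: ifP.
  - rewrite /s; case: (boolP (odd (o + m))) => om i j.
      have ev : e v (rr (o + m - 1)) by apply: vrr; nlia.
      by case: i j => [|[|i]] [|[|j]] // _ _ /=; rewrite ?irrG ?subnn ?t0' ?subn0 ?ev // symG.
    have ev : e v (rr (o + m - 1 - 1)) by apply: vrr; nlia.
    have e01 : e (rr (o + m - 1)) (rr (o + m - 1 - 1)) by rewrite ipk; [apply/orP; right|..]; nlia.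
    have nev : e v (rr (o + m - 1)) = false.
      have ok : odd (o + m - 1) by nlia.
      by apply: (same_part_nadj); rewrite (rrpart (o + m - 1)) ?ok ?addbF //; nlia.
    by case: i j => [|[|[|i]]] [|[|[|j]]] // _ _ /=;
      rewrite ?irrG ?subnn ?t0' ?subn0 ?ev ?e01 ?nev // symG ?ev ?e01 ?nev.
  - by move=> i j si jk; apply: rrM; [nlia|exact: t'M].
(* One or two vertices of [M] beyond [z] keep [r l] away from the end of the path, as [fan_pos]
   demands. *)
have vrpos l : 0 < l <= m -> ~~ n v (r l).
  move=> /andP[l0 lm]; apply/negP=> nl.
  have ol : ~~ odd (o + l).
    have := bG (neg_adj nl); rewrite -rrr (rrpart (o + l)); last by nlia.
    by case: (part _); case: (odd _).
  have [j jk vj] := tadj_gt0 va2 (ltn_addl k2 (isT : 0 < 3)).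
  have [j0 jk'] := andP jk.
  have vj' : e v (t' j) by rewrite -t0' ad2 //; nlia.
  have rrN i : i < o + m -> forall a, 0 < a < k2 + 3 -> ~~ e (rr i) (t' a).
    by move=> im a ak; apply: rrM => //; exact: t'M.
  have [oz|oz] := boolP (odd (o + m)).
    have zj : e z (t' j).
      apply: complz => //; have := bG vj'; have := odd_z; rewrite oz /=.
      by do 3 case: (part _).
    have ip1 := ipath_rcons ipk (etrans (congr1 (fun y => e y _) (esym zE)) zj) (fun i im => rrN i im _ jk).
    have := fan_pos (v := v) (i := o + l) ip1; rewrite /= ltnn leq_add2l lm rrr nl.
    by move=> /(_ vrr0 vj' ol _ _)/negP; apply => //; nlia.
  have [j1 j1k jj1] := tadj_gt0 va2 jk'.
  have [j10 j1k'] := andP j1k.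
  have ejj1 : e (t' j) (t' j1) by rewrite ad2.
  have zj1 : e z (t' j1).
    apply: complz => //; have := bG vj'; have := bG ejj1; have := odd_z; rewrite (negbTE oz) /=.
    by do 4 case: (part _).
  have nzj : ~~ e z (t' j).
    rewrite (same_part_nadj) //; have := bG vj'; have := odd_z; rewrite (negbTE oz) /=.
    by do 3 case: (part _).
  have ip1 := ipath_rcons ipk (etrans (congr1 (fun y => e y _) (esym zE)) zj1) (fun i im => rrN i im _ j1k).
  have ip2 : ipath (fun i => if i <= (o + m).+1 then (if i <= o + m then rr i else t' j1)
      else t' j) (o + m).+2.
    apply: (ipath_rcons ip1) => [|i im]; first by rewrite ltnn symG.
    have [im'|im'] := ltnP i (o + m); first by rewrite ltnW //; exact: rrN.
    have -> : i = o + m by nlia.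
    by rewrite leqnn -zE.
  set f := fun i => _ in ip2.
  have E : f (o + l) = r l by rewrite /f ifT ?ifT ?rrr //; nlia.
  have fm : f (o + m).+2 = t' j by rewrite /f ltnn.
  move: nl; rewrite -E; apply/negP.
  by apply: (fan_pos ip2); rewrite ?fm //; nlia.
(* the join of [t], prolonged by [r], and of [t'] *)
have r0t : r 0 = t 0 by rewrite r0.
have rt i j : 0 < i <= m -> 0 < j < k1 + 3 -> r i <> t j /\ ~~ e (r i) (t j).
  by move=> im jk; have [ne na] := KB (tK j jk) (rB i im); split; [exact: nesym|rewrite symG].
have tT := tad_prepend tt ipr r0t rinj rt.
have TE i (ik : i < k1 + m + 3) := prependE (r := r) (m := m) tt r0t ik.
have T0 : prepend r m t 0 = z.
  rewrite /prepend; case: ltnP => m0; first by rewrite subn0.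
  by rewrite -r0t /z; congr r; nlia.
have xpos : ~~ n v x.
  have [pxv|pxv] := boolP (part v != part x); first exact: (attach_pos fKB compl).
  by apply: contra pxv => /(neg_adj)/bG.
apply: (no_join tT tt').
- move=> i j ik jk; have [[l [lm -> _]]|[l lk [-> _]]] := TE i ik.
    have [->|j0] := posnP j; first by rewrite t0' => /esym; apply: vr.
    by apply: rMne => //; apply: t'M; rewrite j0.
  have [->|j0] := posnP j; first by rewrite t0' => /esym; apply: vt; nlia.
  by case: (KB (tK l lk) (MB _ (t'M j _))); rewrite // j0.
- move=> i j /andP[i0 ik] jk; have [[l [lm -> iE]]|[l lk [-> _]]] := TE i ik.
    by apply: rM; [nlia|exact: t'M].
  by case: (KB (tK l lk) (MB _ (t'M j jk))).
- by rewrite T0.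
- move=> i ik; rewrite t0' symG; have [[l [lm -> _]]|[l lk [-> _]]] := TE i ik.
    rewrite eq_sym -rrr (rrpart (o + l)) => [h|]; last by nlia.
    by apply: vrr; [nlia|move: h; case: (part _); case: (odd _)].
  by rewrite eq_sym; apply: complv; case/andP: lk.
- move=> j jk; rewrite T0 t0' => nj; have h := posz j jk nj; rewrite h andbT.
  have [_ /eqP k21 /eqP jE] := and3P h.
  have := bG (neg_adj nj); rewrite (tad_part bG tt') // t0' jE k21.
  by rewrite /tad_side /= addbF.
- move=> i ik; rewrite t0' T0 symnG; have [[l [lm -> _]]|[l lk [-> iE]]] := TE i ik.
    have [->|l0] := posnP l; first by rewrite r0 (negbTE xpos).
    by rewrite (negbTE (vrpos _ _)) // l0.
  move=> nl; have lk' := proj2 (andP lk); have h := posv l lk' nl.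
  have [tw1 /eqP k11 /eqP lE] := and3P h.
  have [m0|m0] := posnP m.
    rewrite iE k11 lE k11 m0 tw1 /= !andbT /z m0 r0.
    have := bG (neg_adj nl); rewrite (tad_part bG tt) // t0 lE k11 /tad_side /= addbF.
    by rewrite eq_sym.
  exfalso; have va1' := va1; move: k10 lk' lE nl; rewrite k11 => _ _ -> nl.
  have two1F : two1 = false by apply/negbTE.
  have in4 a : a < 4 -> a < k1 + 3 by rewrite k11.
  have tA a b : a < 4 -> b < 4 -> e (t a) (t b) = tadj false 1 a b.
    by move=> a4 b4; rewrite ad1 ?in4 // two1F k11.
  have tN a b : a < 4 -> b < 4 -> tneg false 1 a b -> n (t a) (t b).
    by move=> a4 b4 ab; apply: ng1; rewrite ?in4 // two1F k11.
  have tne a b : a < 4 -> b < 4 -> a != b -> t a != t b.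
    by move=> a4 b4; apply: contraNneq => /inj1 E; apply/eqP/E; rewrite in4.
  have vx : e v (t 0).
    rewrite t0; apply: (attach_adj fKB compl) => //.
    by have := bG (neg_adj nl); rewrite (tad_part bG tt) ?k11 // t0 /tad_side /= addbF.
  have [two [k [u [tu u0 uK]]]] : Tad [pred y | (y \in K) || (y == x)] v.
    apply: (@Tad2 _ v (t 0) (t 1) (t 2) (t 3)); rewrite ?inE ?t0 ?eqxx ?orbT //.
    - by rewrite [t 1 \in K]tK // k11.
    - by rewrite [t 2 \in K]tK // k11.
    - by rewrite [t 3 \in K]tK // k11.
    - by rewrite -t0 tne.
    - by rewrite tne.
    - by apply/eqP/vt; rewrite in4.
    - by apply/eqP/vt; rewrite in4.
    - by rewrite -t0.
    - by rewrite -t0 tN.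
    - by rewrite -t0 tN.
    - by rewrite tA.
    - by rewrite tA.
  apply: (no_sum tu tt'); first by rewrite u0 t0'.
  move=> a b ak bk; have := uK a ak; rewrite inE => /orP[uaK|/eqP->].
    exact: KB uaK (MB _ (t'M b bk)).
  by split; [apply: xt'; case/andP: bk|rewrite -r0; apply: rM => //; exact: t'M].
Qed.

End Pair.

(** * The tadpole of the other component, and the simplicial edge *)

Lemma min_full_pair K B L : full_pair K B -> K \subset L ->
  exists K0 B0, [/\ full_pair K0 B0, K0 \subset L &
    forall K1 B1, full_pair K1 B1 -> K1 \subset L -> #|K0| <= #|K1|].
Proof.
move=> fKB KL; pose P (p : {set T} * {set T}) := full_pair p.1 p.2 && (p.1 \subset L).
have PKB : P (K, B) by rewrite /P fKB.
case: (arg_minnP (fun p : {set T} * {set T} => #|p.1|) PKB) => -[K0 B0] /andP[/= f0 sub0] mn.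
by exists K0, B0; split=> // K1 B1 f1 sub1; apply: (mn (K1, B1)); rewrite /P f1.
Qed.

Section Obstructed.
Hypothesis obs : forall a b, e a b -> exists p q, obstructing G a b p q.

(** A minimal pair [K0], [B0] with [K0] inside [K] gives a tadpole with end [x] in [nb K0]. Let [B']
    be the component of the complement of [nb K0] around [B]. If [x] borders on [B'], its tadpole
    can be prolonged through [B'] until it leaves [K]. *)
Lemma full_pair_tadpole K B : full_pair K B -> exists2 x, x \in nb K & Tad (mem K) x.
Proof.
have [m] := ubnP #|K|; elim: m => // m IH in K B *; rewrite ltnS => Km fKB.
have [K0 [B0 [f0 sub0 mn]]] := min_full_pair fKB (subxx K).
have compl := min_complete f0 sub0 mn.
have uns := min_unsplit f0 sub0 mn.
have [x xN Tx] := min_tadpole f0 compl uns (fun a b _ _ => @obs a b).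
have /and5P[cK cB dKB eK /andP[eB /eqP nKB]] := fKB.
have /and5P[cK0 cB0 dKB0 eK0 /andP[eB0 /eqP nKB0]] := f0.
have KK x' : x' \in K0 -> x' \in K by exact: (subsetP sub0).
have S0 s : s \in nb K0 -> (s \in K) || (s \in nb K).
  case/nbP=> _ [k kK0 ks]; have [//|sK] := boolP (s \in K).
  by apply/nbP; split=> //; exists k => //; exact: KK.
have BS0 : B \subset ~: nb K0.
  apply/subsetP=> s sB; rewrite in_setC; apply/negP=> /nbP[_ [k kK0 ks]].
  by have /andP[_] := full_pair_nadj fKB (KK _ kK0) sB; rewrite ks.
have [b [_ [bB _ _]]] := has_edgeP _ eB.
set D := ~: nb K0 in BS0; pose B' := component D b.
have bD : b \in D by exact: (subsetP BS0).
have bB' : b \in B' by exact: comp_self.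
have BB' : B \subset B' by apply: comp_max cB BS0 bB bB'.
have B'D : B' \subset D by exact: comp_sub.
have B'S0 s : s \in B' -> s \notin nb K0 by move/(subsetP B'D); rewrite in_setC.
have cB' : conn_set B' by exact: comp_conn.
have bK : b \notin K by rewrite (disjointFl dKB).
have K0B' s : s \in K0 -> s \notin B'.
  move=> sK0; apply/negP=> sB'; case/negP: bK; apply: KK; apply: (subsetP _ _ bB').
  apply: (conn_closed_sub cB' sB' sK0) => u v uK0 vB' uv.
  apply/negPn/negP=> vK0; case/negP: (B'S0 v vB'); apply/nbP; split=> //.
  by exists u.
have [xB'|xB'] := boolP (x \in nb B').
  have [xK|xK] := boolP (x \in K); last first.
    exists x; first by have := S0 x xN; rewrite (negbTE xK).
    by apply: Tad_sub Tx => y; exact: KK.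
  have [y yB' xy] : exists2 y, y \in B' & e x y by exact: (nb_adj).
  pose E := x |: B'.
  have xE : x \in E by exact: setU11.
  have xb : connect (within E) x b.
    apply: (@connect_trans _ _ y).
      by apply: connect1; rewrite /= xE in_setU yB' orbT.
    apply: (conn_mono (D := B')); first exact: subsetUr.
    exact: (conn_setP _ cB').
  have [z zE zK] : exists2 z, z \in component E x & z \in nb K.
    have [/exists_inP[z zE zK]|] := boolP [exists z in component E x, z \in nb K].
      by exists z.
    rewrite negb_exists_in => /forall_inP noz; exfalso; case/negP: bK.
    suff : b \in K :&: component E x by rewrite in_setI => /andP[].
    apply: (conn_closed _ xE _ xb); last by rewrite in_setI xK comp_self.
    move=> u v; rewrite !in_setI => /andP[uK uC] vE uv.
    have vC := comp_closed uC vE uv; rewrite vC andbT.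
    by apply/negPn/negP=> vK; case/negP: (noz v vC); apply/nbP; split=> //; exists u.
  (* A shortest path from [x] through [B'] to [nb K]: all its vertices before the last are in [K],
     and none but [x] sees [K0]. *)
  move: zE; rewrite inE => /andP[zE xz].
  have [q [l [ipq q0 qlK noq [qE qinj]]]] := conn_ipath (P := mem (nb K)) xE xz zK.
  have l0 : 0 < l.
    by case: (posnP l) qlK => // ->; rewrite q0 => /nbP[]; rewrite xK.
  have qB' i : 0 < i <= l -> q i \in B'.
    move=> /andP[i0 il]; have := qE i il; rewrite in_setU1 => /orP[/eqP E'|//].
    by have := qinj i 0 il (leq0n l); rewrite q0 => /(_ E') h; rewrite h in i0.
  have qK i : i < l -> q i \in K.
    elim: i => [|i IHi] il; first by rewrite q0.
    have := noq i.+1 il; apply: contraNT => nK; apply/nbP; split=> //.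
    by exists (q i); [exact/IHi/ltnW|rewrite ipq ?eqxx // ltnW // ltnW].
  have [two [k [t [tt t0 tK]]]] := Tx.
  have q0t : q 0 = t 0 by rewrite q0.
  exists (q l) => //; exists two, (k + l), (prepend q l t); split.
  - apply: (tad_prepend tt) => // i j il jk.
    have tj : t j \in K0 by exact: tK.
    have qi := qB' i il; split; first by move=> E'; have := K0B' _ tj; rewrite -E' qi.
    apply/negP=> qt; case/negP: (B'S0 _ qi); apply/nbP; split.
      by apply/negP=> /K0B'; rewrite qi.
    by exists (t j) => //; rewrite symG.
  - by rewrite /prepend l0 subn0.
  - move=> i ik; have [|[a [al -> iE]]|[a ak [-> _]]] := prependE (r := q) (m := l) (i := i) tt q0t.
    + by case/andP: ik.
    + by apply: qK; case/andP: ik => i0 _; rewrite ltn_neqAle al andbT; apply/eqP=> E'; move: i0; rewrite iE E' subnn.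
    + exact/KK/tK.
(* Now [B0] is not the component [B'], hence it is confined to [K] and misses [x]: it is smaller
   than [K]. By induction [B0] contains a tadpole with its end in [nb K0], which cannot coexist with
   that of [K0]. *)
have xB0 : x \in nb B0 by rewrite -nKB0.
have B0D : B0 \subset D.
  by apply/subsetP=> s sB0; rewrite in_setC nKB0; apply/negP=> /nbP[]; rewrite sB0.
have nxB' : x \notin B' by apply: contraL xN; exact: B'S0.
have nB' y : y \in B' -> ~~ e x y.
  move=> yB'; apply: contra xB' => xy; apply/nbP; split=> //; exists y => //.
  by rewrite symG.
have B0K s : s \in B0 -> s \notin nb K.
  move=> sB0; apply/negP; rewrite nKB => sN; have [b' bB2 sb] := nb_adj sN.
  have sB' : s \in B'.
    by apply: (comp_closed (u := b')); rewrite ?(subsetP BB') ?(subsetP B0D) 1?symG.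
  have sub := comp_max cB0 B0D sB0 sB'.
  have [y yB0 xy] := nb_adj xB0.
  by have := nB' y (subsetP sub y yB0); rewrite xy.
have xK : x \in K.
  have := S0 x xN; case/orP=> //; rewrite nKB => /(nb_adj)[y yB xy].
  by have := nB' y (subsetP BB' y yB); rewrite xy.
have [y yB0 xy] := nb_adj xB0.
have step u v : u \in K -> v \in B0 -> e u v -> v \in K.
  move=> uK vB0 uv; have := B0K v vB0; apply: contraNT => vK; apply/nbP.
  by split=> //; exists u.
have yK := step x y xK yB0 xy.
have subB0 : B0 \subset K by exact: (conn_closed_sub cB0 yB0 yK step).
have f0' : full_pair B0 K0 by rewrite full_pairC.
have [|v vN Tv] := IH B0 K0 _ f0'.
  apply: leq_trans Km; apply: proper_card; apply/properP; split=> //.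
  by exists x => //; case/nbP: xB0.
by rewrite -nKB0 in vN; case: (tadpoles_meet f0 compl xN Tx vN Tv).
Qed.

Lemma no_obstructed x y : ~ e x y.
Proof.
move=> xy.
have [/existsP[K /existsP[B fKB]]|] := boolP [exists K, exists B, full_pair K B].
  have [K0 [B0 [f0 sub0 mn]]] := min_full_pair fKB (subsetT K).
  have compl := min_complete f0 sub0 mn.
  have uns := min_unsplit f0 sub0 mn.
  have [u uN Tu] := min_tadpole f0 compl uns (fun a b _ _ => @obs a b).
  have f0' : full_pair B0 K0 by rewrite full_pairC.
  have [v vN Tv] := full_pair_tadpole f0'.
  have /and5P[_ _ _ _ /andP[_ /eqP nKB0]] := f0.
  by rewrite -nKB0 in vN; exact: (tadpoles_meet f0 compl uN Tu vN Tv).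
rewrite negb_exists => /forallP noF.
pose K := [set u | [exists v, e u v]].
have KP u v : e u v -> u \in K by move=> uv; rewrite inE; apply/existsP; exists v.
have xK := KP _ _ xy.
have [u|u v _|u _|s u|s s'|a a' b b' aK aK' bK bK' pa pa' ab ab'|s s' b b'||u] :=
    @base_tadpole K set0 x xK; rewrite ?in_set0 //.
- by rewrite inE => /existsP[v uv]; exists v => //; apply: (KP v u); rewrite symG.
- by rewrite symG orbF => /KP.
- apply/negPn/negP; rewrite negb_or => /andP[nab' nab].
  have /andP[aN bN] := split_edges pa pa' ab ab' nab' nab.
  have [cA eA] := pair_conn ab.
  have [A [fA _ _ _]] := full_pair_of_edge cA eA aN bN ab'.
  by have := noF A; rewrite negb_exists => /forallP/(_ (component (~: ([set a; b] :|: nb [set a; b])) a')); rewrite fA.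
- by move=> a b _ _; exact: obs.
Qed.

End Obstructed.

Lemma exists_simplicial : (exists x y, e x y) ->
  exists u v, e u v /\ signed_simplicial G part (u, v).
Proof.
move=> [x [y xy]].
have [/existsP[u /existsP[v /andP[uv /forallP h]]]|] := boolP [exists u, exists v,
    e u v && [forall p, forall q, ~~ obstructing G u v p q]].
  exists u, v; split=> //; apply: (unobstructed_simplicial sG bG (bG uv)) => p q.
  by have /forallP := h p.
rewrite negb_exists => /forallP no; exfalso; apply: (@no_obstructed _ x y xy) => a b ab.
have := no a; rewrite negb_exists => /forallP/(_ b); rewrite ab /=.
rewrite negb_forall => /existsP[p]; rewrite negb_forall => /existsP[q].
by rewrite negbK; exists p, q.
Qed.

End Core.

Theorem theorem5p1 (T : finType) (G : sgraph T) (part : T -> bool) :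
  signed_graph G -> is_bipartition G part ->
  (chordal G part <-> F_free G).
Proof.
move=> sG bG; split; first exact: chordal_F_free.
by apply: chordal_of_simplicial => // H sH bH; exact: exists_simplicial.
Qed.
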